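(* Let $n\ge1$ be an integer, let $V^{(n)}$ be the $n$-fold iterated Poisson process with intensity $\lambda>0$, let $p>1$, and let $J^{(n)}_p=\int_0^\infty\bigl(V^{(n)}_t+1\bigr)^{-p}\,dt$. Write $P_{n-1}:=\mathsf{P}\{Z_1^{(n-1)}\ge1\}$. Then the Laplace transform $\bar\psi^{(n)}_p(u)=\mathsf{E}\,e^{-uJ^{(n)}_p}$ and the probability density function $\psi^{(n)}_p$ of $J^{(n)}_p$ have the limit-series representations $$\bar\psi^{(n)}_p(u)=\lim_{K\to\infty}P_{n-1}^{-K}\sum_{z_1,\dots,z_K\in\mathbb{Z}_{++}}\Biggl(\prod_{k=1}^K\mathsf{P}\{Z_1^{(n-1)}=z_k\}\Biggr)\prod_{k=1}^K\Biggl(1+\frac{u}{\lambda P_{n-1}\bigl(\sum_{j=1}^{k-1}z_j+1\bigr)^p}\Biggr)^{-1},\qquad \mathrm{Re}\,u>-\lambda P_{n-1},$$ and, for $x>0$, $$\psi^{(n)}_p(x)=\lambda\lim_{K\to\infty}P_{n-1}^{1-K}\sum_{z_1,\dots,z_K\in\mathbb{Z}_{++}}\Biggl(\prod_{k=1}^K\mathsf{P}\{Z_1^{(n-1)}=z_k\}\Biggr)\sum_{k_1=1}^K\Biggl(\sum_{j=1}^{k_1-1}z_j+1\Biggr)^p\exp\Biggl(-\lambda P_{n-1}\Bigl(\sum_{j=1}^{k_1-1}z_j+1\Bigr)^px\Biggr)\prod_{\substack{k_2=1\\k_2\ne k_1}}^K\Biggl(1-\Biggl(\frac{\sum_{j=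1}^{k_1-1}z_j+1}{\sum_{j=1}^{k_2-1}z_j+1}\Biggr)^p\Biggr)^{-1}.$$
   Context: $\mathbb{Z}_{++}=\{1,2,\dots\}$; empty sums are $0$. Let $N^1,N^2,\dots,N^n$ be independent Poisson processes with the same intensity $\lambda>0$. The multiply iterated Poisson process (MIPP) is defined by $V^{(1)}_t=N^1_t$ and $V^{(m)}_t=N^m_{V^{(m-1)}_t}$ for $2\le m\le n$, $t\ge0$. The random variable $Z_1^{(n-1)}$ has the same distribution as $V^{(n-1)}_1$, with the convention $V^{(0)}_t=t$, so $Z_1^{(0)}\equiv1$. Thus the law of $Z^{(1)}_1$ is Poisson with parameter $\lambda$, and for $m\ge2$ $$\mathsf{P}\{V^{(m)}_t=k\}=\frac{\lambda^k}{k!}\sum_{j=0}^\infty j^ke^{-\lambda j}\,\mathsf{P}\{V^{(m-1)}_t=j\},\qquad k\in\{0,1,2,\dots\},$$ with $0^0=1$. The process $V^{(n)}$ is equal in law to the compound Poisson process with intensity $\lambda$ and i.i.d. jumps distributed as $Z_1^{(n-1)}$. *)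

(* Defs.v *)
From HB Require Import structures.
From mathcomp Require Import all_boot all_order all_algebra.
From mathcomp Require Import all_classical all_reals all_analysis.
From mathcomp Require Import measurable_realfun complex.
Set Implicit Arguments.
Unset Strict Implicit.
Unset Printing Implicit Defensive.
Import Order.TTheory GRing.Theory Num.Theory.
Import numFieldNormedType.Exports.
Local Open Scope classical_set_scope.
Local Open Scope ring_scope.
Local Open Scope complex_scope.

Section independence.
Context d (T : measurableType d) (R : realType) (P : probability T R).

Definition mutually_independent (I : finType) (F : I -> set (set T)) :=
  forall (J : {set I}) (A : I -> set T), (forall i, i \in J -> F i (A i)) ->
    P (\bigcap_(i in [set i | i \in J]) A i) = (\prod_(i in J) fine (P (A i)))%:E.

Definition process_sigma (X : R -> {RV P >-> nat}) : set (set T) :=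
  <<s \bigcup_(t in [set t | 0 <= t]) g_sigma_algebra_preimage (X t) >>.

End independence.

(* Only times t >= 0 are constrained; the values X t for t < 0 are irrelevant. *)
Record poisson_process d (T : measurableType d) (R : realType)
    (P : probability T R) (lambda : R) (X : R -> {RV P >-> nat}) : Prop := {
  pp_start : forall w, X 0 w = 0%N ;
  pp_nondecreasing : forall w s t, 0 <= s -> s <= t -> (X s w <= X t w)%N ;
  pp_right_continuous : forall w t, 0 <= t ->
    (X s w)%:R @[s --> t^'+] --> ((X t w)%:R : R) ;
  pp_independent_increments : forall (m : nat) (t : nat -> R), 0 <= t 0%N ->
    (forall i, (i < m)%N -> t i <= t i.+1) ->
    mutually_independent P (fun i : 'I_m =>
      g_sigma_algebra_preimage (fun w => (X (t i.+1) w - X (t i) w)%N)) ;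
  pp_poisson_increments : forall s t, 0 <= s -> s < t -> forall k : nat,
    P [set w | (X t w - X s w)%N = k] = (poisson_pmf (lambda * (t - s)) k)%:E }.

(* N i is the process N^i for i = 1, 2, ...; N 0 is not used. *)
Fixpoint mipp d (T : measurableType d) (R : realType) (P : probability T R)
    (N : nat -> R -> {RV P >-> nat}) (m : nat) (t : R) (w : T) : R :=
  if m is m'.+1 then (N m (mipp N m' t w) w)%:R else t.

Definition mipp_functional d (T : measurableType d) (R : realType)
    (P : probability T R) (N : nat -> R -> {RV P >-> nat}) (n : nat) (p : R)
    (w : T) : \bar R :=
  (\int[lebesgue_measure]_(t in `[0%R, +oo[) ((mipp N n t w + 1) `^ (- p))%:E)%E.

Section complex_random_variables.
Context d (T : measurableType d) (R : realType) (P : probability T R).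

Definition cintegrable (f : T -> R[i]) : Prop :=
  P.-integrable [set: T] (fun w => (complex.Re (f w))%:E) /\
  P.-integrable [set: T] (fun w => (complex.Im (f w))%:E).

Definition cexpectation (f : T -> R[i]) : R[i] :=
  fine ('E_P[fun w => complex.Re (f w)]) +i*
  fine ('E_P[fun w => complex.Im (f w)]).

Definition is_density (X : T -> R) (f : R -> R) : Prop :=
  [/\ measurable_fun [set: R] f,
      forall x, 0 <= f x
    & forall B : set R, measurable B ->
        P (X @^-1` B) = (\int[lebesgue_measure]_(x in B) (f x)%:E)%E].

End complex_random_variables.

Definition cexp (R : realType) (z : R[i]) : R[i] :=
  (expR (complex.Re z))%:C * (cos (complex.Im z) +i* sin (complex.Im z)).

Section absolutely_convergent_sums.
Context (R : realType) (I : choiceType).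

Definition rsummable (D : set I) (f : I -> R) : Prop :=
  summable D (fun i => (f i)%:E).

(* The sum of f over D; meaningful when rsummable D f holds. *)
Definition rsum (D : set I) (f : I -> R) : R :=
  fine (esum D (fun i => (f i)%:E)^\+ - esum D (fun i => (f i)%:E)^\-)%E.

Definition csummable (D : set I) (f : I -> R[i]) : Prop :=
  rsummable D (fun i => complex.Re (f i)) /\
  rsummable D (fun i => complex.Im (f i)).

Definition csum (D : set I) (f : I -> R[i]) : R[i] :=
  rsum D (fun i => complex.Re (f i)) +i* rsum D (fun i => complex.Im (f i)).

End absolutely_convergent_sums.

Section series_terms.
Context (R : realType) (K : nat).
Implicit Type z : {ffun 'I_K -> nat}.

(* Indices are shifted by one: z k stands for z_{k+1}, k = 0, ..., K-1. *)
Definition positive_multiindices : set {ffun 'I_K -> nat} :=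
  [set z | forall k, (1 <= z k)%N].

Definition level z (k : 'I_K) : R := (\sum_(j < K | (j < k)%N) z j + 1)%N%:R.

(* a is lambda * P_{n-1} and q the probability mass function of Z_1^{(n-1)}. *)
Definition laplace_term (a p : R) (q : nat -> R) (u : R[i]) z : R[i] :=
  (\prod_(k < K) q (z k))%:C *
  \prod_(k < K) (1 + u / (a * level z k `^ p)%:C)^-1.

Definition density_term (a p : R) (q : nat -> R) (x : R) z : R :=
  (\prod_(k < K) q (z k)) *
  \sum_(k1 < K) (level z k1 `^ p * expR (- (a * level z k1 `^ p * x)) *
    \prod_(k2 < K | k2 != k1) (1 - (level z k1 / level z k2) `^ p)^-1).

End series_terms.

Arguments positive_multiindices K : clear implicits.

(* Main.v *)
Require Import Defs.
From HB Require Import structures.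
From mathcomp Require Import all_boot all_order all_algebra.
From mathcomp Require Import all_classical all_reals all_analysis.
From mathcomp Require Import measurable_realfun complex ring lra.
Set Implicit Arguments.
Unset Strict Implicit.
Unset Printing Implicit Defensive.
Import Order.TTheory GRing.Theory Num.Theory.
Import numFieldNormedType.Exports.
Local Open Scope classical_set_scope.
Local Open Scope ring_scope.
Local Open Scope complex_scope.

(** Put a = lambda * P_{n-1} and let r be the law of the jumps of the iterated
    process conditioned to be positive.  Watched only when it moves, the process
    visits the levels 1, 1 + z_1, 1 + z_1 + z_2 and so on, with independent
    increments z_k of law r, and it stays at each level for an independent
    exponential time of rate a.  Hence J is the sum of independent exponential
    variables whose rates a * level ^ p are random but distinct.  The K-th member
    of either sequence in the theorem is the Laplace transform, or the density,
    of the first K terms of this sum, averaged over the levels; the power of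
    P_{n-1} in front turns the weights of the jump law into those of r.

    That this description is correct is established through Laplace transforms.
    Let phi l be the mean of exp (- u J) for the process lifted to start at
    level l.  When the time integral is replaced by a Riemann sum of mesh h,
    phi l becomes the survival probability of a killed random walk, because the
    increments of the iterated process over the grid are independent
    ([grid_prob], [grid_mean]).  The first order expansion in h of one step of
    this walk gives in the limit
    (a l^p + u) phi l = a l^p * (sum over k of r k * phi (l + k))
    ([laplace_equation], [conditioned_laplace_equation]).  Since p > 1, the
    series of l^(-p) converges, which keeps the killing of the walk started at l
    below a constant times u * l^(1 - p) ([iter_walk_lower]); so phi l tends to 1 as
    l grows, and J is almost surely finite.  Iterating the equation K times from
    level 1 writes phi 1 as an average of a product of K factors b / (b + u) times
    the value of phi at a level beyond K, which proves the first limit for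
    u > 0 ([mean_rate_factor_cvg]).

    On the side of densities, expansion in partial fractions makes the density of
    a sum of exponential variables explicit ([hypoexp_pdf]).  That density is a
    times the difference of two tail probabilities, both of which increase with
    the number of terms; hence the averaged densities converge pointwise
    ([cvg_mean_pdf]).  Exponential tilting bounds them by a constant times
    exp (- c x) for each c < a, uniformly in K ([mean_pdf_bound]).  By dominated
    convergence the limit has Laplace transform phi 1, hence is the density of J
    ([density_of_laplace], [functional_density]), and the same domination gives
    the complex transforms on the whole half-plane Re u > - a
    ([osc_mean_cvg], [laplace_limit_cvg]). *)

(** * Partial fractions and sums of independent exponential variables *)

Section partial_fractions.
Context (F : fieldType).
Implicit Types (s : seq F) (a b t : F).

(** The coefficient of the rate b in the decomposition into partial fractions
    of the product of the c / (c - t) over s. *)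
Definition pf_weight s b : F := \prod_(c <- s | c != b) (c / (c - b)).

Lemma pf_weight_cons a s b : a != b ->
  pf_weight (a :: s) b = a / (a - b) * pf_weight s b.
Proof. by move=> ab; rewrite /pf_weight big_cons ab. Qed.

Lemma pf_weight_head a s : a \notin s ->
  pf_weight (a :: s) a = \prod_(c <- s) (c / (c - a)).
Proof.
move=> as_; rewrite /pf_weight big_cons eqxx big_seq_cond [RHS]big_seq_cond.
apply: eq_bigl => c; rewrite andbT; case: (boolP (c \in s)) => //= cs.
by apply: contraNneq as_ => <-.
Qed.

(** By induction on s.  Adding a rate a multiplies each weight by a / (a - b),
    and a / ((a - b) (b - t)) splits into a difference of simple fractions at
    t and at a; the induction hypothesis is used at both points. *)
Lemma partial_fractions s t : s != [::] -> uniq s -> t \notin s ->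
  \sum_(b <- s) b / (b - t) * pf_weight s b = \prod_(c <- s) (c / (c - t)).
Proof.
elim: s t => // a [|a' s] IH t _.
  move=> _; rewrite inE => ta.
  by rewrite !big_seq1 pf_weight_head// big_nil mulr1.
set s' := a' :: s in IH *.
rewrite cons_uniq (in_cons a s' t) negb_or => /andP[as_ us] /andP[ta ts].
rewrite [LHS]big_cons pf_weight_head// [RHS]big_cons -[in RHS]IH//.
have at0 : a - t != 0 by rewrite subr_eq0 eq_sym.
have -> : \sum_(b <- s') b / (b - t) * pf_weight (a :: s') b =
  a / (a - t) * (\sum_(b <- s') b / (b - t) * pf_weight s' b -
                 \sum_(b <- s') b / (b - a) * pf_weight s' b).
  rewrite -sumrB big_distrr/= big_seq [RHS]big_seq; apply: eq_bigr => b bs.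
  have ab : a != b by apply: contraNneq as_ => ->.
  rewrite pf_weight_cons//.
  have bt0 : b - t != 0 by rewrite subr_eq0; apply: contraNneq ts => <-.
  have ab0 : a - b != 0 by rewrite subr_eq0.
  have ba0 : b - a != 0 by rewrite subr_eq0 eq_sym.
  by field; rewrite ba0 bt0 at0 ab0.
by rewrite -IH// mulrBr addrC subrK.
Qed.

End partial_fractions.

Section hypoexponential.
Context (R : realType).
Implicit Types (s : seq R) (a b x : R).

(** For distinct positive rates s, the density at x of a sum of independent
    exponential variables with these rates. *)
Definition hypoexp_pdf s x : R :=
  \sum_(b <- s) b * expR (- (b * x)) * pf_weight s b.
(** For distinct positive rates s, the probability that this sum exceeds x. *)
Definition hypoexp_tail s x : R :=
  \sum_(b <- s) expR (- (b * x)) * pf_weight s b.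

Lemma perm_pf_weight s s' b : perm_eq s s' -> pf_weight s b = pf_weight s' b.
Proof. exact: perm_big. Qed.

Lemma perm_hypoexp_pdf s s' x : perm_eq s s' ->
  hypoexp_pdf s x = hypoexp_pdf s' x.
Proof.
move=> ss'; rewrite /hypoexp_pdf (perm_big _ ss')/=.
by apply: eq_bigr => b _; rewrite (perm_pf_weight _ ss').
Qed.

Lemma perm_hypoexp_tail s s' x : perm_eq s s' ->
  hypoexp_tail s x = hypoexp_tail s' x.
Proof.
move=> ss'; rewrite /hypoexp_tail (perm_big _ ss')/=.
by apply: eq_bigr => b _; rewrite (perm_pf_weight _ ss').
Qed.

(** If E is exponential of rate a and Y is the sum for s, the density of Y + E
    at x is a times the probability of Y <= x < Y + E. *)
Lemma hypoexp_pdf_cons a s x : a \notin s ->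
  hypoexp_pdf (a :: s) x = a * (hypoexp_tail (a :: s) x - hypoexp_tail s x).
Proof.
move=> as_; rewrite /hypoexp_pdf /hypoexp_tail !big_cons -addrA mulrDr mulrA.
congr (_ + _); rewrite -sumrB big_distrr/= big_seq [RHS]big_seq.
apply: eq_bigr => b bs.
have ab : a != b by apply: contraNneq as_ => ->.
have ab0 : a - b != 0 by rewrite subr_eq0.
by rewrite pf_weight_cons//; field.
Qed.

(** This is the partial fraction identity at t = 0. *)
Lemma hypoexp_tail0 s : s != [::] -> uniq s -> 0 \notin s -> hypoexp_tail s 0 = 1.
Proof.
move=> s0 us s0'; have nz b : b \in s -> b / (b - 0) = 1.
  by move=> bs; rewrite subr0 divff//; apply: contraNneq s0' => <-.
have := partial_fractions s0 us s0'.
rewrite [X in _ = X -> _]big1_seq; last by move=> b /andP[_]; exact: nz.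
move=> <-; rewrite /hypoexp_tail big_seq [RHS]big_seq; apply: eq_bigr => b bs.
by rewrite nz// mulr0 oppr0 expR0.
Qed.

Lemma is_derive_sum_seq (I : eqType) (r : seq I) (f df : I -> R -> R) x :
  (forall i, i \in r -> is_derive x 1 (f i) (df i x)) ->
  is_derive x 1 (fun y => \sum_(i <- r) f i y) (\sum_(i <- r) df i x).
Proof.
elim: r => [_|i r IH H].
  rewrite (_ : (fun _ => _) = cst 0); last by apply/funext => y; rewrite big_nil.
  by rewrite big_nil; exact: is_derive_cst.
rewrite (_ : (fun _ => _) = f i \+ (fun y => \sum_(i <- r) f i y)); last first.
  by apply/funext => y; rewrite big_cons.
rewrite big_cons; apply: is_deriveD; first by apply: H; rewrite mem_head.
by apply: IH => j jr; apply: H; rewrite inE jr orbT.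
Qed.

Lemma is_derive_mulrl (k : R) (f : R -> R) (df x : R) :
  is_derive x 1 f df -> is_derive x 1 (fun y => k * f y) (k * df).
Proof. exact: is_deriveZ. Qed.

Lemma is_derive_add (f g : R -> R) (df dg x : R) : is_derive x 1 f df ->
  is_derive x 1 g dg -> is_derive x 1 (fun y => f y + g y) (df + dg).
Proof. exact: is_deriveD. Qed.

Lemma is_derive_expRM (k x : R) :
  is_derive x 1 (fun y => expR (k * y)) (k * expR (k * x)).
Proof.
have dk : is_derive x 1 (fun y : R => k * y) k.
  by rewrite -[k in X in is_derive _ _ _ X]mulr1; exact: is_derive_mulrl.
by rewrite [X in is_derive _ _ _ X]mulrC; exact: is_derive1_comp.
Qed.

Lemma is_derive_hypoexp_tail s x :
  is_derive x 1 (hypoexp_tail s) (- hypoexp_pdf s x).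
Proof.
rewrite /hypoexp_tail /hypoexp_pdf -sumrN.
apply: (@is_derive_sum_seq _ _ (fun b y => expR (- (b * y)) * pf_weight s b)
  (fun b y => - (b * expR (- (b * y)) * pf_weight s b))) => b _.
have := is_derive_mulrl (pf_weight s b) (is_derive_expRM (- b) x).
rewrite (_ : (fun _ => _) = (fun y => expR (- (b * y)) * pf_weight s b)).
  by rewrite [X in is_derive _ _ _ X]mulrC !mulNr.
by apply/funext => y; rewrite mulNr mulrC.
Qed.

(** By the previous identities, expR (a * y) * hypoexp_pdf (a :: s) y vanishes
    at 0 and has derivative a * expR (a * y) * hypoexp_pdf s y, which is
    nonnegative by induction. *)
Lemma hypoexp_pdf_ge0 s x : uniq s -> all (fun b => 0 < b) s -> 0 <= x ->
  0 <= hypoexp_pdf s x.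
Proof.
elim: s x => [|a [|a' s] IH] x; first by rewrite /hypoexp_pdf big_nil.
  move=> _ /= /andP[a0 _] _; rewrite /hypoexp_pdf big_seq1 pf_weight_head//.
  by rewrite big_nil mulr1 mulr_ge0 ?expR_ge0// ltW.
set s' := a' :: s in IH *.
rewrite cons_uniq => /andP[as_ us] /andP[a0 ps] x0.
pose G y := expR (a * y) * hypoexp_pdf (a :: s') y.
have as0 : 0 \notin a :: s'.
  have : all (fun b => 0 < b) (a :: s') by rewrite /= a0.
  by move=> /allP p; apply/negP => /p; rewrite ltxx.
have s0 : 0 \notin s' by apply: contra as0 => s0; rewrite in_cons s0 orbT.
have G0 : G 0 = 0.
  by rewrite /G hypoexp_pdf_cons// !hypoexp_tail0//= ?as_// subrr !mulr0.
have dG (y : R) : is_derive y 1 G (a * expR (a * y) * hypoexp_pdf s' y).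
  have H1 := is_deriveB (is_derive_hypoexp_tail (a :: s') y)
                        (is_derive_hypoexp_tail s' y).
  have H2 := is_deriveM (is_derive_expRM a y) (is_deriveZ a H1).
  have GE : G = (fun y => expR (a * y)) *
                (a \*: (hypoexp_tail (a :: s') - hypoexp_tail s')).
    by apply/funext => z; rewrite /G hypoexp_pdf_cons.
  rewrite GE; apply: is_derive_eq H2 _.
  rewrite /= hypoexp_pdf_cons// /GRing.scale/=.
  by rewrite -[(_ - _) y]/(hypoexp_tail (a :: s') y - hypoexp_tail s' y); ring.
have : G 0 <= G x.
  apply: (@ger0_derive1_le_cc _ G 0 x) => //.
  - move=> y; rewrite in_itv/= => /andP[y0 _].
    rewrite derive1E (derive_val (is_derive := dG y)).
    by rewrite !mulr_ge0 ?expR_ge0 ?(ltW a0)// IH// ltW.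
  - by apply: derivable_within_continuous => y _; case: (dG y).
  - by rewrite in_itv/= lexx.
  - by rewrite in_itv/= lexx x0.
by rewrite G0 /G pmulr_rge0// expR_gt0.
Qed.

Lemma hypoexp_tail_ge0 s x : uniq s -> all (fun b => 0 < b) s -> 0 <= x ->
  0 <= hypoexp_tail s x.
Proof.
elim: s => [|a s IH]; first by rewrite /hypoexp_tail big_nil.
move=> uas pas x0; have := hypoexp_pdf_ge0 uas pas x0.
move: uas pas; rewrite cons_uniq => /andP[as_ us] /= /andP[a0 ps].
by rewrite hypoexp_pdf_cons// pmulr_rge0// subr_ge0; apply: le_trans; exact: IH.
Qed.

Lemma hypoexp_tail_le1 s x : uniq s -> all (fun b => 0 < b) s -> 0 <= x ->
  hypoexp_tail s x <= 1.
Proof.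
case: s => [|a s]; first by rewrite /hypoexp_tail big_nil.
move=> us ps x0.
have s0 : 0 \notin a :: s.
  by apply/negP => /(allP ps)/=; rewrite ltxx.
rewrite -(hypoexp_tail0 _ us s0)//.
apply: (@ler0_derive1_le_cc _ (hypoexp_tail (a :: s)) 0 x) => //.
- by move=> y _; case: (is_derive_hypoexp_tail (a :: s) y).
- move=> y; rewrite in_itv/= => /andP[y0 _].
  rewrite derive1E (derive_val (is_derive := is_derive_hypoexp_tail (a :: s) y)).
  by rewrite oppr_le0 hypoexp_pdf_ge0// ltW.
- apply: derivable_within_continuous => y _.
  by case: (is_derive_hypoexp_tail (a :: s) y).
- by rewrite in_itv/= lexx x0.
- by rewrite in_itv/= lexx x0.
Qed.

(** The value does not depend on the order of the rates; with b in front it is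
    b times a difference of tails, which lie between 0 and 1. *)
Lemma hypoexp_pdf_le s b x : uniq s -> all (fun c => 0 < c) s -> 0 <= x ->
  b \in s -> hypoexp_pdf s x <= b.
Proof.
move=> us ps x0 bs; have sE := perm_to_rem bs.
rewrite (perm_hypoexp_pdf _ sE).
move: us ps; rewrite (perm_uniq sE) (perm_all _ sE) => ubs pbs.
move: (ubs) (pbs); rewrite cons_uniq => /andP[bs' us] /= /andP[b0 ps].
rewrite hypoexp_pdf_cons// -[leRHS]mulr1 ler_pM2l//.
rewrite lerBlDr (le_trans (hypoexp_tail_le1 ubs pbs x0))// lerDl.
exact: hypoexp_tail_ge0.
Qed.

(** Exponential tilting by c replaces each rate b by b - c, up to the value at
    - c of the Laplace transform. *)
Lemma hypoexp_pdf_tilt s c x : uniq s -> c \notin s ->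
  expR (c * x) * hypoexp_pdf s x =
  \prod_(b <- s) (b / (b - c)) * hypoexp_pdf [seq b - c | b <- s] x.
Proof.
move=> us cs; rewrite /hypoexp_pdf big_map !big_distrr/= big_seq [RHS]big_seq.
apply: eq_bigr => b bs.
have bc : b - c != 0 by rewrite subr_eq0; apply: contraNneq cs => <-.
have key : b * pf_weight s b = \prod_(d <- s) (d / (d - c)) *
    ((b - c) * pf_weight [seq d - c | d <- s] (b - c)).
  rewrite /pf_weight big_map (bigD1_seq b)//=.
  under [X in _ = _ * (_ * X)]eq_bigl do rewrite (inj_eq (@subIr _ c)).
  rewrite mulrACA divfK// -big_split/=; congr (_ * _).
  rewrite big_seq_cond [RHS]big_seq_cond; apply: eq_bigr => d /andP[ds db].
  have dc : d - c != 0 by rewrite subr_eq0; apply: contraNneq cs => <-.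
  have db' : d - b != 0 by rewrite subr_eq0.
  have -> : d - c - (b - c) = d - b by ring.
  by field; rewrite dc db'.
have -> : - ((b - c) * x) = c * x + - (b * x) by ring.
rewrite expRD; transitivity
  (expR (c * x) * expR (- (b * x)) * (b * pf_weight s b)); first by ring.
by rewrite key; ring.
Qed.

Lemma hypoexp_pdf_exp_bound s b c x : uniq s -> all (fun d => c < d) s ->
  0 <= c -> 0 <= x -> b \in s ->
  hypoexp_pdf s x <= b * \prod_(d <- s) (d / (d - c)) * expR (- (c * x)).
Proof.
move=> us cs c0 x0 bs.
have cs' : c \notin s by apply/negP => /(allP cs)/=; rewrite ltxx.
rewrite -(ler_pM2l (expR_gt0 (c * x))) hypoexp_pdf_tilt// mulrCA -expRD.
rewrite subrr expR0 mulr1 [leRHS]mulrC; apply: ler_wpM2l.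
  rewrite big_seq; apply: prodr_ge0 => d ds; have := allP cs _ ds => /= cd.
  by rewrite divr_ge0 ?subr_ge0 ?(ltW cd)// (le_trans c0)// ltW.
apply: (@le_trans _ _ (b - c)); last by rewrite lerBlDr lerDl.
apply: hypoexp_pdf_le => //.
- by rewrite map_inj_uniq//; exact: subIr.
- by rewrite all_map; apply/allP => d /(allP cs)/=; rewrite subr_gt0.
- exact: (map_f (fun d => d - c)) bs.
Qed.

End hypoexponential.

(** * Laplace transforms of these sums *)

Section laplace_transform.
Context (R : realType).
Notation mu := (@lebesgue_measure R).
Implicit Types (b c d w x v : R).

(** Integrals of a complex exponential are differences of integrals of such
    kernels, for (c, d) equal to (1, 0), (0, 1) and (0, 0).  Under the bound
    of [osc_bound] the kernel is nonnegative, so that sums and integrals are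
    exchanged by Tonelli's theorem. *)
Definition osc c d w x : R := 1 + (c * cos (w * x) + d * sin (w * x)).
Definition osc_laplace c d w b : R := b^-1 + (b * c + w * d) / (b ^+ 2 + w ^+ 2).

Lemma osc_bound c d w x : `|c| + `|d| <= 1 -> 0 <= osc c d w x <= 2.
Proof.
move=> cd; rewrite /osc.
have : `|c * cos (w * x) + d * sin (w * x)| <= 1.
  rewrite (le_trans (ler_normD _ _))// (le_trans _ cd)// !normrM lerD//.
    by rewrite ler_piMr// ler_norml cos_geN1 cos_le1.
  by rewrite ler_piMr// ler_norml sin_geN1 sin_le1.
by rewrite ler_norml => /andP[? ?]; apply/andP; split; lra.
Qed.

Lemma continuous_osc c d w : continuous (osc c d w).
Proof.
move=> x; apply: cvgD; first exact: cvg_cst.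
have cw : w * y @[y --> x] --> w * x by exact: mulrl_continuous.
apply: cvgD; apply: cvgM; try exact: cvg_cst.
  by apply: (cvg_comp _ cos cw); exact: continuous_cos.
by apply: (cvg_comp _ sin cw); exact: continuous_sin.
Qed.

Lemma continuous_expRM b : continuous (fun x : R => expR (- (b * x))).
Proof.
move=> x; apply: (@continuous_comp _ _ _ (fun y => - (b * y)) expR).
  by apply: cvgN; exact: mulrl_continuous.
exact: continuous_expR.
Qed.

Lemma measurable_osc c d w D : measurable_fun D (osc c d w).
Proof. by apply: measurable_funTS; apply: continuous_measurable_fun; exact: continuous_osc. Qed.

Lemma measurable_expRM b D : measurable_fun D (fun x : R => expR (- (b * x))).
Proof. by apply: measurable_funTS; apply: continuous_measurable_fun; exact: continuous_expRM. Qed.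

Lemma cvgy_expRM b : 0 < b -> expR (- (b * x)) @[x --> +oo%R] --> (0 : R).
Proof.
move=> b0; apply: (@cvg_comp _ _ _ (fun x => b * x) (fun y => expR (- y)) _ (pinfty_nbhs R)); last exact: cvgr_expR.
exact: gt0_cvgMry.
Qed.

Lemma integral_expR_osc c d w b : `|c| + `|d| <= 1 -> 0 < b ->
  (\int[mu]_(x in `[0%R, +oo[) (expR (- (b * x)) * osc c d w x)%:E =
   (osc_laplace c d w b)%:E)%E.
Proof.
move=> cd b0.
have bw0 : b ^+ 2 + w ^+ 2 != 0 by rewrite gt_eqF// ltr_pwDl ?sqr_ge0 ?exprn_gt0.
(* A and B are chosen so that F is the primitive that vanishes at infinity. *)
pose A := - (b * c + w * d) / (b ^+ 2 + w ^+ 2).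
pose B := (w * c - b * d) / (b ^+ 2 + w ^+ 2).
pose H x := - b^-1 + (A * cos (w * x) + B * sin (w * x)).
pose F x := expR (- (b * x)) * H x.
have dw (x : R) : is_derive x 1 (fun y : R => w * y) w.
  by rewrite -[w in X in is_derive _ _ _ X]mulr1; exact: is_derive_mulrl.
have dH (x : R) : is_derive x 1 H (A * (- sin (w * x) * w) + B * (cos (w * x) * w)).
  rewrite -[X in is_derive _ _ _ X]add0r.
  exact: is_derive_add.
have dF (x : R) : is_derive x 1 F (expR (- (b * x)) * osc c d w x).
  have := is_deriveM (is_derive_expRM (- b) x) (dH x).
  rewrite (_ : _ * H = F); last by apply/funext => y; rewrite /F -mulNr.
  move=> h; apply: is_derive_eq h _; rewrite /GRing.scale/= mulNr /H /osc /A /B.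
  by field; rewrite bw0 gt_eqF.
have cF : continuous F by move=> x; apply/differentiable_continuous/derivable1_diffP; case: (dF x).
rewrite (@ge0_continuous_FTC2y _ _ F _ 0).
- rewrite sub0e -EFinN /F /H !mulr0 oppr0 expR0 mul1r cos0 sin0 mulr0 addr0 mulr1.
  by rewrite /osc_laplace /A; congr (_%:E); field; rewrite bw0 gt_eqF.
- by move=> x _; rewrite mulr_ge0 ?expR_ge0//; case/andP: (osc_bound w x cd).
- apply: continuous_subspaceT => x; apply: cvgM; first exact: continuous_expRM.
  exact: continuous_osc.
- pose M := b^-1 + `|A| + `|B|.
  have FM x : `|F x| <= M * expR (- (b * x)).
    rewrite /F normrM mulrC (ger0_norm (expR_ge0 _)) ler_wpM2r ?expR_ge0//.
    rewrite /H (le_trans (ler_normD _ _))// normrN (@ger0_norm _ b^-1) ?invr_ge0 ?(ltW b0)//.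
    rewrite /M -addrA lerD2l// (le_trans (ler_normD _ _))// !normrM lerD//.
      by rewrite ler_piMr// ler_norml cos_geN1 cos_le1.
    by rewrite ler_piMr// ler_norml sin_geN1 sin_le1.
  apply: norm_cvg0; apply: (@squeeze_cvgr _ _ _ _ (cst 0) (fun x => M * expR (- (b * x)))).
  + by apply: nearW => x; rewrite normr_ge0 FM.
  + exact: cvg_cst.
  + by rewrite -[X in _ --> X](mulr0 M); apply: cvgMr; exact: cvgy_expRM.
- by move=> x _; case: (dF x).
- by apply: cvg_at_right_filter; exact: cF.
- by move=> x _; rewrite derive1E; exact: (derive_val (is_derive := dF x)).
Qed.

End laplace_transform.

Section integral_lincomb.
Context d (T : measurableType d) (R : realType) (mu : {measure set T -> \bar R}).
Local Open Scope ereal_scope.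

Lemma integral_lincomb (I : eqType) (r : seq I) (D : set T) (c : I -> R) (f : I -> T -> R) (l : I -> R) :
  measurable D ->
  (forall i, i \in r -> mu.-integrable D (EFin \o f i)) ->
  (forall i, i \in r -> \int[mu]_(x in D) (f i x)%:E = (l i)%:E) ->
  mu.-integrable D (fun x => (\sum_(i <- r) c i * f i x)%:E) /\
  \int[mu]_(x in D) (\sum_(i <- r) c i * f i x)%R%:E = (\sum_(i <- r) c i * l i)%R%:E.
Proof.
move=> mD; elim: r => [_ _|i r IH fi li].
  under eq_fun do rewrite big_nil; split; first exact: integrable0.
  by rewrite integral0 big_nil.
have [||IH1 IH2] := IH.
- by move=> j jr; apply: fi; rewrite inE jr orbT.
- by move=> j jr; apply: li; rewrite inE jr orbT.
have ii : mu.-integrable D (fun x => (c i * f i x)%:E).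
  under eq_fun do rewrite EFinM; apply: integrableZl => //.
  by apply: fi; rewrite mem_head.
under eq_fun do rewrite big_cons EFinD.
split; first exact: integrableD.
rewrite integralD// IH2 big_cons EFinD; congr (_ + _).
under eq_integral do rewrite EFinM.
rewrite integralZl//; last by apply: fi; rewrite mem_head.
by rewrite li ?mem_head// EFinM.
Qed.

End integral_lincomb.

Section hypoexp_laplace.
Context (R : realType).
Notation mu := (@lebesgue_measure R).

Lemma integrable_expR_osc (c d w b : R) : `|c| + `|d| <= 1 -> 0 < b ->
  mu.-integrable `[0, +oo[ (fun x => (expR (- (b * x)) * osc c d w x)%:E).
Proof.
move=> cd b0; apply/integrableP; split.
  apply/measurable_EFinP; apply: measurable_funM.
    exact: measurable_expRM.
  exact: measurable_osc.
under eq_integral => x _.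
  rewrite gee0_abs; last first.
    by rewrite lee_fin mulr_ge0 ?expR_ge0//; case/andP: (osc_bound w x cd).
  over.
by rewrite integral_expR_osc// ltry.
Qed.

Lemma Re_sum (I : Type) (r : seq I) (f : I -> R[i]) :
  complex.Re (\sum_(i <- r) f i) = \sum_(i <- r) complex.Re (f i).
Proof. by apply: (big_morph (@complex.Re R)) => //; case=> [? ?] [? ?]. Qed.

Lemma Im_sum (I : Type) (r : seq I) (f : I -> R[i]) :
  complex.Im (\sum_(i <- r) f i) = \sum_(i <- r) complex.Im (f i).
Proof. by apply: (big_morph (@complex.Im R)) => //; case=> [? ?] [? ?]. Qed.

Lemma Re_realM (k : R) (z : R[i]) : complex.Re (k%:C * z) = k * complex.Re z.
Proof. by case: z => x y; rewrite /= mul0r subr0. Qed.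

Lemma Im_realM (k : R) (z : R[i]) : complex.Im (k%:C * z) = k * complex.Im z.
Proof. by case: z => x y; rewrite /= mul0r addr0. Qed.

Lemma pf_weight_map (F K : fieldType) (f : {rmorphism F -> K}) s b :
  pf_weight (map f s) (f b) = f (pf_weight s b).
Proof.
rewrite /pf_weight big_map rmorph_prod.
by apply: eq_big => [d|d _]; rewrite ?(inj_eq (fmorph_inj f))// fmorph_div rmorphB.
Qed.

Lemma osc_laplaceE (c d b : R) (u : R[i]) :
  osc_laplace c d (- complex.Im u) (b + complex.Re u) =
  (b + complex.Re u)^-1 + (c * complex.Re (b%:C + u)^-1 + d * complex.Im (b%:C + u)^-1).
Proof.
case: u => v w /=; rewrite /osc_laplace add0r sqrrN; congr (_ + _).
by rewrite mulrDl; congr (_ + _); ring.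
Qed.

(** Integration term by term leaves two sums over the rates, one real and one
    complex, which the partial fraction identity evaluates at the opposites of
    Re u and of u. *)
Lemma hypoexp_laplace (s : seq R) (u : R[i]) (c d : R) :
  s != [::] -> uniq s -> `|c| + `|d| <= 1 -> all (fun b => 0 < b + complex.Re u) s ->
  let Q := \prod_(b <- s) (b%:C / (b%:C + u)) in
  mu.-integrable `[0, +oo[ (fun x =>
    (expR (- (complex.Re u * x)) * osc c d (- complex.Im u) x * hypoexp_pdf s x)%:E) /\
  (\int[mu]_(x in `[0%R, +oo[)
    (expR (- (complex.Re u * x)) * osc c d (- complex.Im u) x * hypoexp_pdf s x)%:E =
  (\prod_(b <- s) (b / (b + complex.Re u)) + (c * complex.Re Q + d * complex.Im Q))%:E)%E.
Proof.
move=> s0 us cd /allP su Q; set v := complex.Re u; set w := - complex.Im u.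
have E x : expR (- (v * x)) * osc c d w x * hypoexp_pdf s x =
    \sum_(b <- s) (b * pf_weight s b) * (expR (- ((b + v) * x)) * osc c d w x).
  rewrite /hypoexp_pdf big_distrr/=; apply: eq_bigr => b _.
  by rewrite mulrDl opprD expRD; ring.
rewrite (_ : (fun x : R => _%:E) = (fun x => (\sum_(b <- s) (b * pf_weight s b) *
  (expR (- ((b + v) * x)) * osc c d w x))%:E)); last first.
  by apply/funext => x; rewrite E.
have [|||-> ->] := @integral_lincomb _ _ _ mu _ s `[0, +oo[%classic
    (fun b => b * pf_weight s b) (fun b x => expR (- ((b + v) * x)) * osc c d w x)
    (fun b => osc_laplace c d w (b + v)) _ _ _ => //.
- by move=> b /su bs; exact: integrable_expR_osc.
- by move=> b /su bs; exact: integral_expR_osc.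
split => //; congr (_%:E).
transitivity (\sum_(b <- s) (b / (b - (- v)) * pf_weight s b) +
  (c * complex.Re (\sum_(b <- [seq b%:C | b <- s]) b / (b - (- u)) * pf_weight [seq b%:C | b <- s] b) +
   d * complex.Im (\sum_(b <- [seq b%:C | b <- s]) b / (b - (- u)) * pf_weight [seq b%:C | b <- s] b))).
  rewrite big_map Re_sum Im_sum !big_distrr/= -!big_split/=.
  apply: eq_bigr => b _; rewrite osc_laplaceE pf_weight_map !opprK.
  rewrite [_ / _ * (pf_weight s b)%:C]mulrAC -rmorphM/= Re_realM Im_realM.
  by rewrite -/v; ring.
rewrite !partial_fractions//.
- rewrite big_map; congr (_ + (c * complex.Re _ + d * complex.Im _)).
  + by apply: eq_bigr => b _; rewrite opprK.
  + by apply: eq_bigr => b _; rewrite opprK.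
  + by apply: eq_bigr => b _; rewrite opprK.
- by apply: contra s0; case: (s).
- by rewrite map_inj_uniq//; exact: complexI.
- apply/negP => /mapP[b /su bs uE]; move: bs.
  by rewrite (_ : u = - b%:C) /= ?addrN ?ltxx// -uE opprK.
- by apply/negP => /su; rewrite addNr ltxx.
Qed.

End hypoexp_laplace.

(** * Laplace transforms determine densities *)

Section dominated.
Context d (T : measurableType d) (R : realType) (mu : {measure set T -> \bar R}).

Lemma dominated_cvg_real (D : set T) (f_ : nat -> T -> R) (f g : T -> R) :
  measurable D -> (forall n, measurable_fun D (f_ n)) -> measurable_fun D f ->
  (forall x, D x -> f_ n x @[n --> \oo] --> f x) ->
  mu.-integrable D (fun x => (g x)%:E) ->
  (forall x n, D x -> `|f_ n x| <= g x) ->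
  mu.-integrable D (fun x => (f x)%:E) /\
  (\int[mu]_(x in D) (f_ n x)%:E @[n --> \oo] --> \int[mu]_(x in D) (f x)%:E)%E.
Proof.
move=> mD mf_ mf cf ig fg.
have [] := @dominated_convergence _ T R mu D mD (fun n x => (f_ n x)%:E)
    (fun x => (f x)%:E) (fun x => (g x)%:E) _ _ _ ig _.
- by move=> n; apply/measurable_EFinP; exact: mf_.
- by apply/measurable_EFinP.
- by apply: aeW => x Dx; apply: cvg_EFin; [exact: nearW|exact: cf].
- by apply: aeW => x n Dx; rewrite abse_EFin lee_fin; exact: fg.
by move=> i _ c; split.
Qed.

End dominated.

Section step_approximation.
Context (R : realType).
Implicit Types t x : R.

(** A polynomial in exp (- c x) approximating the indicator function of x > t:
    the exponential here is 2 ^ (- n x / t), and its product with the exponent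
    n 2 ^ n tends to 0 when x > t and to infinity when x <= t. *)
Definition smooth_step t n x : R :=
  (1 - expR (- (n%:R * (ln 2 / t) * x))) ^+ (n * 2 ^ n).

Lemma ln2_gt0 : 0 < ln 2 :> R.
Proof. by rewrite ln_gt0// ltr1n. Qed.

Lemma smooth_step_bound t n x : 0 < t -> 0 <= x -> 0 <= smooth_step t n x <= 1.
Proof.
move=> t0 x0; have e01 : 0 <= 1 - expR (- (n%:R * (ln 2 / t) * x)) <= 1.
  rewrite subr_ge0 lerBlDr lerDl expR_ge0 andbT expR_le1 oppr_le0.
  by rewrite !mulr_ge0 ?invr_ge0 ?(ltW t0) ?(ltW ln2_gt0)//.
case/andP: e01 => e0 e1; rewrite /smooth_step.
by rewrite exprn_ge0//= exprn_ile1.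
Qed.

Lemma bernoulli_ineq (z : R) N : 0 <= z -> z <= 1 -> 1 - N%:R * z <= (1 - z) ^+ N.
Proof.
move=> z0 z1; elim: N => [|N IH]; first by rewrite mul0r subr0 expr0.
rewrite exprSr; apply: (@le_trans _ _ ((1 - N%:R * z) * (1 - z))); last first.
  by apply: ler_wpM2r => //; rewrite subr_ge0.
rewrite -natr1 -subr_ge0.
have -> : (1 - N%:R * z) * (1 - z) - (1 - (N%:R + 1) * z) = N%:R * z * z by ring.
by rewrite !mulr_ge0.
Qed.

Lemma expr_le_expRN (z : R) N : z <= 1 -> (1 - z) ^+ N <= expR (- (N%:R * z)).
Proof.
move=> z1; rewrite -mulrN expRM_natl; apply: lerXn2r.
- by rewrite nnegrE subr_ge0.
- by rewrite nnegrE expR_ge0.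
- exact: expR_ge1Dx.
Qed.

Lemma cvg_smooth_step t x : 0 < t -> 0 <= x ->
  smooth_step t n x @[n --> \oo] --> ((t < x)%R%:R : R).
Proof.
move=> t0 x0; have l0 := ln2_gt0.
set q := ln 2 / t * x.
pose z n : R := expR (- (n%:R * (ln 2 / t) * x)).
have q0 : 0 <= q by rewrite /q !mulr_ge0 ?invr_ge0 ?(ltW l0) ?(ltW t0).
have z0 n : 0 <= z n by exact: expR_ge0.
have z1 n : z n <= 1.
  by rewrite /z expR_le1 oppr_le0 -mulrA mulr_ge0 ?ler0n.
have NzE n : (n * 2 ^ n)%N%:R * z n = n%:R * expR (n%:R * (ln 2 - q)).
  rewrite natrM natrX -mulrA; congr (_ * _).
  rewrite mulrBr expRD expRM_natl lnK ?posrE//.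
  by rewrite /z /q; congr (_ * expR _); ring.
have [tx|xt] := ltP t x.
- have s0 : 0 < q - ln 2.
    rewrite subr_gt0 /q mulrAC -mulrA -[ltLHS]mulr1 ltr_pM2l//.
    by rewrite ltr_pdivlMr// mul1r.
  set s := q - ln 2 in s0.
  apply: (@squeeze_cvgr _ _ _ _ (fun n => 1 - 2 / s ^+ 2 * n%:R^-1) (cst 1)).
  + near=> n; case/andP: (smooth_step_bound n t0 x0) => _ ->; rewrite andbT.
    apply: (@le_trans _ _ (1 - (n * 2 ^ n)%N%:R * z n)); last exact: bernoulli_ineq.
    rewrite lerD2l lerN2 NzE.
    have n0 : 0 < n%:R :> R by rewrite ltr0n; near: n; exists 1%N.
    have -> : ln 2 - q = - s by rewrite /s opprB.
    rewrite mulrN expRN ler_pdivrMr ?expR_gt0//.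
    have := @expR_ge1Dxn _ (n%:R * s) 1 (mulr_ge0 (ltW n0) (ltW s0)).
    move=> h; apply: (@le_trans _ _ (2 / s ^+ 2 / n%:R * ((n%:R * s) ^+ 2 / 2))).
      have -> : 2 / s ^+ 2 / n%:R * ((n%:R * s) ^+ 2 / 2) = n%:R.
        by field; rewrite !gt_eqF.
      by [].
    apply: ler_wpM2l; last by apply: le_trans h; rewrite lerDr.
    by rewrite !mulr_ge0 ?invr_ge0 ?exprn_ge0 ?(ltW s0) ?(ltW n0).
  + rewrite -[X in _ --> X]subr0 -[X in _ --> _ - X](mulr0 (2 / s ^+ 2)).
    by apply: cvgB; [exact: cvg_cst|apply: cvgMr; apply/gtr0_cvgV0]; last exact: cvgr_idn; near=> n; rewrite ltr0n; near: n; exists 1%N.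
  + exact: cvg_cst.
- have s0 : 0 <= ln 2 - q.
    by rewrite subr_ge0 /q mulrAC -mulrA ler_piMr ?(ltW l0)// ler_pdivrMr ?mul1r.
  apply: (@squeeze_cvgr _ _ _ _ (cst 0) (fun n => expR (- n%:R))).
  + apply: nearW => n; case/andP: (smooth_step_bound n t0 x0) => -> _/=.
    apply: (le_trans (expr_le_expRN _ (z1 n))).
    rewrite NzE ler_expR lerN2 ler_peMr// (le_trans _ (expR_ge1Dx _))// lerDl.
    by rewrite mulr_ge0.
  + exact: cvg_cst.
  + exact: cvgn_expR.
Unshelve. all: end_near. Qed.

Lemma smooth_step_expand t n x : smooth_step t n x =
  \sum_(i < (n * 2 ^ n).+1) ((-1) ^+ i *+ 'C(n * 2 ^ n, i)) *
     expR (- (i%:R * (n%:R * (ln 2 / t)) * x)).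
Proof.
rewrite /smooth_step exprDn; apply: eq_bigr => i _.
rewrite expr1n mul1r [RHS]mulrnAl; congr (_ *+ _).
by rewrite [LHS]exprNn -expRM_natl; congr (_ * expR _); ring.
Qed.

End step_approximation.

Section laplace_tail.
Context d (T : measurableType d) (R : realType) (mu : {measure set T -> \bar R}).

(** The approximations of the indicator function of x > t have integrals that
    are finite combinations of values of the Laplace transform.  The weight
    rho covers at once the law of a random variable and a measure with a
    density. *)
Lemma laplace_cvg_tail (D : set T) (X rho : T -> R) (lap : R -> R) (t : R) :
  measurable D -> measurable_fun D X -> (forall s, D s -> 0 <= X s) ->
  (forall s, D s -> 0 <= rho s) ->
  mu.-integrable D (fun s => (rho s)%:E) ->
  (forall u : R, (0 <= u)%R ->
    \int[mu]_(s in D) (expR (- (u * X s)) * rho s)%:E = (lap u)%:E)%E ->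
  0 < t ->
  ((\sum_(i < (n * 2 ^ n).+1) ((-1) ^+ i *+ 'C(n * 2 ^ n, i)) *
     lap (i%:R * (n%:R * (ln 2 / t))))%:E @[n --> \oo] -->
   \int[mu]_(s in D) ((t < X s)%R%:R * rho s)%:E)%E.
Proof.
move=> mD mX X0 rho0 irho laplace t0.
have mrho : measurable_fun D rho by apply/measurable_EFinP; case/integrableP: irho.
have me u : measurable_fun D (fun s => expR (- (u * X s))).
  apply: (@measurableT_comp _ _ _ _ _ _ (fun x : R => expR (- (u * x)))) => //.
  exact: measurable_expRM.
have := @dominated_cvg_real _ T R mu D (fun n s => smooth_step t n (X s) * rho s)
  (fun s => (t < X s)%R%:R * rho s) rho mD.
have E n s : smooth_step t n (X s) * rho s = \sum_(i < (n * 2 ^ n).+1) ((-1) ^+ i *+ 'C(n * 2 ^ n, i)) *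
     (expR (- (i%:R * (n%:R * (ln 2 / t)) * X s)) * rho s).
  by rewrite smooth_step_expand big_distrl/=; apply: eq_bigr => i _; rewrite [RHS]mulrA.
case.
- move=> n; apply: measurable_funM => //.
  apply: measurable_funX; apply: measurable_funB => //; exact: me.
- apply: measurable_funM => //.
  have mb : measurable_fun [set: bool] (fun b : bool => b%:R : R) by [].
  have mt : measurable_fun D (fun s => t < X s) by exact: measurable_fun_ltr.
  exact: (measurableT_comp mb mt).
- move=> s Ds; apply: cvgM; last exact: cvg_cst.
  by apply: cvg_smooth_step => //; exact: X0.
- exact: irho.
- move=> s n Ds; case/andP: (smooth_step_bound n t0 (X0 _ Ds)) => p0 p1.
  by rewrite ger0_norm ?mulr_ge0 ?rho0// ler_piMl ?rho0.
move=> _; apply: cvg_trans; rewrite (_ : (fun n => _) =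
   (fun n => \int[mu]_(x in D) (smooth_step t n (X x) * rho x)%:E)%E)//.
apply/funext => n; apply/esym; under eq_integral do rewrite E.
set c := fun i : 'I_(n * 2 ^ n).+1 => i%:R * (n%:R * (ln 2 / t)).
have c0 i : 0 <= c i by rewrite !mulr_ge0 ?invr_ge0 ?(ltW t0) ?(ltW (ln2_gt0 _)).
have [||_ ->//] := @integral_lincomb _ T R mu _ (index_enum 'I_(n * 2 ^ n).+1) D
  (fun i => (-1) ^+ i *+ 'C(n * 2 ^ n, i)) (fun i s => expR (- (c i * X s)) * rho s)
  (fun i => lap (c i)) mD; last by move=> i _; exact: laplace.
move=> i _; apply: (le_integrable mD _ _ irho).
  by apply/measurable_EFinP; apply: measurable_funM => //; exact: me.
move=> s Ds; rewrite lee_fin !ger0_norm ?mulr_ge0 ?expR_ge0 ?rho0//.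
by rewrite ler_piMl ?rho0// expR_le1 oppr_le0 mulr_ge0// X0.
Qed.

End laplace_tail.

Section density.
Context d (T : measurableType d) (R : realType) (mu : {measure set T -> \bar R}).
Local Open Scope ereal_scope.

Lemma density_measureP (psi : T -> R) : measurable_fun [set: T] psi ->
  (forall x, (0 <= psi x)%R) ->
  exists m : {measure set T -> \bar R},
    forall A, m A = \int[mu]_(x in A) (psi x)%:E.
Proof.
move=> mpsi psi0.
pose f A := \int[mu]_(x in A) (psi x)%:E.
have f0 : f set0 = 0 by rewrite /f integral_set0.
have fge0 A : 0 <= f A by apply: integral_ge0 => x _; rewrite lee_fin.
have fadd : semi_sigma_additive f.
  move=> F mF tF mUF; rewrite /f ge0_integral_bigcup//.
  - by apply: is_cvg_ereal_nneg_natsum_cond => n _ _; exact: fge0.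
  - by apply: measurable_funTS; apply/measurable_EFinP.
  - by move=> x _; rewrite lee_fin.
pose m : {measure set T -> \bar R} := HB.pack f (isMeasure.Build _ _ _ f f0 fge0 fadd).
by exists m.
Qed.

Import HBNNSimple.

(** The identity passes from indicator functions to simple functions, then to
    increasing limits of these. *)
Lemma ge0_integral_density (m : {measure set T -> \bar R}) (psi : T -> R) (f : T -> \bar R) :
  measurable_fun [set: T] psi -> (forall x, (0 <= psi x)%R) ->
  (forall A, measurable A -> m A = \int[mu]_(x in A) (psi x)%:E) ->
  measurable_fun [set: T] f -> (forall x, 0 <= f x) ->
  \int[m]_x f x = \int[mu]_x (f x * (psi x)%:E).
Proof.
move=> mpsi psi0 mE mf f0.
pose g := nnsfun_approx measurableT mf.
have gf x : EFin \o g ^~ x @ \oo --> f x.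
  exact: (cvg_nnsfun_approx measurableT mf (fun x _ => f0 x)).
have ndg x : nondecreasing_seq (fun n => (g n x)%:E).
  by move=> i j ij; rewrite lee_fin; apply/lefP/nd_nnsfun_approx.
have limg x : limn (fun n => (g n x)%:E) = f x by apply/cvg_lim => //; exact: gf.
have mpsiE : measurable_fun [set: T] (EFin \o psi) by apply/measurable_EFinP.
have gE n : \int[m]_x (g n x)%:E = \int[mu]_x ((g n x)%:E * (psi x)%:E).
  transitivity (\int[mu]_x \sum_(y \in range (g n))
      ((y * \1_(g n @^-1` [set y]) x)%:E * (psi x)%:E)); last first.
    apply: eq_integral => x _; rewrite -ge0_mule_fsuml; last first.
      by move=> y; rewrite EFinM nnfun_muleindic_ge0.
    by rewrite fsumEFin// -fimfunE.
  rewrite ge0_integral_fsum//; last 2 first.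
  - move=> y; apply: emeasurable_funM => //.
    by apply/measurable_EFinP; apply: measurable_funM.
  - move=> y x _; rewrite mule_ge0 ?lee_fin//.
    by have := nnfun_muleindic_ge0 (g n) y x; rewrite -EFinM lee_fin.
  rewrite integralT_nnsfun sintegralE; apply: eq_fsbigr => y.
  rewrite inE => -[x _ <-].
  set A := g n @^-1` [set g n x].
  have mA : measurable A by exact: measurable_sfunP.
  under eq_integral do rewrite EFinM -muleA.
  rewrite ge0_integralZl//; last 3 first.
  - apply: emeasurable_funM => //.
    by apply/measurable_EFinP; exact: measurable_indic.
  - by move=> z _; rewrite mule_ge0 ?lee_fin.
  - by rewrite lee_fin.
  congr (_ * _); rewrite mE// integral_mkcond; apply: eq_integral => z _.
  by rewrite epatch_indic muleC.
transitivity (limn (fun n => \int[m]_x (g n x)%:E)).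
  rewrite -monotone_convergence//.
  - by apply: eq_integral => x _; rewrite limg.
  - by move=> n; apply/measurable_EFinP.
  - by move=> n x _; rewrite lee_fin.
under eq_fun do rewrite gE.
rewrite -monotone_convergence//.
- apply: eq_integral => x _; apply/cvg_lim => //.
  by apply: cvgeZr => //; exact: gf.
- by move=> n; apply: emeasurable_funM => //; apply/measurable_EFinP.
- by move=> n x _; rewrite mule_ge0 ?lee_fin.
- by move=> x _ i j ij; rewrite lee_wpmul2r ?lee_fin//; exact: ndg.
Qed.

End density.

Section laplace_uniqueness.
Context d (T : measurableType d) (R : realType) (P : probability T R).
Notation mu := (@lebesgue_measure R).

Lemma itvoy_bigcup_harmonic : `]0, +oo[%classic = \bigcup_n `](n.+1%:R^-1 : R), +oo[%classic.
Proof.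
apply/seteqP; split => x /=; rewrite !in_itv/= !andbT; last first.
  by case=> n _ /=; rewrite in_itv/= andbT; apply: le_lt_trans; rewrite invr_ge0.
move=> x0; have [n _ /(_ n (leqnn n))] := near_infty_natSinv_lt (PosNum x0).
by move=> /= nx; exists n => //=; rewrite in_itv/= andbT.
Qed.

(** The probability of J > t and the integral of psi over x > t are limits of
    one and the same sequence of combinations of values of the Laplace
    transform, and the open half-lines generate the Borel sets. *)
Lemma density_of_laplace (J : T -> R) (psi : R -> R) :
  measurable_fun [set: T] J -> (forall w, 0 <= J w) ->
  measurable_fun [set: R] psi -> (forall x, 0 <= psi x) -> (forall x, x < 0 -> psi x = 0) ->
  (forall u : R, 0 <= u -> (\int[P]_w (expR (- (u * J w)))%:E =
     \int[mu]_(x in `[0%R, +oo[) (expR (- (u * x)) * psi x)%:E)%E) ->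
  is_density P J psi.
Proof.
move=> mJ J0 mpsi psi0 psiN laplace; split => // B mB.
pose rJ : {RV P >-> measurableTypeR R} :=
  HB.pack (J : T -> measurableTypeR R) (isMeasurableFun.Build _ _ T (measurableTypeR R) _ mJ).
have [m mE] := density_measureP mu mpsi psi0.
pose lap u := fine (\int[P]_w (expR (- (u * J w)))%:E)%E.
have iP u : 0 <= u -> P.-integrable [set: T] (fun w => (expR (- (u * J w)))%:E).
  move=> u0; apply: (@le_integrable _ _ _ _ _ _ _ (fun=> 1%E)) => //.
  - apply/measurable_EFinP.
    apply: (@measurableT_comp _ _ _ _ _ _ (fun x : R => expR (- (u * x)))) => //.
    exact: measurable_expRM.
  - move=> w _; rewrite lee_fin !ger0_norm ?expR_ge0//.
    by rewrite expR_le1 oppr_le0 mulr_ge0.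
  - by apply: finite_measure_integrable_cst.
have lapE u : 0 <= u -> (\int[P]_w (expR (- (u * J w)))%:E = (lap u)%:E)%E.
  by move=> u0; rewrite /lap fineK//; exact/integrable_fin_num/iP.
have psi1 : (\int[mu]_(x in `[0%R, +oo[) (psi x)%:E = 1)%E.
  have := laplace 0 (lexx _).
  under eq_integral do rewrite mul0r oppr0 expR0.
  under [RHS]eq_integral do rewrite mul0r oppr0 expR0 mul1r.
  by rewrite integral_cst// mul1e => <-; exact: probability_setT.
have ipsi : mu.-integrable `[0, +oo[ (fun x => (psi x)%:E).
  apply/integrableP; split; first by apply/measurable_EFinP; exact: measurable_funTS.
  under eq_integral do rewrite gee0_abs ?lee_fin//.
  by rewrite psi1 ltry.
have tailE t : 0 < t -> P [set w | t < J w] = m `]t, +oo[%classic.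
  move=> t0.
  pose C n := \sum_(i < (n * 2 ^ n).+1) ((-1) ^+ i *+ 'C(n * 2 ^ n, i)) *
     lap (i%:R * (n%:R * (ln 2 / t))).
  have H1 : ((C n)%:E @[n --> \oo] -->
      \int[P]_s (((t < J s)%R)%:R * cst 1%R s)%:E)%E.
    apply: laplace_cvg_tail => //.
      exact: finite_measure_integrable_cst.
    move=> u u0; rewrite -lapE//; apply: eq_integral => w _; rewrite mulr1//.
  have H2 : ((C n)%:E @[n --> \oo] -->
      \int[mu]_(x in `[0%R, +oo[) (((t < x)%R)%:R * psi x)%:E)%E.
    have := @laplace_cvg_tail _ _ R mu `[0%R, +oo[%classic idfun psi lap t _ (@measurable_id _ _ _) _ (fun x _ => psi0 x) ipsi _ t0.
    apply => //.
      by move=> x /=; rewrite in_itv/= andbT.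
    by move=> u u0; rewrite -laplace// lapE.
  transitivity (\int[P]_s (((t < J s)%R)%:R * cst 1%R s)%:E)%E.
    under eq_integral do rewrite /= mulr1.
    rewrite -[LHS]mul1e -(@integral_cst _ _ _ P [set w | t < J w] _ 1%E).
      rewrite integral_mkcond; apply: eq_integral => s _.
      rewrite patchE; case: ifPn; rewrite ?inE/= ?notin_setE/=; first by move=> ->.
      by move=> /negP/negbTE ->.
    by rewrite -[X in measurable X]setTI; exact: measurable_fun_ltr.
  transitivity (\int[mu]_(x in `[0%R, +oo[) (((t < x)%R)%:R * psi x)%:E)%E; last first.
    rewrite mE [LHS]integral_mkcond [RHS]integral_mkcond; apply: (@eq_integral _ _ R mu) => x _.
    rewrite !patchE !mem_setE !in_itv/= !andbT.
    have [tx|xt] := ltP t x; first by rewrite (le_trans (ltW t0) (ltW tx)) mul1r.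
    by rewrite mul0r; case: ifP.
  exact: (cvg_unique _ H1 H2).
have mJt t : measurable [set w | t < J w].
  by rewrite -[X in measurable X]setTI; exact: measurable_fun_ltr.
have tail0 : P [set w | 0 < J w] = m `]0%R, +oo[%classic.
  have H1 : (P \o (fun n => [set w | (n.+1%:R^-1 : R) < J w])) n @[n --> \oo] -->
      P (\bigcup_n [set w | (n.+1%:R^-1 : R) < J w]).
    apply: nondecreasing_cvg_mu => //; first exact: bigcupT_measurable.
    move=> i j ij; apply/subsetPset => w /=; apply: le_lt_trans.
    by rewrite lef_pV2 ?posrE ?ltr0n// ler_nat ltnS.
  have H2 : (m \o (fun n => `](n.+1%:R^-1 : R), +oo[%classic)) n @[n --> \oo] -->
      m (\bigcup_n `](n.+1%:R^-1 : R), +oo[%classic).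
    apply: nondecreasing_cvg_mu => //; first exact: bigcupT_measurable.
    move=> i j ij; apply/subsetPset => w /=; rewrite !in_itv/= !andbT; apply: le_lt_trans.
    by rewrite lef_pV2 ?posrE ?ltr0n// ler_nat ltnS.
  rewrite itvoy_bigcup_harmonic.
  rewrite (_ : [set w | 0 < J w] = \bigcup_n [set w | (n.+1%:R^-1 : R) < J w]); last first.
    have := itvoy_bigcup_harmonic => /(congr1 (fun A => J @^-1` A)).
    rewrite preimage_bigcup => E; rewrite (_ : [set w | 0 < J w] = J @^-1` `]0, +oo[); last first.
      by apply/seteqP; split => w /=; rewrite in_itv/= andbT.
    rewrite E; apply: eq_bigcupr => n _.
    by apply/seteqP; split => w /=; rewrite in_itv/= andbT.
  have EPm : P \o (fun n => [set w | (n.+1%:R^-1 : R) < J w]) =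
             m \o (fun n => `](n.+1%:R^-1 : R), +oo[%classic).
    by apply/funext => n /=; apply: tailE; rewrite invr_gt0.
  by move: H1; rewrite EPm => H1; exact: (cvg_unique _ H1 H2).
have tailN t : t < 0 -> P [set w | t < J w] = m `]t, +oo[%classic.
  move=> t0; rewrite (_ : [set w | t < J w] = setT).
    rewrite mE; apply: (eq_trans (probability_setT P)); rewrite -psi1.
    rewrite [LHS]integral_mkcond [RHS]integral_mkcond; apply: (@eq_integral _ _ R mu) => x _.
    rewrite !patchE !mem_setE !in_itv/= !andbT.
    have [x0|x0] := leP 0 x; first by rewrite (lt_le_trans t0 x0).
    by rewrite psiN//; case: ifP.
  by apply/seteqP; split => // w _ /=; exact: lt_le_trans t0 (J0 w).
have tail t : P [set w | t < J w] = m `]t, +oo[%classic.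
  by have [t0|t0|->] := ltgtP t 0; [exact: tailN|exact: tailE|exact: tail0].
rewrite -mE -[LHS]/(distribution P rJ B).
have Eitv t : rJ @^-1` `]t, +oo[ = [set w | t < J w].
  by apply/seteqP; split => w /=; rewrite in_itv/= andbT.
suff M : forall A : set (measurableTypeR R), measurable A -> distribution P rJ A = m A.
  exact: M.
apply: (@measure_unique _ R (measurableTypeR R) (@RGenOInfty.G R) (fun n => `](- n%:R : R), +oo[%classic)) => //.
- by rewrite RGenOInfty.measurableE.
- move=> _ _ [x ->] [y ->]; exists (Num.max x y); apply/seteqP; split => z /=.
    by rewrite !in_itv/= !andbT gt_max => -[-> ->].
  by rewrite !in_itv/= !andbT gt_max => /andP[-> ->].
- by move=> n; exists (- n%:R).
- apply/seteqP; split => // x _; exists (Num.bound `|x|) => //=.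
  by rewrite in_itv/= andbT ltrNl (le_lt_trans (ler_norm _))// normrN archi_boundP.
- by move=> _ [t ->]; rewrite -tail -Eitv.
- by move=> n; rewrite (le_lt_trans (probability_le1 _ _)) ?ltry.
Qed.

Lemma ge0_integral_is_density (J : T -> R) (psi : R -> R) (f : R -> \bar R) :
  measurable_fun [set: T] J -> is_density P J psi ->
  measurable_fun [set: R] f -> (forall x, (0 <= f x)%E) ->
  (\int[P]_w f (J w) = \int[mu]_x (f x * (psi x)%:E))%E.
Proof.
move=> mJ [mpsi psi0 PJ] mf f0.
pose rJ : {RV P >-> measurableTypeR R} :=
  HB.pack (J : T -> measurableTypeR R) (isMeasurableFun.Build _ _ T (measurableTypeR R) _ mJ).
rewrite -(@ge0_integral_density _ (measurableTypeR R) R mu (distribution P rJ) psi f)//.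
by rewrite ge0_integral_pushforward.
Qed.

End laplace_uniqueness.

(** * A bound for the tails of the series of l^(-p) *)

Section power_series_tail.
Context (R : realType).

(** 2 ^ p times the integral of x ^ (- p) over x >= l; the factor 2 ^ p pays
    for replacing x ^ (- p) by l ^ (- p) on an interval of length 1. *)
Definition zeta_tail (p : R) (l : nat) : R :=
  2 `^ p / (p - 1) * l%:R `^ (1 - p).

Lemma zeta_tail_ge0 p l : 1 < p -> 0 <= zeta_tail p l.
Proof. by move=> p1; rewrite !mulr_ge0 ?powR_ge0// invr_ge0 subr_ge0 ltW. Qed.

Lemma powRN_le (p x y : R) : 0 <= p -> 0 < x -> x <= y -> y `^ (- p) <= x `^ (- p).
Proof.
move=> p0 x0 xy; rewrite !powRN lef_pV2 ?posrE ?powR_gt0//; last exact: lt_le_trans xy.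
by apply: ge0_ler_powR => //; rewrite nnegrE ltW// (lt_le_trans x0).
Qed.

Lemma zeta_tail_step p l : 1 < p -> (0 < l)%N ->
  l%:R `^ (- p) <= zeta_tail p l - zeta_tail p l.+1.
Proof.
move=> p1 l0; set s := p - 1; have s0 : 0 < s by rewrite subr_gt0.
have L0 : 0 < l%:R :> R by rewrite ltr0n.
have M0 : 0 < l.+1%:R :> R by rewrite ltr0n.
have sE : 1 - p = - s by rewrite opprB.
rewrite /zeta_tail -mulrBr sE -/s.
have h : s * l.+1%:R `^ (- p) <= l%:R `^ (- s) - l.+1%:R `^ (- s).
  have -> : l.+1%:R `^ (- p) = l.+1%:R `^ (- s) * l.+1%:R^-1.
    rewrite -[X in _ * X]powR_inv1 ?(ltW M0)// -powRD ?(gt_eqF M0) ?implybT//.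
    by congr (_ `^ _); rewrite /s; ring.
  have -> : l%:R `^ (- s) = l.+1%:R `^ (- s) * (l%:R / l.+1%:R) `^ (- s).
    rewrite -powRM ?divr_ge0 ?ler0n//; congr (_ `^ _).
    by rewrite mulrC divfK// gt_eqF.
  rewrite mulrCA -[X in _ <= _ - X]mulr1 -mulrBr.
  apply: ler_wpM2l; first exact: powR_ge0.
  rewrite lerBrDl /powR gt_eqF ?divr_gt0//.
  apply: le_trans (expR_ge1Dx _); rewrite lerD2l mulNr -mulrN.
  apply: ler_wpM2l; first exact: ltW.
  have -> : l%:R / l.+1%:R = 1 + - l.+1%:R^-1 :> R.
    by field; rewrite nat1r gt_eqF.
  by rewrite lerNr le_ln1Dx// ltrN2 invf_lt1// ltr1n ltnS.
apply: (@le_trans _ _ (2 `^ p * l.+1%:R `^ (- p))); last first.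
  rewrite -mulrA ler_wpM2l ?powR_ge0//.
  by rewrite mulrC ler_pdivlMr// mulrC.
rewrite !powRN ler_pdivlMr ?powR_gt0// mulrC ler_pdivrMr ?powR_gt0//.
rewrite -powRM//; apply: ge0_ler_powR; rewrite ?nnegrE ?mulr_ge0//.
  by rewrite (le_trans ler01) ?ltW.
by rewrite -natrM ler_nat mul2n -addnn -addn1 leq_add2l.
Qed.

Lemma zeta_tail_cvg p : 1 < p -> zeta_tail p l @[l --> \oo] --> (0 : R).
Proof.
move=> p1; rewrite -[X in _ --> X](mulr0 (2 `^ p / (p - 1))); apply: cvgMr.
have s0 : 0 < p - 1 by rewrite subr_gt0.
apply/cvgrPdist_le => e e0; near=> l.
rewrite sub0r normrN ger0_norm ?powR_ge0//.
have x0 : 0 < e `^ (- (p - 1)^-1) by rewrite powR_gt0.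
have -> : 1 - p = - (p - 1) by rewrite opprB.
apply: (@le_trans _ _ ((e `^ (- (p - 1)^-1)) `^ (- (p - 1)))).
  apply: powRN_le => //; first exact: ltW.
  by near: l; exact: nbhs_infty_ger.
by rewrite -powRrM mulrNN mulVf ?gt_eqF// powRr1// ltW.
Unshelve. all: end_near. Qed.

End power_series_tail.

(** * Sums over multi-indices *)

Section multiindex_sums.
Context (R : realType).
Local Open Scope ereal_scope.

Definition frcons K (z : {ffun 'I_K -> nat}) (k : nat) : {ffun 'I_K.+1 -> nat} :=
  [ffun i => oapp z k (unlift ord_max i)].

Lemma frcons_widen K (z : {ffun 'I_K -> nat}) k i :
  frcons z k (widen_ord (leqnSn K) i) = z i.
Proof.
have -> : widen_ord (leqnSn K) i = lift ord_max i.
  by apply: val_inj; exact/esym/lift_max.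
by rewrite ffunE liftK.
Qed.

Lemma frcons_max K (z : {ffun 'I_K -> nat}) k : frcons z k ord_max = k.
Proof. by rewrite ffunE unlift_none. Qed.

Lemma frcons_bij K : set_bij [set: {ffun 'I_K -> nat} * nat] [set: {ffun 'I_K.+1 -> nat}]
  (fun zk => frcons zk.1 zk.2).
Proof.
split => // [[z k] [z' k'] _ _ /= E|z _].
  have -> : k = k' by rewrite -(frcons_max z k) E frcons_max.
  congr (_, _); apply/ffunP => i.
  by rewrite -(frcons_widen z k) E frcons_widen.
exists ([ffun i => z (widen_ord (leqnSn K) i)], z ord_max) => //=.
apply/ffunP => i; have [j ->|->] := unliftP ord_max i; last by rewrite frcons_max.
have -> : lift ord_max j = widen_ord (leqnSn K) j.
  by apply: val_inj; exact: lift_max.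
by rewrite frcons_widen ffunE.
Qed.

Lemma esum_ffun0 (a : {ffun 'I_0 -> nat} -> \bar R) : (forall z, 0 <= a z) ->
  \esum_(z in [set: {ffun 'I_0 -> nat}]) a z = a [ffun=> 0%N].
Proof.
move=> a0; rewrite (_ : setT = [set [ffun=> 0%N]]) ?esum_set1//.
by apply/seteqP; split => // z _; apply/ffunP => -[].
Qed.

Lemma esum_ffunS K (a : {ffun 'I_K.+1 -> nat} -> \bar R) : (forall z, 0 <= a z) ->
  \esum_(z in [set: {ffun 'I_K.+1 -> nat}]) a z =
  \esum_(z in [set: {ffun 'I_K -> nat}]) \esum_(k in [set: nat]) a (frcons z k).
Proof.
move=> a0; rewrite (reindex_esum _ _ _ _ (frcons_bij K)) esum_esum//.
by rewrite -setXTT; congr esum; apply/seteqP; split.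
Qed.

Lemma esumZl (I : choiceType) (D : set I) (a : I -> \bar R) (c : R) :
  (0 <= c)%R -> (forall i, 0 <= a i) ->
  \esum_(i in D) (c%:E * a i) = c%:E * \esum_(i in D) a i.
Proof.
move=> c0 a0; rewrite /esum -ereal_supZl//; last first.
  apply/set0P; exists 0; exists set0; first exact: fsets_set0.
  by rewrite fsbig_set0.
congr (ereal_sup _); apply/seteqP; split => [_ [A DA <-]|_ [_ [A DA <-] <-]].
  by exists (\sum_(x \in A) a x); [exists A|rewrite ge0_mule_fsumr].
by exists A => //; rewrite ge0_mule_fsumr.
Qed.

Definition multi_pmf K (q : nat -> R) (z : {ffun 'I_K -> nat}) : R :=
  (\prod_(k < K) q (z k))%R.

Lemma multi_pmf_ge0 K q z : (forall k, (0 <= q k)%R) -> (0 <= @multi_pmf K q z)%R.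
Proof. by move=> q0; apply: prodr_ge0 => k _. Qed.

Lemma multi_pmf_frcons K q (z : {ffun 'I_K -> nat}) k :
  multi_pmf q (frcons z k) = (multi_pmf q z * q k)%R.
Proof.
rewrite /multi_pmf big_ord_recr/= frcons_max; congr (_ * _)%R.
by apply: eq_bigr => i _; rewrite frcons_widen.
Qed.

Lemma esum_multi_pmfS K q (G : {ffun 'I_K.+1 -> nat} -> R) :
  (forall k, (0 <= q k)%R) -> (forall z, (0 <= multi_pmf q z * G z)%R) ->
  \esum_(z in [set: {ffun 'I_K.+1 -> nat}]) (multi_pmf q z * G z)%:E =
  \esum_(z in [set: {ffun 'I_K -> nat}]) ((multi_pmf q z)%:E *
     \esum_(k in [set: nat]) (q k * G (frcons z k))%:E).
Proof.
move=> q0 G0; rewrite esum_ffunS; last by move=> z; rewrite lee_fin.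
apply: eq_esum => z _.
have [z0|z0] := eqVneq (multi_pmf q z) 0%R.
  rewrite z0 mul0e; apply: esum1 => k _.
  by rewrite multi_pmf_frcons z0 !mul0r.
have zp : (0 < multi_pmf q z)%R by rewrite lt_def z0 multi_pmf_ge0.
rewrite -esumZl ?multi_pmf_ge0//; last first.
  by move=> k; rewrite lee_fin -(pmulr_rge0 _ zp) mulrA -multi_pmf_frcons.
by apply: eq_esum => k _; rewrite -EFinM mulrA multi_pmf_frcons.
Qed.

(** Distributivity: the sum over multi-indices of a product is the product of
    the sums. *)
Lemma esum_prod K (q : 'I_K -> nat -> R) (s : 'I_K -> R) :
  (forall i k, (0 <= q i k)%R) ->
  (forall i, \esum_(k in [set: nat]) (q i k)%:E = (s i)%:E) ->
  \esum_(z in [set: {ffun 'I_K -> nat}]) (\prod_(i < K) q i (z i))%R%:E =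
  (\prod_(i < K) s i)%R%:E.
Proof.
elim: K q s => [|K IH] q s q0 sE.
  rewrite esum_ffun0 ?big_ord0// => z; last by rewrite big_ord0.
rewrite esum_ffunS; last by move=> z; rewrite lee_fin prodr_ge0.
transitivity (\esum_(z in [set: {ffun 'I_K -> nat}])
    ((s ord_max)%:E * (\prod_(i < K) q (widen_ord (leqnSn K) i) (z i))%R%:E)).
  apply: eq_esum => z _; rewrite muleC -sE -esumZl; last 2 first.
  - by apply: prodr_ge0 => i _; exact: q0.
  - by move=> k; rewrite lee_fin.
  apply: eq_esum => k _; rewrite big_ord_recr/= frcons_max -EFinM; congr (_ * _)%:E.
  by apply: eq_bigr => i _; rewrite frcons_widen.
have s0 : (0 <= s ord_max)%R by rewrite -lee_fin -sE; apply: esum_ge0 => k _; rewrite lee_fin.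
rewrite (@esumZl _ _ (fun z : {ffun 'I_K -> nat} =>
  (\prod_(i < K) q (widen_ord (leqnSn K) i) (z i))%R%:E))//; last first.
  by move=> z; rewrite lee_fin prodr_ge0.
rewrite (IH (fun i => q (widen_ord (leqnSn K) i)) (fun i => s (widen_ord (leqnSn K) i)))//.
by rewrite -EFinM big_ord_recr/= mulrC.
Qed.

(** An enumeration turns unordered sums into series, for which monotone
    convergence is available. *)
Lemma esum_countable (I : countType) (i0 : I) : exists (e : nat -> I) (Q : pred nat),
  forall a : I -> \bar R, (forall i, 0 <= a i) ->
  \esum_(i in [set: I]) a i = \sum_(n <oo) (if Q n then a (e n) else 0).
Proof.
pose e n := odflt i0 (unpickle n).
pose Q n := if unpickle n is Some i then pickle (i : I) == n else false.
exists e, Q => a a0.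
rewrite -eseries_mkcond -esum_pred_image//.
  congr esum; apply/seteqP; split => // i _; exists (pickle i).
    by rewrite /= /Q pickleK eqxx.
  by rewrite /e pickleK.
move=> m n; rewrite !inE /Q /e.
case: unpickle => // i /eqP <-; case: unpickle => //= j /eqP <-.
by move=> ->.
Qed.

Lemma integral_esum d (T : measurableType d) (mu : {measure set T -> \bar R}) (D : set T)
    (I : countType) (f : I -> T -> \bar R) :
  measurable D -> (forall i, measurable_fun D (f i)) -> (forall i x, 0 <= f i x) ->
  \int[mu]_(x in D) (\esum_(i in [set: I]) f i x) =
  \esum_(i in [set: I]) \int[mu]_(x in D) f i x.
Proof.
move=> mD mf f0; have [[i0 _]|I0] := pselect (exists i : I, True); last first.
  have -> : [set: I] = set0 by apply/seteqP; split => // i _; apply: I0; exists i.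
  rewrite esum_set0; under eq_integral do rewrite esum_set0.
  by rewrite integral0.
have [e [Q H]] := esum_countable i0.
rewrite H; last by move=> i; apply: integral_ge0.
under eq_integral do rewrite H//.
rewrite integral_nneseries//.
- by apply: eq_eseriesr => n _; case: (Q n); rewrite ?integral0.
- by move=> n; case: (Q n); [exact: mf|exact: measurable_cst].
- by move=> n x _; case: (Q n).
Qed.

Lemma measurable_fun_esum d (T : measurableType d) (D : set T)
    (I : countType) (f : I -> T -> \bar R) :
  measurable D -> (forall i, measurable_fun D (f i)) -> (forall i x, 0 <= f i x) ->
  measurable_fun D (fun x => \esum_(i in [set: I]) f i x).
Proof.
move=> mD mf f0; have [[i0 _]|I0] := pselect (exists i : I, True); last first.
  have -> : [set: I] = set0 by apply/seteqP; split => // i _; apply: I0; exists i.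
  rewrite (_ : (fun x => _) = cst 0); first exact: measurable_cst.
  by apply/funext => x; rewrite esum_set0.
have [e [Q H]] := esum_countable i0.
under eq_fun do rewrite H//.
apply: ge0_emeasurable_sum => // n; first by move=> x _; case: (Q n).
by move=> _; case: (Q n); [exact: mf|exact: measurable_cst].
Qed.

End multiindex_sums.

(** * Levels and rates *)

Section levels.
Context (R : realType) (a p : R).

Definition rate K (z : {ffun 'I_K -> nat}) (k : 'I_K) : R := a * level R z k `^ p.
Definition rates K (z : {ffun 'I_K -> nat}) : seq R := [seq rate z k | k <- enum 'I_K].
Definition end_level K (z : {ffun 'I_K -> nat}) : nat := (\sum_(j < K) z j + 1)%N.

Lemma level_frcons_widen K (z : {ffun 'I_K -> nat}) k i :
  level R (frcons z k) (widen_ord (leqnSn K) i) = level R z i.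
Proof.
congr (_ + _)%:R; rewrite big_mkcond [RHS]big_mkcond/= big_ord_recr/=.
rewrite ltnNge (ltnW (ltn_ord i)) addn0.
by apply: eq_bigr => j _; rewrite frcons_widen.
Qed.

Lemma level_frcons_max K (z : {ffun 'I_K -> nat}) k :
  level R (frcons z k) ord_max = (end_level z)%:R.
Proof.
congr (_ + _)%:R; rewrite big_mkcond/= big_ord_recr/= ltnn addn0.
by apply: eq_bigr => j _; rewrite frcons_widen ltn_ord.
Qed.

Lemma rates_frcons K (z : {ffun 'I_K -> nat}) k :
  rates (frcons z k) = rcons (rates z) (a * (end_level z)%:R `^ p).
Proof.
rewrite /rates enum_ordSr map_rcons -map_comp; congr rcons.
  by apply: eq_map => i /=; rewrite /rate level_frcons_widen.
by rewrite /rate level_frcons_max.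
Qed.

Lemma total_frcons K (z : {ffun 'I_K -> nat}) k : end_level (frcons z k) = (end_level z + k)%N.
Proof.
rewrite /end_level big_ord_recr/= frcons_max addnAC; congr (_ + _ + _)%N.
by apply: eq_bigr => i _; rewrite frcons_widen.
Qed.

Lemma level_ge1 K (z : {ffun 'I_K -> nat}) k : 1 <= level R z k.
Proof. by rewrite /level ler1n addn1. Qed.

Lemma level_lt K (z : {ffun 'I_K -> nat}) (i j : 'I_K) : positive_multiindices K z ->
  (i < j)%N -> level R z i < level R z j.
Proof.
move=> zp ij; rewrite /level ltr_nat ltn_add2r.
rewrite [ltnRHS](bigD1 i)//= -[X in (X < _)%N]add0n -addSn leq_add ?zp//.
rewrite big_mkcond [leqRHS]big_mkcond/=; apply: leq_sum => k _.
case: ltnP => // ki; rewrite (ltn_trans ki ij)/=.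
by rewrite ifT// -val_eqE/= neq_ltn ki.
Qed.

Lemma level_ge_ord K (z : {ffun 'I_K -> nat}) (k : 'I_K) : positive_multiindices K z ->
  k.+1%:R <= level R z k.
Proof.
move=> zp; rewrite /level ler_nat -addn1 leq_add2r.
have {1}-> : (k : nat) = (\sum_(j < K | (j < k)%N) 1)%N.
  rewrite -(big_ord_widen K (fun=> 1%N) (ltnW (ltn_ord k))).
  by rewrite sum1_card card_ord.
by apply: leq_sum => j _; exact: zp.
Qed.

Lemma total_gt K (z : {ffun 'I_K -> nat}) : positive_multiindices K z -> (K < end_level z)%N.
Proof.
move=> zp; rewrite /end_level addn1 ltnS -[X in (X <= _)%N]card_ord -sum1_card.
by apply: leq_sum => j _; exact: zp.
Qed.

Lemma level_inj K (z : {ffun 'I_K -> nat}) : positive_multiindices K z ->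
  injective (level R z).
Proof.
move=> zp i j; have [ij|ji|ij _] := ltngtP i j; last exact: val_inj.
  by have := level_lt zp ij => /[swap] ->; rewrite ltxx.
by have := level_lt zp ji => /[swap] ->; rewrite ltxx.
Qed.

Hypotheses (a0 : 0 < a) (p0 : 0 < p).

Lemma rate_ge K (z : {ffun 'I_K -> nat}) k : a <= rate z k.
Proof.
rewrite /rate ler_peMr ?(ltW a0)//.
rewrite -[leLHS](congr1 (@^~ p) (@powR1 R)); apply: ge0_ler_powR; rewrite ?nnegrE ?(ltW p0)//.
exact: level_ge1.
Qed.

Lemma rate_inj K (z : {ffun 'I_K -> nat}) : positive_multiindices K z ->
  injective (rate z).
Proof.
move=> zp i j; rewrite /rate => /(mulfI (lt0r_neq0 a0)) /(congr1 (fun x => x `^ p^-1)).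
rewrite -!powRrM divff ?gt_eqF// !powRr1 ?(le_trans ler01) ?level_ge1//.
exact: level_inj.
Qed.

Lemma rates_uniq K (z : {ffun 'I_K -> nat}) : positive_multiindices K z ->
  uniq (rates z).
Proof. by move=> zp; rewrite map_inj_uniq ?enum_uniq//; exact: rate_inj. Qed.

Lemma rates_gt c K (z : {ffun 'I_K -> nat}) : c < a -> all (fun b => c < b) (rates z).
Proof.
by move=> ca; apply/allP => _ /mapP[k _ ->] /=; rewrite (lt_le_trans ca)// rate_ge.
Qed.

Lemma rates_head K (z : {ffun 'I_K.+1 -> nat}) : rates z = a :: behead (rates z).
Proof.
rewrite /rates enum_ordSl/=; congr cons.
rewrite /rate /level big1 ?add0n ?powR1 ?mulr1//.
Qed.

(** Each factor b / (b - c) is at most exp (c / (b - c)).  The k-th rate is at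
    least a * k ^ p, so b - c is at least (a - c) * k ^ p, and the exponents
    telescope against zeta_tail. *)
Lemma prod_rates_bound c K (z : {ffun 'I_K -> nat}) : 1 < p -> 0 <= c -> c < a ->
  positive_multiindices K z ->
  \prod_(b <- rates z) (b / (b - c)) <= expR (c / (a - c) * zeta_tail p 1).
Proof.
move=> p1 c0 ca zp; rewrite /rates big_map big_enum/=.
apply: (@le_trans _ _ (\prod_(k < K) expR (c / (a - c) * (zeta_tail p k.+1 - zeta_tail p k.+2)))).
  apply: ler_prod => k _.
  have b0 : a <= rate z k := rate_ge z k.
  have bc : 0 < rate z k - c by rewrite subr_gt0 (lt_le_trans ca).
  apply/andP; split; first by rewrite divr_ge0 ?(ltW bc)// (le_trans (ltW a0)).
  have -> : rate z k / (rate z k - c) = 1 + c / (rate z k - c).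
    by field; rewrite gt_eqF.
  apply: le_trans (expR_ge1Dx _) _; rewrite ler_expR -mulrA ler_wpM2l//.
  apply: (@le_trans _ _ ((a - c)^-1 * k.+1%:R `^ (- p))); last first.
    by rewrite ler_wpM2l ?zeta_tail_step// invr_ge0 subr_ge0 ltW.
  have k0 : 0 < k.+1%:R `^ p :> R by rewrite powR_gt0.
  rewrite powRN -invfM lef_pV2 ?posrE ?mulr_gt0 ?subr_gt0// ?(lt_le_trans ca b0)//.
  apply: (@le_trans _ _ (a * k.+1%:R `^ p - c)).
    rewrite mulrBl lerD2l lerN2 ler_peMr//.
    rewrite -[leLHS](congr1 (@^~ p) (@powR1 R)); apply: ge0_ler_powR; rewrite ?nnegrE ?(ltW p0)//.
    by rewrite ler1n.
  rewrite lerD2r /rate ler_pM2l//; apply: ge0_ler_powR; rewrite ?nnegrE ?(ltW p0)//.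
  exact: level_ge_ord.
rewrite -expR_sum ler_expR -big_distrr/= ler_wpM2l//.
  by rewrite divr_ge0// subr_ge0 ltW.
rewrite -(big_mkord xpredT (fun k => zeta_tail p k.+1 - zeta_tail p k.+2)).
under eq_bigr do rewrite -[X in X - _]opprK addrC.
rewrite (telescope_sumr (fun k => - zeta_tail p k.+1))//.
by rewrite opprK addrC lerBlDr lerDl zeta_tail_ge0.
Qed.

End levels.

(** * Averages over the jumps *)

Section mean.
Context (R : realType) (r : nat -> R).
Hypotheses (r0 : forall k, 0 <= r k) (r00 : r 0%N = 0)
  (r1 : (\esum_(k in [set: nat]) (r k)%:E = 1)%E).
Implicit Types K : nat.

Definition mean K (G : {ffun 'I_K -> nat} -> R) : R :=
  fine (\esum_(z in [set: {ffun 'I_K -> nat}]) (multi_pmf r z * G z)%:E)%E.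

Lemma multi_pmf_eq0 K (z : {ffun 'I_K -> nat}) : ~ positive_multiindices K z ->
  multi_pmf r z = 0.
Proof.
move=> /existsNP[k /negP]; rewrite -eqn0Ngt => /eqP zk.
by rewrite /multi_pmf (bigD1 k)//= zk r00 mul0r.
Qed.

Lemma esum_multi_pmf K : (\esum_(z in [set: {ffun 'I_K -> nat}]) (multi_pmf r z)%:E = 1)%E.
Proof.
rewrite (@esum_prod _ _ (fun=> r) (fun=> 1))// big1//.
Qed.

Lemma multi_pmf_mul_ge0 K (G : {ffun 'I_K -> nat} -> R) :
  (forall z, positive_multiindices K z -> 0 <= G z) ->
  forall z, 0 <= multi_pmf r z * G z.
Proof.
move=> G0 z; have [zp|/multi_pmf_eq0 ->] := pselect (positive_multiindices K z).
  by rewrite mulr_ge0 ?multi_pmf_ge0// G0.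
by rewrite mul0r.
Qed.

Lemma le_esum_mean K (G H : {ffun 'I_K -> nat} -> R) :
  (forall z, positive_multiindices K z -> G z <= H z) ->
  (\esum_(z in [set: {ffun 'I_K -> nat}]) (multi_pmf r z * G z)%:E <=
   \esum_(z in [set: {ffun 'I_K -> nat}]) (multi_pmf r z * H z)%:E)%E.
Proof.
move=> GH; apply: le_esum => z _; rewrite lee_fin.
have [zp|/multi_pmf_eq0 ->] := pselect (positive_multiindices K z).
  by rewrite ler_wpM2l ?multi_pmf_ge0// GH.
by rewrite !mul0r.
Qed.

Lemma meanP K (G : {ffun 'I_K -> nat} -> R) (M : R) :
  (forall z, positive_multiindices K z -> 0 <= G z <= M) ->
  (\esum_(z in [set: {ffun 'I_K -> nat}]) (multi_pmf r z * G z)%:E = (mean G)%:E)%E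
  /\ 0 <= mean G <= M.
Proof.
move=> GM; have M0 : 0 <= M.
  have /GM/andP[] : positive_multiindices K [ffun=> 1%N] by move=> k; rewrite ffunE.
  exact: le_trans.
have G0 : forall z, 0 <= multi_pmf r z * G z.
  by apply: multi_pmf_mul_ge0 => z /GM/andP[].
set S := esum _ _; have SM : (S <= M%:E)%E.
  have -> : M%:E = (M%:E * \esum_(z in [set: {ffun 'I_K -> nat}]) (multi_pmf r z)%:E)%E.
    by rewrite esum_multi_pmf mule1.
  rewrite -esumZl//; last by move=> z; rewrite lee_fin multi_pmf_ge0.
  apply: le_esum => z _; rewrite -EFinM lee_fin mulrC.
  have [/GM/andP[_ zM]|/multi_pmf_eq0 ->] := pselect (positive_multiindices K z).
    by rewrite ler_wpM2r ?multi_pmf_ge0.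
  by rewrite !mulr0.
have S0 : (0 <= S)%E by apply: esum_ge0 => z _; rewrite lee_fin.
have SE : S = (mean G)%:E.
  by rewrite /mean fineK// ge0_fin_numE// (le_lt_trans SM)// ltry.
by move: SM S0; rewrite SE !lee_fin => -> ->.
Qed.

(** Averaging over the last jump preserves the inequality. *)
Lemma mean_frcons_ge K (G : {ffun 'I_K -> nat} -> R) (H : {ffun 'I_K.+1 -> nat} -> R) (M : R) :
  (forall z, positive_multiindices K z -> 0 <= G z <= M) ->
  (forall z, positive_multiindices K.+1 z -> 0 <= H z <= M) ->
  (forall z k, positive_multiindices K z -> G z <= H (frcons z k)) ->
  mean G <= mean H.
Proof.
move=> GM HM GH; rewrite -lee_fin -(meanP GM).1 -(meanP HM).1.
rewrite esum_multi_pmfS//; last by apply: multi_pmf_mul_ge0 => z /HM/andP[].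
apply: le_esum => z _.
have [zp|/multi_pmf_eq0 ->] := pselect (positive_multiindices K z); last first.
  by rewrite mul0r mul0e.
rewrite EFinM lee_wpmul2l ?lee_fin ?multi_pmf_ge0//.
rewrite -[leLHS]mule1 -r1 -esumZl//.
- by apply: le_esum => k _; rewrite -EFinM lee_fin mulrC ler_wpM2l// GH.
- by case/andP: (GM z zp).
Qed.

Lemma eq_mean K (G H : {ffun 'I_K -> nat} -> R) :
  (forall z, positive_multiindices K z -> G z = H z) -> mean G = mean H.
Proof.
move=> GH; rewrite /mean; congr fine; apply: eq_esum => z _.
by have [/GH ->|/multi_pmf_eq0 ->] := pselect (positive_multiindices K z); rewrite ?mul0r.
Qed.

Lemma meanD K (G H : {ffun 'I_K -> nat} -> R) (M : R) :
  (forall z, positive_multiindices K z -> 0 <= G z <= M) ->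
  (forall z, positive_multiindices K z -> 0 <= H z <= M) ->
  mean (fun z => G z + H z) = mean G + mean H.
Proof.
move=> GM HM; apply: EFin_inj; rewrite EFinD -(meanP GM).1 -(meanP HM).1.
have GHM z : positive_multiindices K z -> 0 <= G z + H z <= M + M.
  by move=> zp; case/andP: (GM z zp) => ? ?; case/andP: (HM z zp) => ? ?; rewrite addr_ge0//= lerD.
rewrite -(meanP GHM).1 -esumD.
- by apply: eq_esum => z _; rewrite mulrDr EFinD.
- by move=> z _; rewrite lee_fin multi_pmf_mul_ge0// => z' /GM/andP[].
- by move=> z _; rewrite lee_fin multi_pmf_mul_ge0// => z' /HM/andP[].
Qed.

Lemma meanZ K (c : R) (G : {ffun 'I_K -> nat} -> R) (M : R) : 0 <= c ->
  (forall z, positive_multiindices K z -> 0 <= G z <= M) ->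
  mean (fun z => c * G z) = c * mean G.
Proof.
move=> c0 GM; apply: EFin_inj; rewrite EFinM -(meanP GM).1.
have cGM z : positive_multiindices K z -> 0 <= c * G z <= c * M.
  by move=> zp; case/andP: (GM z zp) => ? ?; rewrite mulr_ge0//= ler_wpM2l.
rewrite -(meanP cGM).1 -esumZl//.
  by apply: eq_esum => z _; rewrite mulrCA EFinM.
by move=> z; rewrite lee_fin multi_pmf_mul_ge0// => z' /GM/andP[].
Qed.

End mean.

(** * The limit density *)

Section limit_density.
Context (R : realType) (a p : R) (r : nat -> R).
Hypotheses (a0 : 0 < a) (p1 : 1 < p).
Hypotheses (r0 : forall k, 0 <= r k) (r00 : r 0%N = 0)
  (r1 : (\esum_(k in [set: nat]) (r k)%:E = 1)%E).
Notation mu := (@lebesgue_measure R).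

Let p0 : 0 < p. Proof. exact: lt_trans p1. Qed.

Local Notation rts := (rates a p).
Local Notation pos := (positive_multiindices _).

Definition mean_pdf K (x : R) : R := mean r (fun z : {ffun 'I_K -> nat} => hypoexp_pdf (rts z) x).

Let rts_pos K (z : {ffun 'I_K -> nat}) : all (fun b => 0 < b) (rts z).
Proof. exact: rates_gt. Qed.

Let rts_uniq K (z : {ffun 'I_K -> nat}) : pos z -> uniq (rts z).
Proof. exact: rates_uniq. Qed.

Let rts_mem K (z : {ffun 'I_K.+1 -> nat}) : a \in rts z.
Proof. by rewrite rates_head mem_head. Qed.

(** The first level is 1, so that a is among the rates as soon as there is
    one, and the exponential bound applies with this rate. *)
Lemma hypoexp_pdf_rates_bound K (z : {ffun 'I_K -> nat}) (c x : R) : 0 <= c -> c < a -> 0 <= x ->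
  pos z -> 0 <= hypoexp_pdf (rts z) x <= a * expR (c / (a - c) * zeta_tail p 1) * expR (- (c * x)).
Proof.
move=> c0 ca x0 zp; rewrite hypoexp_pdf_ge0 ?rts_uniq//=.
case: K z zp => [|K] z zp.
  rewrite /rates enum_ord0 /hypoexp_pdf big_nil.
  by rewrite !mulr_ge0 ?expR_ge0 ?(ltW a0).
apply: le_trans (hypoexp_pdf_exp_bound (rts_uniq zp) (rates_gt a0 p0 z ca) c0 x0 (rts_mem z)) _.
by rewrite ler_wpM2r ?expR_ge0// ler_wpM2l ?(ltW a0)// prod_rates_bound.
Qed.

Lemma mean_pdf_bound K (c x : R) : 0 <= c -> c < a -> 0 <= x ->
  0 <= mean_pdf K x <= a * expR (c / (a - c) * zeta_tail p 1) * expR (- (c * x)).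
Proof.
move=> c0 ca x0; apply: (meanP r0 r00 r1 _).2.
by move=> z zp; exact: hypoexp_pdf_rates_bound.
Qed.

Let mean_tail K (x : R) : R := mean r (fun z : {ffun 'I_K.+1 -> nat} => hypoexp_tail (rts z) x).
Let mean_tail' K (x : R) : R := mean r (fun z : {ffun 'I_K.+1 -> nat} => hypoexp_tail (behead (rts z)) x).

Lemma hypoexp_tail_rcons (s : seq R) b x : uniq (rcons s b) -> all (fun c => 0 < c) (rcons s b) ->
  0 <= x -> hypoexp_tail s x <= hypoexp_tail (rcons s b) x.
Proof.
move=> ub pb x0; have E : perm_eq (rcons s b) (b :: s) by rewrite perm_rcons.
rewrite (perm_hypoexp_tail _ E); move: ub pb; rewrite (perm_uniq E) (perm_all _ E) => ub pb.
have := hypoexp_pdf_ge0 ub pb x0.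
move: ub pb; rewrite cons_uniq => /andP[bs us] /= /andP[b0 _].
by rewrite hypoexp_pdf_cons// pmulr_rge0// subr_ge0.
Qed.

Let behead_uniq K (z : {ffun 'I_K.+1 -> nat}) : pos z -> uniq (behead (rts z)).
Proof. by move=> /rts_uniq; rewrite rates_head => /andP[]. Qed.

Let behead_pos K (z : {ffun 'I_K.+1 -> nat}) : all (fun b => 0 < b) (behead (rts z)).
Proof. by have := rts_pos z; rewrite rates_head => /andP[]. Qed.

Let tail01 K (z : {ffun 'I_K.+1 -> nat}) x : 0 <= x -> pos z -> 0 <= hypoexp_tail (rts z) x <= 1.
Proof. by move=> x0 zp; rewrite hypoexp_tail_ge0 ?hypoexp_tail_le1 ?rts_uniq. Qed.

Let tail01' K (z : {ffun 'I_K.+1 -> nat}) x : 0 <= x -> pos z ->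
  0 <= hypoexp_tail (behead (rts z)) x <= 1.
Proof. by move=> x0 zp; rewrite hypoexp_tail_ge0 ?hypoexp_tail_le1 ?behead_uniq. Qed.

(** The first rate is a for every multi-index, so that the identity for one
    more rate may be averaged. *)
Lemma mean_pdfE K x : 0 <= x -> mean_pdf K.+1 x = a * (mean_tail K x - mean_tail' K x).
Proof.
move=> x0; have H z : pos z -> 0 <= hypoexp_pdf (rts z) x <= a * expR (0 / (a - 0) * zeta_tail p 1) * expR (- (0 * x)).
  by move=> zp; apply: hypoexp_pdf_rates_bound.
have G z : positive_multiindices K.+1 z -> 0 <= a * hypoexp_tail (behead (rts z)) x <= a * 1.
  by move=> zp; case/andP: (tail01' x0 zp) => t0 t1; rewrite mulr_ge0 ?(ltW a0)//= ler_wpM2l ?(ltW a0).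
apply/eqP; rewrite mulrBr eq_sym subr_eq eq_sym /mean_tail /mean_tail'.
rewrite -(meanZ r0 r00 r1 (ltW a0) (fun z zp => tail01 x0 zp)).
rewrite -(meanZ r0 r00 r1 (ltW a0) (fun z zp => tail01' x0 zp)).
pose M := Num.max (a * 1) (a * expR (0 / (a - 0) * zeta_tail p 1) * expR (- (0 * x))).
rewrite -(meanD r0 r00 r1 (M := M)).
- apply/eqP; apply: eq_mean => // z zp.
  have := rts_uniq zp; rewrite rates_head => /andP[ab _].
  by rewrite hypoexp_pdf_cons// mulrBr subrK.
- by move=> z /H/andP[-> h]; rewrite le_max h orbT.
- by move=> z /G/andP[-> h]; rewrite le_max h.
Qed.

Let pos_frcons K (z : {ffun 'I_K -> nat}) k : pos z -> (0 < k)%N -> pos (frcons z k).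
Proof.
move=> zp k0 i; have [j ->|->] := unliftP ord_max i; last by rewrite frcons_max.
by rewrite ffunE liftK /= zp.
Qed.

(** One more exponential variable makes the sum larger. *)
Lemma mean_tail_ndecr x : 0 <= x -> nondecreasing_seq (mean_tail ^~ x).
Proof.
move=> x0; apply/nondecreasing_seqP => K; apply: (mean_frcons_ge r0 r00 r1 (M := 1)) => //.
- by move=> z zp; exact: tail01.
- by move=> z zp; exact: tail01.
move=> z k zp; have := rts_uniq (pos_frcons zp (ltn0Sn 0)).
have := rts_pos (frcons z 1).
by rewrite !rates_frcons => up pp; apply: hypoexp_tail_rcons.
Qed.

Lemma mean_tail'_ndecr x : 0 <= x -> nondecreasing_seq (mean_tail' ^~ x).
Proof.
move=> x0; apply/nondecreasing_seqP => K; apply: (mean_frcons_ge r0 r00 r1 (M := 1)) => //.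
- by move=> z zp; exact: tail01'.
- by move=> z zp; exact: tail01'.
move=> z k zp; have := behead_uniq (pos_frcons zp (ltn0Sn 0)).
have := behead_pos (frcons z 1).
rewrite !rates_frcons (rates_head a p z) /= => up pp; exact: hypoexp_tail_rcons.
Qed.

(** The averaged densities are controlled on x >= 0, and the density of the
    nonnegative variable J vanishes on x < 0. *)
Definition limit_pdf (x : R) : R := if 0 <= x then limn (mean_pdf ^~ x) else 0.

(** A difference of two bounded nondecreasing sequences converges. *)
Lemma cvg_mean_pdf x : 0 <= x -> mean_pdf K x @[K --> \oo] --> limit_pdf x.
Proof.
move=> x0; rewrite /limit_pdf x0; apply/cvg_ex => /=.
have C1 : cvgn (mean_tail ^~ x).
  apply: nondecreasing_is_cvgn; first exact: mean_tail_ndecr.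
  by exists 1 => _ [K _ <-]; have := (meanP r0 r00 r1 (fun (z : {ffun 'I_K.+1 -> nat}) zp => tail01 x0 zp)).2 => /andP[].
have C2 : cvgn (mean_tail' ^~ x).
  apply: nondecreasing_is_cvgn; first exact: mean_tail'_ndecr.
  by exists 1 => _ [K _ <-]; have := (meanP r0 r00 r1 (fun (z : {ffun 'I_K.+1 -> nat}) zp => tail01' x0 zp)).2 => /andP[].
exists (a * (limn (mean_tail ^~ x) - limn (mean_tail' ^~ x))).
rewrite -cvg_shiftS /=; under eq_fun do rewrite mean_pdfE//.
by apply: cvgMr; apply: cvgB.
Qed.

Lemma limit_pdf_lt0 x : x < 0 -> limit_pdf x = 0.
Proof. by move=> x0; rewrite /limit_pdf leNgt x0. Qed.

Lemma limit_pdf_ge0 x : 0 <= limit_pdf x.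
Proof.
have [x0|x0] := leP 0 x; last by rewrite limit_pdf_lt0.
have C := cvg_mean_pdf x0; rewrite -(cvg_lim _ C)//; apply: limr_ge; first by apply/cvg_ex; exists (limit_pdf x).
by apply: nearW => K; case/andP: (mean_pdf_bound K (lexx 0) a0 x0).
Qed.

Lemma measurable_hypoexp_pdf s D : measurable_fun D (@hypoexp_pdf R s).
Proof.
apply: measurable_funTS; apply: measurable_sum => b.
apply: measurable_funM; last exact: measurable_cst.
by apply: measurable_funM; [exact: measurable_cst|exact: measurable_expRM].
Qed.

(** The sum over multi-indices is known to be finite on the half-line, hence
    the composition with the positive part. *)
Lemma measurable_mean_pdf_max K : measurable_fun [set: R] (fun x => mean_pdf K (Num.max x 0)).
Proof.
apply/measurable_EFinP.
have m0 (x : R) : 0 <= Num.max x 0 by rewrite le_max lexx orbT.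
pose f (z : {ffun 'I_K -> nat}) x := (multi_pmf r z * hypoexp_pdf (rts z) (Num.max x 0))%:E.
rewrite (_ : EFin \o _ = (fun x => \esum_(z in [set: {ffun 'I_K -> nat}]) f z x)%E); last first.
  apply/funext => x /=.
  by rewrite /mean_pdf -(meanP r0 r00 r1 (fun z zp => hypoexp_pdf_rates_bound (lexx 0) a0 (m0 x) zp)).1.
apply: measurable_fun_esum => //.
- move=> z; apply/measurable_EFinP; apply: measurable_funM => //.
  apply: (@measurableT_comp _ _ _ _ _ _ (hypoexp_pdf (rts z))); first exact: measurable_hypoexp_pdf.
  exact: measurable_maxr.
- move=> z x; rewrite lee_fin.
  apply: (multi_pmf_mul_ge0 r0 r00 (G := fun z => hypoexp_pdf (rts z) (Num.max x 0))) => z' zp.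
  by case/andP: (hypoexp_pdf_rates_bound (lexx 0) a0 (m0 x) zp).
Qed.

Lemma measurable_mean_pdf K : measurable_fun (`[0, +oo[%classic : set R) (mean_pdf K).
Proof.
have H : measurable_fun (`[0, +oo[%classic : set R) (fun x => mean_pdf K (Num.max x 0)).
  by apply: measurable_funTS; exact: measurable_mean_pdf_max.
apply: eq_measurable_fun H => x; rewrite inE/= in_itv/= andbT => x0.
by rewrite max_l.
Qed.

Lemma measurable_limit_pdf : measurable_fun [set: R] limit_pdf.
Proof.
apply: (@measurable_fun_cvg _ R R setT
  (fun (K : nat) (x : R) => if 0 <= x then mean_pdf K (Num.max x 0) else 0)).
  move=> K; apply: measurable_fun_ifT => //; last exact: measurable_mean_pdf_max.
  exact: measurable_fun_ler.
move=> x _; have [x0|x0] := leP 0 x.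
  exact: cvg_mean_pdf.
by rewrite limit_pdf_lt0//; exact: cvg_cst.
Qed.

Lemma osc_integral_mean_pdf K (c d : R) (u : R[i]) : (0 < K)%N -> `|c| + `|d| <= 1 ->
  - a < complex.Re u ->
  (\int[mu]_(x in `[0%R, +oo[)
    (expR (- (complex.Re u * x)) * osc c d (- complex.Im u) x * mean_pdf K x)%:E =
  \esum_(z in [set: {ffun 'I_K -> nat}]) (multi_pmf r z *
     (\prod_(b <- rts z) (b / (b + complex.Re u)) +
      (c * complex.Re (\prod_(b <- rts z) (b%:C / (b%:C + u))) +
       d * complex.Im (\prod_(b <- rts z) (b%:C / (b%:C + u))))))%:E)%E.
Proof.
move=> K0 cd ua.
pose k x := expR (- (complex.Re u * x)) * osc c d (- complex.Im u) x.
have k0 x : 0 <= k x by rewrite mulr_ge0 ?expR_ge0//; case/andP: (osc_bound (- complex.Im u) x cd).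
have mk D : measurable_fun D k.
  by apply: measurable_funM; [exact: measurable_expRM|exact: measurable_osc].
pose f (z : {ffun 'I_K -> nat}) x := (multi_pmf r z * (k x * hypoexp_pdf (rts z) (Num.max x 0)))%:E.
transitivity (\int[mu]_(x in `[0%R, +oo[) \esum_(z in [set: {ffun 'I_K -> nat}]) f z x)%E.
  apply: eq_integral => x; rewrite inE/= in_itv/= andbT => x0.
  rewrite -/(k x) EFinM /mean_pdf -(meanP r0 r00 r1 (fun z zp => hypoexp_pdf_rates_bound (lexx 0) a0 x0 zp)).1.
  rewrite -esumZl//; last first.
    move=> z; rewrite lee_fin.
    apply: (multi_pmf_mul_ge0 r0 r00 (G := fun z => hypoexp_pdf (rts z) x)) => z' zp.
    by case/andP: (hypoexp_pdf_rates_bound (lexx 0) a0 x0 zp).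
  by apply: eq_esum => z _; rewrite -EFinM /f max_l// mulrCA.
have m0 (x : R) : 0 <= Num.max x 0 by rewrite le_max lexx orbT.
rewrite integral_esum//.
- apply: eq_esum => z _.
  have [zp|/(multi_pmf_eq0 r00) E] := pselect (pos z); last first.
    rewrite E mul0r; under eq_integral do rewrite /f E mul0r.
    by rewrite integral0.
  have sn : rts z != [::] by case: K K0 z {f zp} => // K' _ z; rewrite rates_head.
  have sall : all (fun b => 0 < b + complex.Re u) (rts z).
    apply/allP => _ /mapP[i _ ->]; rewrite -ltrBlDr sub0r.
    by rewrite (lt_le_trans _ (rate_ge a0 p0 z i))// ltrNl.
  have [I IE] := hypoexp_laplace sn (rts_uniq zp) cd sall.
  rewrite EFinM -IE -ge0_integralZl//; last 3 first.
  + by case/integrableP: I.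
  + move=> x; rewrite /= in_itv/= andbT => x0.
    rewrite lee_fin mulr_ge0//; last by rewrite hypoexp_pdf_ge0// rts_uniq.
    exact: k0.
  + by rewrite lee_fin multi_pmf_ge0.
  apply: eq_integral => x; rewrite inE/= in_itv/= andbT => x0.
  by rewrite /f max_l.
- move=> z; apply: measurable_funTS; apply/measurable_EFinP; apply: measurable_funM => //.
  apply: measurable_funM; first exact: mk.
  apply: (@measurableT_comp _ _ _ _ _ _ (hypoexp_pdf (rts z))); first exact: measurable_hypoexp_pdf.
  exact: measurable_maxr.
- move=> z x; rewrite lee_fin.
  apply: (multi_pmf_mul_ge0 r0 r00 (G := fun z => k x * hypoexp_pdf (rts z) (Num.max x 0))) => z' zp.
  by rewrite mulr_ge0//; case/andP: (hypoexp_pdf_rates_bound (lexx 0) a0 (m0 x) zp).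
Qed.

(** The averaged densities are dominated by a multiple of exp (- e x), for any
    e in ]- v, a[ with e >= 0. *)
Lemma osc_integral_cvg (c d v w : R) : `|c| + `|d| <= 1 -> - a < v ->
  mu.-integrable `[0, +oo[ (fun x => (expR (- (v * x)) * osc c d w x * limit_pdf x)%:E) /\
  ((\int[mu]_(x in `[0%R, +oo[) (expR (- (v * x)) * osc c d w x * mean_pdf K x)%:E)
     @[K --> \oo] -->
   \int[mu]_(x in `[0%R, +oo[) (expR (- (v * x)) * osc c d w x * limit_pdf x)%:E)%E.
Proof.
move=> cd va.
have [e [e0 ea ve]] : exists e, [/\ 0 <= e, e < a & 0 < v + e].
  have [v0|v0] := ltP 0 v; first by exists 0; rewrite addr0.
  by exists ((a - v) / 2); split; lra.
pose C := a * expR (e / (a - e) * zeta_tail p 1).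
have C0 : 0 <= C by rewrite mulr_ge0 ?expR_ge0 ?(ltW a0).
have mk D : measurable_fun D (fun x => expR (- (v * x)) * osc c d w x).
  by apply: measurable_funM; [exact: measurable_expRM|exact: measurable_osc].
apply: (@dominated_cvg_real _ _ R mu `[0%R, +oo[%classic
   (fun K x => expR (- (v * x)) * osc c d w x * mean_pdf K x)
   (fun x => expR (- (v * x)) * osc c d w x * limit_pdf x)
   (fun x => (2 * C) * expR (- ((v + e) * x)))) => //.
- by move=> n; apply: (measurable_funM (mk _)); exact: measurable_mean_pdf.
- by apply: (measurable_funM (mk _)); apply: measurable_funTS; exact: measurable_limit_pdf.
- move=> x /=; rewrite in_itv/= andbT => x0.
  by apply: cvgM; [exact: cvg_cst|exact: cvg_mean_pdf].
- have cd0 : `|0 : R| + `|0 : R| <= 1 by rewrite normr0 addr0.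
  have I := @integrable_expR_osc R 0 0 0 (v + e) cd0 ve.
  have := @integrableZl _ _ R mu _ (measurable_itv _) (2 * C) _ I; apply: eq_integrable => // x _.
  by rewrite /osc !mul0r !addr0 mulr1.
move=> x n /=; rewrite in_itv/= andbT => x0.
case/andP: (mean_pdf_bound n e0 ea x0) => m0 mC.
case/andP: (osc_bound w x cd) => o0 o2.
rewrite ger0_norm ?mulr_ge0 ?expR_ge0//.
have -> : - ((v + e) * x) = - (v * x) + - (e * x) by ring.
rewrite expRD; have -> : 2 * C * (expR (- (v * x)) * expR (- (e * x))) =
  expR (- (v * x)) * 2 * (C * expR (- (e * x))) by ring.
by apply: ler_pM => //; rewrite ?mulr_ge0 ?expR_ge0// ler_wpM2l ?expR_ge0.
Qed.

End limit_density.

(** * Iterated Poisson laws *)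

Section poisson_kernel.
Context (R : realType).

(** The Poisson law extended to the rate 0, where it is the point mass at 0
    while poisson_pmf is constantly 1. *)
Definition poisson_weight (x : R) (k : nat) : R :=
  if 0 < x then poisson_pmf x k else (k == 0%N)%:R.

Lemma poisson_weight_ge0 x k : 0 <= poisson_weight x k.
Proof. by rewrite /poisson_weight; case: ifP => // _; rewrite poisson_pmf_ge0. Qed.

Lemma esum_pointmass (n : nat) (f : nat -> R) : (forall k, 0 <= f k) ->
  (\esum_(k in [set: nat]) ((k == n)%:R * f k)%:E = (f n)%:E)%E.
Proof.
move=> f0; rewrite -[RHS](@esum_set1 _ _ n (fun k => (f k)%:E)) ?lee_fin//.
rewrite [RHS]esum_mkcond; apply: eq_esum => k _.
have -> : (k \in [set n]) = (k == n) by apply/idP/eqP; rewrite inE.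
by case: eqP => [->|_]; rewrite ?mul1r ?mul0r.
Qed.

Lemma poisson_weight_sum x : (\esum_(k in [set: nat]) (poisson_weight x k)%:E = 1)%E.
Proof.
rewrite /poisson_weight; have [x0|x0] := boolP (0 < x); last first.
  have := @esum_pointmass 0%N (fun=> 1) (fun=> ler01).
  by under eq_esum do rewrite mulr1.
have := @probability_setT _ _ R (poisson_prob x 0).
by rewrite /= /poisson_prob x0.
Qed.

(** The law of N_V, when V has law nu and N is an independent Poisson process
    of rate lambda. *)
Definition poisson_step (lambda : R) (nu : nat -> R) (k : nat) : R :=
  fine (\esum_(j in [set: nat]) (nu j * poisson_weight (lambda * j%:R) k)%:E)%E.

Definition is_pmf (nu : nat -> R) := (forall k, 0 <= nu k) /\ (\esum_(k in [set: nat]) (nu k)%:E = 1)%E.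

Lemma esum_exchange (I J : countType) (f : I -> J -> \bar R) : (forall i j, (0 <= f i j)%E) ->
  (\esum_(i in [set: I]) \esum_(j in [set: J]) f i j =
   \esum_(j in [set: J]) \esum_(i in [set: I]) f i j)%E.
Proof.
move=> f0; rewrite !esum_esum//.
rewrite (reindex_esum ([set: J] `*`` (fun=> [set: I])) _ (fun x => (x.2, x.1)))//.
split=> //=.
- by move=> [i1 i2] [j1 j2] /= _ _ [] -> ->.
- by move=> [i j] _; exists (j, i).
Qed.

Lemma poisson_weight_le1 x k : poisson_weight x k <= 1.
Proof.
rewrite -lee_fin -(poisson_weight_sum x) (esumID [set k])/=; last by move=> i _; rewrite lee_fin poisson_weight_ge0.
rewrite setTI esum_set1 ?lee_fin ?poisson_weight_ge0// leeDl//.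
by apply: esum_ge0 => i _; rewrite lee_fin poisson_weight_ge0.
Qed.

Lemma poisson_stepE lambda nu k : is_pmf nu ->
  (\esum_(j in [set: nat]) (nu j * poisson_weight (lambda * j%:R) k)%:E = (poisson_step lambda nu k)%:E)%E.
Proof.
move=> [nu0 nu1]; rewrite /poisson_step fineK// ge0_fin_numE; last first.
  by apply: esum_ge0 => j _; rewrite lee_fin mulr_ge0 ?poisson_weight_ge0.
apply: (@le_lt_trans _ _ 1%E); last exact: ltry.
by rewrite -nu1; apply: le_esum => j _; rewrite lee_fin ler_piMr ?poisson_weight_le1.
Qed.

Lemma poisson_step_pmf lambda nu : is_pmf nu -> is_pmf (poisson_step lambda nu).
Proof.
move=> nup; have [nu0 nu1] := nup; split=> [k|].
  by rewrite -lee_fin -poisson_stepE//; apply: esum_ge0 => j _; rewrite lee_fin mulr_ge0 ?poisson_weight_ge0.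
under eq_esum do rewrite -poisson_stepE//.
rewrite esum_exchange; last by move=> i j; rewrite lee_fin mulr_ge0 ?poisson_weight_ge0.
rewrite -nu1; apply: eq_esum => j _.
under eq_esum do rewrite EFinM.
rewrite esumZl// ?poisson_weight_sum ?mule1// => i; by rewrite lee_fin poisson_weight_ge0.
Qed.

End poisson_kernel.

(** * Joint law of the iterated process on a time grid *)

Section countable_partition.
Context d (T : measurableType d) (R : realType) (mu : {measure set T -> \bar R}).
Local Open Scope ereal_scope.

Lemma esum_indic_partition (I : choiceType) (F : I -> set T) (g : I -> R) (i : I) (x : T) :
  trivIset setT F -> F i x -> (forall j, (0 <= g j)%R) ->
  \esum_(j in [set: I]) (\1_(F j) x * g j)%:E = (g i)%:E.
Proof.
move=> tF Fi g0; rewrite -[RHS](@esum_set1 _ _ i (fun k => (g k)%:E)) ?lee_fin//.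
rewrite [RHS]esum_mkcond; apply: eq_esum => k _.
case: ifPn => [|ki].
  by rewrite inE => ->; rewrite indicE mem_set// mul1r.
rewrite indicE memNset ?mul0r// => Fk; move: ki; rewrite notin_setE/= => ki.
by apply: ki; apply: (tF k i) => //; exists x.
Qed.

Lemma measure_countable_partition (I : countType) (F : I -> set T) (A : set T) :
  (forall i, measurable (F i)) -> trivIset setT F -> A = \bigcup_i F i ->
  mu A = \esum_(i in [set: I]) mu (F i).
Proof.
move=> mF tF AF.
have mA : measurable A by rewrite AF; apply: countable_bigcupT_measurable.
transitivity (\int[mu]_x \esum_(i in [set: I]) (\1_(F i) x)%:E).
  have <- : \int[mu]_x (\1_A x)%:E = mu A by rewrite integral_indic// setIT.
  apply: eq_integral => x _.
  rewrite indicE; have [|xA] := boolP (x \in A).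
    rewrite inE AF => -[i _ Fi].
    have := esum_indic_partition (g := fun=> 1%R) tF Fi (fun=> ler01).
    by under eq_esum do rewrite mulr1; move=> ->.
  rewrite esum1// => i _; rewrite indicE memNset// => Fi.
  by move: xA; rewrite notin_setE AF; apply; exists i.
rewrite integral_esum//.
- by apply: eq_esum => i _; rewrite integral_indic// setIT.
- by move=> i; apply/measurable_EFinP; exact: measurable_indic.
Qed.

End countable_partition.

Section poisson_events.
Context d (T : measurableType d) (R : realType) (P : probability T R).
Variables (lambda : R) (X : R -> {RV P >-> nat}).
Hypothesis hX : poisson_process lambda X.
Hypothesis lambda0 : 0 < lambda.

Definition partial_sum M (r : {ffun 'I_M -> nat}) (i : nat) : nat :=
  (\sum_(j < M | (j < i)%N) r j)%N.

Lemma partial_sum0 M (r : {ffun 'I_M -> nat}) : partial_sum r 0 = 0%N.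
Proof. by rewrite /partial_sum big1. Qed.

Lemma partial_sumS M (r : {ffun 'I_M -> nat}) (i : 'I_M) :
  partial_sum r i.+1 = (partial_sum r i + r i)%N.
Proof.
rewrite /partial_sum (bigD1 i)//= addnC; congr (_ + _)%N.
apply: eq_bigl => j; rewrite ltnS (leq_eqVlt j i) andb_orl; case: eqP => [/val_inj ->|ji] /=.
  by rewrite eqxx ltnn.
by rewrite andbC; case: (boolP (j == i)) => // /eqP ij; case: ji; rewrite ij.
Qed.

Lemma partial_sum_homo M (r : {ffun 'I_M -> nat}) i j : (i <= j)%N ->
  (partial_sum r i <= partial_sum r j)%N.
Proof.
move=> ij; rewrite /partial_sum big_mkcond [leqRHS]big_mkcond; apply: leq_sum => k _.
by case: ltnP => // ki; rewrite (leq_trans ki ij).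
Qed.

(** For a process that is nondecreasing from the value 0, these events form a
    partition indexed by the increments r, in which the probabilities are
    products. *)
Definition grid_event (Y : R -> T -> nat) (t : nat -> R) M (r : {ffun 'I_M -> nat}) : set T :=
  [set w | forall i : 'I_M, Y (t i.+1) w = partial_sum r i.+1].

Lemma process_sigma_event t k : 0 <= t -> process_sigma X [set w | X t w = k].
Proof.
move=> t0; apply: sub_sigma_algebra; exists t => //.
by exists [set k] => //; rewrite setTI.
Qed.

Lemma process_sigma_grid t M (r : {ffun 'I_M -> nat}) :
  (forall i, (i < M)%N -> 0 <= t i.+1) ->
  process_sigma X (grid_event (fun s => X s) t r).
Proof.
move=> t0; pose S := g_sigma_algebraType (\bigcup_(t in [set t | 0 <= t]) g_sigma_algebra_preimage (X t)).
rewrite (_ : grid_event _ _ _ = \bigcap_(i in [set: 'I_M]) [set w | X (t i.+1) w = partial_sum r i.+1]).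
  have : @measurable _ S (\bigcap_(i in [set: 'I_M]) [set w | X (t i.+1) w = partial_sum r i.+1]).
    apply: fin_bigcap_measurable => // i _.
    by apply: process_sigma_event; apply: t0.
  by [].
by apply/seteqP; split => w /= H i; [move=> _; exact: H|exact: H].
Qed.

Lemma poisson_grid_prob t M (r : {ffun 'I_M -> nat}) :
  t 0%N = 0 -> (forall i, (i < M)%N -> t i <= t i.+1) ->
  P (grid_event (fun s => X s) t r) =
  (\prod_(i < M) poisson_weight (lambda * (t i.+1 - t i)) (r i))%:E.
Proof.
move=> t0 tm.
have tge0 i : (i <= M)%N -> 0 <= t i.
  elim: i => [|i IH iM]; first by rewrite t0.
  by rewrite (le_trans (IH (ltnW iM)))// tm.
pose A (i : 'I_M) := [set w | (X (t i.+1) w - X (t i) w)%N = r i].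
have -> : grid_event (fun s => X s) t r = \bigcap_(i in [set i | i \in [set: 'I_M]%SET]) A i.
  apply/seteqP; split => w /= H.
    move=> i _; rewrite /A/=.
    have -> : X (t i) w = partial_sum r i.
      case: i => -[|i] iM /=; first by rewrite t0 (pp_start hX) partial_sum0.
      exact: (H (Ordinal (ltnW iM))).
    by rewrite (H i) partial_sumS addKn.
  have Hn i : (i <= M)%N -> X (t i) w = partial_sum r i.
    elim: i => [|i IH] iM; first by rewrite t0 (pp_start hX) partial_sum0.
    have := H (Ordinal iM); rewrite /A/= inE => /(_ isT) Hi.
    rewrite (partial_sumS r (Ordinal iM)) /= -IH ?(ltnW iM)// -Hi subnKC//.
    by apply: (pp_nondecreasing hX); [exact: tge0 (ltnW iM)|exact: tm].
  by move=> i; exact: Hn.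
have t00 : 0 <= t 0%N by rewrite t0.
rewrite (pp_independent_increments hX t00 tm); last first.
  by move=> i _; exists [set r i] => //; rewrite setTI.
congr (_%:E); rewrite big_mkcond/=; apply: eq_bigr => i _; rewrite inE.
have := tm i (ltn_ord i); rewrite le_eqVlt => /orP[/eqP tE|tlt].
  rewrite /A -tE subrr mulr0 /poisson_weight ltxx.
  rewrite (_ : [set w | _] = if r i == 0%N then setT else set0).
    by case: eqP => _; rewrite ?probability_setT ?measure0.
  by apply/seteqP; split => w /=; rewrite subnn; case: eqP => [->|+] // => + h; rewrite h.
rewrite (pp_poisson_increments hX _ tlt) ?tge0 ?(ltnW (ltn_ord i))//=.
by rewrite /poisson_weight mulr_gt0// subr_gt0.
Qed.

End poisson_events.

Section iterated_poisson.
Context d (T : measurableType d) (R : realType) (P : probability T R).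
Variables (n : nat) (lambda : R) (N : nat -> R -> {RV P >-> nat}).
Hypothesis lambda0 : 0 < lambda.
Hypothesis hN : forall i, (1 <= i <= n)%N -> poisson_process lambda (N i).
Hypothesis hNindep : mutually_independent P (fun i : 'I_n => process_sigma (N i.+1)).

Definition mipp_nat m (s : R) (w : T) : nat := N m (mipp N m.-1 s w) w.

Lemma mippE m s w : (0 < m)%N -> mipp N m s w = (mipp_nat m s w)%:R.
Proof. by case: m. Qed.

Lemma mipp_ge0 m s w : 0 <= s -> 0 <= mipp N m s w.
Proof. by case: m. Qed.

Lemma mipp_homo m s t w : (m <= n)%N -> 0 <= s -> s <= t -> mipp N m s w <= mipp N m t w.
Proof.
move=> + s0 st; elim: m => [//|m IH] mn /=; rewrite ler_nat.
by apply: (pp_nondecreasing (hN _)) => //; [exact: mipp_ge0|exact: IH (ltnW mn)].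
Qed.

Lemma mipp_nat_homo m s t w : (0 < m <= n)%N -> 0 <= s -> s <= t ->
  (mipp_nat m s w <= mipp_nat m t w)%N.
Proof. by move=> /andP[m0 mn] s0 st; rewrite -(ler_nat R) -!mippE// mipp_homo. Qed.

Lemma mipp_start m w : (m <= n)%N -> mipp N m 0 w = 0.
Proof.
by elim: m => [//|m IH] mn /=; rewrite IH ?(ltnW mn)// (pp_start (hN _)).
Qed.

Lemma mipp_nat_start m w : (0 < m <= n)%N -> mipp_nat m 0 w = 0%N.
Proof.
move=> /andP[m0 mn]; apply/eqP; rewrite -(eqr_nat R) -mippE//; apply/eqP.
exact: mipp_start.
Qed.

Lemma measurable_mipp_nat m s : (0 < m)%N -> measurable_fun setT (mipp_nat m s).
Proof.
elim: m => // m IH _; rewrite /mipp_nat /=; case: m IH => [_|m IH] /=.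
  exact: measurable_funPT.
move=> _ Y mY; rewrite setTI.
rewrite (_ : _ @^-1` Y = \bigcup_j ((mipp_nat m.+1 s @^-1` [set j]) `&` (N m.+2 j%:R @^-1` Y))).
  apply: bigcupT_measurable => j; apply: measurableI.
    by rewrite -[X in measurable X]setTI; exact: IH.
  by rewrite -[X in measurable X]setTI; exact: measurable_funPT.
apply/seteqP; split => w /=; first by move=> Yw; exists (mipp_nat m.+1 s w).
by move=> [j _ [<-]].
Qed.

(** An event about the Poisson processes number m + 1, ..., n: the ordinal j
    stands for the process number j + 1. *)
Definition later (A : 'I_n -> set T) (m : nat) : set T :=
  \bigcap_(j in [set j | j \in [set j : 'I_n | (m <= j)%N]%SET]) A j.

Lemma process_sigma_measurable i A : process_sigma (N i) A -> measurable A.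
Proof.
apply: smallest_sub; first exact: sigma_algebra_measurable.
move=> B [t _ [C mC <-]]; exact: measurable_funPT.
Qed.

Lemma later_measurable A m : (forall j : 'I_n, (m <= j)%N -> process_sigma (N j.+1) (A j)) ->
  measurable (later A m).
Proof.
move=> hA; apply: fin_bigcap_measurable => // j /=; rewrite inE => mj.
exact: process_sigma_measurable (hA j mj).
Qed.

Lemma later_prob A m : (forall j : 'I_n, (m <= j)%N -> process_sigma (N j.+1) (A j)) ->
  P (later A m) = (\prod_(j < n | (m <= j)%N) fine (P (A j)))%:E.
Proof.
move=> hA; rewrite /later hNindep; last by move=> j; rewrite inE; exact: hA.
by congr (_%:E); apply: eq_bigl => j; rewrite inE.
Qed.

Lemma partial_sum_inj M (r r' : {ffun 'I_M -> nat}) :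
  (forall i : 'I_M, partial_sum r i.+1 = partial_sum r' i.+1) -> r = r'.
Proof.
move=> E; apply/ffunP => i.
have Ei : partial_sum r i = partial_sum r' i.
  case: i => -[|i] iM /=; first by rewrite !partial_sum0.
  exact: (E (Ordinal (ltnW iM))).
by apply/eqP; rewrite -(eqn_add2l (partial_sum r i)) -partial_sumS E partial_sumS Ei.
Qed.

Lemma grid_event_trivIset (Y : R -> T -> nat) t M :
  trivIset [set: {ffun 'I_M -> nat}] (grid_event Y t (M := M)).
Proof.
move=> r r' _ _ [w [Hr Hr']]; apply: partial_sum_inj => i.
by rewrite -(Hr i) -(Hr' i).
Qed.

Lemma grid_event_cover m (t : nat -> R) M w : (0 < m <= n)%N -> t 0%N = 0 ->
  (forall i, (i < M)%N -> t i <= t i.+1) ->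
  exists r : {ffun 'I_M -> nat}, grid_event (mipp_nat m) t r w.
Proof.
move=> mn t0 tm.
have tge0 i : (i <= M)%N -> 0 <= t i.
  elim: i => [|i IH iM]; first by rewrite t0.
  by rewrite (le_trans (IH (ltnW iM)))// tm.
pose r := [ffun i : 'I_M => (mipp_nat m (t i.+1) w - mipp_nat m (t i) w)%N].
exists r.
have Hn i : (i <= M)%N -> mipp_nat m (t i) w = partial_sum r i.
  elim: i => [|i IH] iM; first by rewrite t0 mipp_nat_start// partial_sum0.
  rewrite (partial_sumS r (Ordinal iM)) /= -IH ?(ltnW iM)// ffunE /= subnKC//.
  by apply: mipp_nat_homo => //; [exact: tge0 (ltnW iM)|exact: tm].
by move=> i; exact: Hn.
Qed.

Lemma grid_event_measurable m (t : nat -> R) M (r : {ffun 'I_M -> nat}) : (0 < m)%N ->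
  measurable (grid_event (mipp_nat m) t r).
Proof.
move=> m0; rewrite (_ : grid_event _ _ _ =
    \bigcap_(i in [set: 'I_M]) (mipp_nat m (t i.+1) @^-1` [set partial_sum r i.+1])).
  apply: fin_bigcap_measurable => // i _.
  by rewrite -[X in measurable X]setTI; exact: measurable_mipp_nat.
by apply/seteqP; split => w /= H i; [move=> _; exact: H|exact: H].
Qed.

(** The law at time h of the m-fold iterated process. *)
Definition mipp_pmf m (h : R) : nat -> R :=
  iter m.-1 (poisson_step lambda) (poisson_weight (lambda * h)).

Lemma mipp_pmfP m h : is_pmf (mipp_pmf m h).
Proof.
rewrite /mipp_pmf; elim: m.-1 => [|k IH] /=; last exact: poisson_step_pmf.
by split; [move=> k; exact: poisson_weight_ge0|exact: poisson_weight_sum].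
Qed.

Lemma first_layer m (t : nat -> R) M (r : {ffun 'I_M -> nat}) (A : 'I_n -> set T) :
  (m < n)%N -> t 0%N = 0 -> (forall i, (i < M)%N -> t i <= t i.+1) ->
  (forall j : 'I_n, (m < j)%N -> process_sigma (N j.+1) (A j)) ->
  let A' (j : 'I_n) := if (nat_of_ord j == m) then grid_event (fun s => N m.+1 s) t r else A j in
  [/\ forall j : 'I_n, (m <= j)%N -> process_sigma (N j.+1) (A' j),
      later A' m = grid_event (fun s => N m.+1 s) t r `&` later A m.+1 &
      P (later A' m) = ((\prod_(i < M) poisson_weight (lambda * (t i.+1 - t i)) (r i)) *
                        fine (P (later A m.+1)))%:E].
Proof.
move=> mn t0 tm hA A'.
have tge0 i : (i <= M)%N -> 0 <= t i.
  elim: i => [|i IH iM]; first by rewrite t0.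
  by rewrite (le_trans (IH (ltnW iM)))// tm.
have hA' (j : 'I_n) : (m <= j)%N -> process_sigma (N j.+1) (A' j).
  rewrite leq_eqVlt /A' eq_sym; case: eqP => [jm _|_ /= mj]; last exact: hA.
  by rewrite jm; apply: process_sigma_grid => i iM; exact: tge0.
split => //.
- apply/seteqP; split => w /=.
    move=> H; split.
      by have := H (Ordinal mn); rewrite /A' /= eqxx inE; exact.
    move=> j /=; rewrite inE => mj; have := H j; rewrite /A' gtn_eqF//=.
    by rewrite inE (ltnW mj); exact.
  move=> [H1 H2] j /=; rewrite inE leq_eqVlt /A' eq_sym; case: eqP => [//|_ /= mj].
  by apply: H2; rewrite /= inE.
- rewrite !later_prob//= (bigD1 (Ordinal mn))//= /A' eqxx.
  rewrite (poisson_grid_prob (hN _) lambda0 r t0 tm)//=; congr ((_ * _)%:E).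
  rewrite [LHS](_ : _ = \prod_(j < n | (m < j)%N) fine (P (A' j))).
    by apply: eq_bigr => j mj; rewrite /A' gtn_eqF.
  by apply: eq_bigl => j; rewrite ltn_neqAle eq_sym andbC.
Qed.

(** By induction on the number m of layers.  Given the values of the inner
    process on the grid, the outer Poisson process is observed at the
    corresponding partial sums, which are deterministic times; summing over
    these values composes the two laws.  An event about the processes further
    out is carried along, because independence has to be used at every stage. *)
Lemma grid_law m (t : nat -> R) M (r : {ffun 'I_M -> nat}) (A : 'I_n -> set T) :
  (m < n)%N -> t 0%N = 0 -> (forall i, (i < M)%N -> t i <= t i.+1) ->
  (forall j : 'I_n, (m < j)%N -> process_sigma (N j.+1) (A j)) ->
  P (grid_event (mipp_nat m.+1) t r `&` later A m.+1) =
  ((\prod_(i < M) mipp_pmf m.+1 (t i.+1 - t i) (r i)) * fine (P (later A m.+1)))%:E.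
Proof.
move=> + t0 tm; elim: m r A => [|m IH] r A mn hA.
  by have [_ <- ->] := first_layer r mn t0 tm hA.
pose A' (k : {ffun 'I_M -> nat}) (j : 'I_n) := if (nat_of_ord j == m.+1)
  then grid_event (fun s => N m.+2 s) (fun i => (partial_sum k i)%:R) r else A j.
have k0 (k : {ffun 'I_M -> nat}) : (partial_sum k 0)%:R = 0 :> R by rewrite partial_sum0.
have km (k : {ffun 'I_M -> nat}) i : (i < M)%N -> (partial_sum k i)%:R <= (partial_sum k i.+1)%:R :> R.
  by move=> _; rewrite ler_nat partial_sum_homo.
have FL k := first_layer r mn (k0 k) (km k) hA.
have E : grid_event (mipp_nat m.+2) t r `&` later A m.+2 =
    \bigcup_(k : {ffun 'I_M -> nat}) (grid_event (mipp_nat m.+1) t k `&` later (A' k) m.+1).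
  apply/seteqP; split => w.
    move=> [Hr HA].
    have [k Hk] := @grid_event_cover m.+1 t M w (ltnW mn) t0 tm.
    exists k => //; split => //; have [_ -> _] := FL k; split => // i.
    by rewrite -(Hr i) /mipp_nat /= -(Hk i).
  move=> [k _ [Hk]]; have [_ -> _] := FL k => -[HB HA]; split => // i.
  by rewrite -(HB i) /mipp_nat /= -(Hk i).
rewrite (measure_countable_partition P (F := fun k : {ffun 'I_M -> nat} =>
   grid_event (mipp_nat m.+1) t k `&` later (A' k) m.+1) _ _ E).
- set c := fine (P (later A m.+2)).
  transitivity (\esum_(k in [set: {ffun 'I_M -> nat}])
     (c%:E * (\prod_(i < M) (mipp_pmf m.+1 (t i.+1 - t i) (k i) *
                 poisson_weight (lambda * (k i)%:R) (r i)))%:E))%E.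
    apply: eq_esum => k _; have [hA' _ PA'] := FL k.
    apply: eq_trans (IH k (A' k) (ltnW mn) hA') _.
    rewrite [X in fine X]PA' /= -EFinM -/c; congr (_%:E).
    rewrite big_split/= mulrA mulrC; congr (_ * (_ * _)).
    apply: eq_bigr => i _; congr poisson_weight.
    by rewrite partial_sumS natrD addrAC subrr add0r.
  have nu0 h j : 0 <= mipp_pmf m.+1 h j by case: (mipp_pmfP m.+1 h).
  rewrite esumZl ?fine_ge0//; last first.
    move=> k; rewrite lee_fin; apply: prodr_ge0 => i _.
    by rewrite mulr_ge0 ?poisson_weight_ge0.
  rewrite (@esum_prod _ M (fun i j => mipp_pmf m.+1 (t i.+1 - t i) j * poisson_weight (lambda * j%:R) (r i))
    (fun i => mipp_pmf m.+2 (t i.+1 - t i) (r i))).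
  + by rewrite -EFinM mulrC.
  + by move=> i j; rewrite mulr_ge0 ?poisson_weight_ge0.
  + by move=> i; rewrite (poisson_stepE _ _ (mipp_pmfP _ _)).
- move=> k; apply: measurableI; first exact: grid_event_measurable.
  by have [hA' _ _] := FL k; exact: later_measurable.
- move=> k k' _ _ [w [[Hk _] [Hk' _]]].
  by apply: (grid_event_trivIset (Y := mipp_nat m.+1) (t := t)) => //; exists w.
Qed.

Lemma grid_prob m (t : nat -> R) M (r : {ffun 'I_M -> nat}) :
  (0 < m <= n)%N -> t 0%N = 0 -> (forall i, (i < M)%N -> t i <= t i.+1) ->
  P (grid_event (mipp_nat m) t r) = (\prod_(i < M) mipp_pmf m (t i.+1 - t i) (r i))%:E.
Proof.
case: m => // m /= mn t0 tm.
have hA (j : 'I_n) : (m < j)%N -> process_sigma (N j.+1) ((fun=> setT) j).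
  by move=> _; rewrite -setC0; apply: sigma_algebraC; exact: sigma_algebra0.
have lT : later (fun=> setT) m.+1 = setT by apply/seteqP; split => w.
have := grid_law r mn t0 tm hA.
by rewrite lT setIT probability_setT /= mulr1.
Qed.

End iterated_poisson.

(** * Riemann sums of decreasing functions *)

Section riemann_sums.
Context (R : realType).
Notation mu := (@lebesgue_measure R).
Local Open Scope ereal_scope.

(** The values are taken at the right ends of the intervals of length h, so
    that a nonincreasing function is bounded from below. *)
Definition riemann_sum (f : R -> R) (h : R) : \bar R := \sum_(j <oo) (h * f (j.+1%:R * h))%:E.

Definition cell (h : R) (j : nat) : set R := `[(j%:R * h)%R, (j.+1%:R * h)%R[%classic.

Lemma cell_cover (h : R) : (0 < h)%R -> `[0%R, +oo[%classic = \bigcup_j cell h j.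
Proof.
move=> h0; apply/seteqP; split => x /=; rewrite in_itv/= andbT.
  move=> x0; exists (Num.truncn (x / h)) => //.
  have xh : (0 <= x / h)%R by rewrite divr_ge0// ltW.
  have /andP[t1 t2] := truncn_itv xh.
  by rewrite /cell/= in_itv/= -ler_pdivlMr// t1 -ltr_pdivrMr.
move=> [j _]; rewrite /cell/= in_itv/= => /andP[+ _]; apply: le_trans.
by rewrite mulr_ge0// ltW.
Qed.

Lemma cell_trivIset (h : R) : (0 < h)%R -> trivIset setT (cell h).
Proof.
move=> h0 i j _ _ [x []]; rewrite /cell/= !in_itv/= => /andP[ix xi] /andP[jx xj].
have := le_lt_trans ix xj; have := le_lt_trans jx xi.
rewrite !ltr_pM2r// !ltr_nat !ltnS => ji ij.
by apply/eqP; rewrite eqn_leq ij ji.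
Qed.

(** On each interval a nonincreasing function lies between its values at the
    two ends, and shifting the right end to the left end costs the first term
    h * f 0. *)
Lemma riemann_sandwich (f : R -> R) (h : R) : (0 < h)%R ->
  (forall x y, (0 <= x)%R -> (x <= y)%R -> (f y <= f x)%R) -> (forall x, (0 <= f x)%R) ->
  riemann_sum f h <= \int[mu]_(x in `[0%R, +oo[) (f x)%:E <= (h * f 0)%:E + riemann_sum f h.
Proof.
move=> h0 fni f0; have h0' := ltW h0.
have mf : measurable_fun (`[0%R, +oo[%classic : set R) (fun x => (f x)%:E).
  apply/measurable_EFinP.
  have : measurable_fun (`[0%R, +oo[%classic : set R) (fun x => f (Num.max x 0%R)).
    apply: nonincreasing_measurable => // x y xy; apply: fni.
      by rewrite le_max lexx orbT.
    by rewrite ge_max !le_max xy lexx orbT.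
  by apply: eq_measurable_fun => x; rewrite inE/= in_itv/= andbT => x0; rewrite max_l.
have mc j : measurable (cell h j : set R) by exact: measurable_itv.
have mfc j : measurable_fun (cell h j) (fun x => (f x)%:E).
  apply: (measurable_funS _ _ mf) => //.
  by rewrite (cell_cover h0); exact: bigcup_sup.
have jh (j : nat) : (0 <= j%:R * h)%R by rewrite mulr_ge0.
have muc j : mu (cell h j) = h%:E.
  rewrite /cell lebesgue_measure_itv/= lte_fin ltr_pM2r// ltr_nat ltnSn.
  by rewrite -EFinD -natr1 mulrDl mul1r addrAC subrr add0r.
have cstE (c : R) j : \int[mu]_(x in cell h j) c%:E = (h * c)%:E.
  rewrite integral_cst; last exact: mc.
  transitivity (c%:E * h%:E); last by rewrite -EFinM mulrC.
  by congr mule; exact: muc.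
have lo j : (h * f (j.+1%:R * h))%:E <= \int[mu]_(x in cell h j) (f x)%:E.
  have -> : (h * f (j.+1%:R * h))%:E = \int[mu]_(x in cell h j) (f (j.+1%:R * h))%:E.
    by rewrite cstE.
  apply: ge0_le_integral.
  - exact: mc.
  - by move=> x _; rewrite lee_fin.
  - exact: measurable_cst.
  - exact: mfc.
  - move=> x; rewrite /cell/= in_itv/= => /andP[jx xj]; rewrite lee_fin fni//.
      by rewrite (le_trans (jh j)).
    exact: ltW.
have up j : \int[mu]_(x in cell h j) (f x)%:E <= (h * f (j%:R * h))%:E.
  have -> : (h * f (j%:R * h))%:E = \int[mu]_(x in cell h j) (f (j%:R * h))%:E.
    by rewrite cstE.
  apply: ge0_le_integral.
  - exact: mc.
  - by move=> x _; rewrite lee_fin.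
  - exact: mfc.
  - exact: measurable_cst.
  - by move=> x; rewrite /cell/= in_itv/= => /andP[jx xj]; rewrite lee_fin fni.
have IE : \int[mu]_(x in `[0%R, +oo[) (f x)%:E = \sum_(j <oo) \int[mu]_(x in cell h j) (f x)%:E.
  rewrite (cell_cover h0) ge0_integral_bigcup//.
  - by rewrite -(cell_cover h0).
  - by move=> x _; rewrite lee_fin.
  - exact: cell_trivIset.
rewrite IE; apply/andP; split.
  by apply: lee_nneseries => [j _ _|j _]; [rewrite lee_fin mulr_ge0|exact: lo].
have -> : (h * f 0)%:E + riemann_sum f h = \sum_(j <oo) (h * f (j%:R * h))%:E.
  rewrite [RHS]nneseries_recl//; last by move=> j _; rewrite lee_fin mulr_ge0.
  rewrite mul0r; congr (_ + _); rewrite -nneseries_addn.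
    by apply: eq_eseriesr => j _; rewrite addn1.
  by move=> j; rewrite lee_fin mulr_ge0.
by apply: lee_nneseries => [j _ _|j _]; [apply: integral_ge0 => x _; rewrite lee_fin|exact: up].
Qed.

End riemann_sums.

Section extended_exponential.
Context (R : realType).
Implicit Types (u : R) (x y : \bar R).

(** The value 0 at +oo is the limit of the exponential; it allows the
    functional to be handled before it is known to be finite. *)
Definition eexp u x : R := if x is r%:E then expR (- (u * r)) else 0.

Lemma eexp_ge0 u x : 0 <= eexp u x.
Proof. by case: x => [r| |] //=; exact: expR_ge0. Qed.

Lemma eexp_le1 u x : 0 <= u -> (0 <= x)%E -> eexp u x <= 1.
Proof.
case: x => [r| |] //= u0; rewrite lee_fin => r0.
by rewrite expR_le1 oppr_le0 mulr_ge0.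
Qed.

Lemma eexp_ge u x y : 0 <= u -> (x <= y)%E -> (0 <= x)%E -> eexp u y <= eexp u x.
Proof.
case: y => [s| |]; case: x => [r| |] //= u0; rewrite ?lee_fin ?expR_ge0//.
by move=> rs _; rewrite ler_expR lerN2 ler_wpM2l.
Qed.

Lemma eexpD u (r : R) x : eexp u (r%:E + x)%E = expR (- (u * r)) * eexp u x.
Proof. by case: x => [s| |] /=; rewrite ?mulr0// mulrDr opprD expRD. Qed.

Lemma cvg_eexp u (a : nat -> R) : 0 < u -> (forall j, 0 <= a j) ->
  expR (- (u * \sum_(j < M) a j)) @[M --> \oo] --> eexp u (\sum_(j <oo) (a j)%:E)%E.
Proof.
move=> u0 a0; set S := (\sum_(j <oo) _)%E.
have C : (\sum_(0 <= j < M) (a j)%:E)%E @[M --> \oo] --> S.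
  by apply: is_cvg_nneseries => j _ _; rewrite lee_fin.
have E M : (\sum_(0 <= j < M) (a j)%:E)%E = (\sum_(j < M) a j)%:E.
  by rewrite big_mkord sumEFin.
rewrite (eq_cvg _ _ E) in C.
have S0 : (0 <= S)%E by apply: nneseries_ge0 => j _ _; rewrite lee_fin.
case: S C S0 => [s| |]//= C _.
  have /fine_cvgP[_ C'] := C.
  have C1 : \sum_(j < M) a j @[M --> \oo] --> s by exact: C'.
  have C2 : expR (- (u * x)) @[x --> s] --> expR (- (u * s)) by exact: continuous_expRM.
  exact: (cvg_comp _ _ C1 C2).
have C1 : \sum_(j < M) a j @[M --> \oo] --> +oo%R by apply/cvgeryP.
exact: (cvg_comp _ _ C1 (cvgy_expRM u0)).
Qed.

End extended_exponential.

(** * Killed random walks *)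

Section pmf_mean.
Context (R : realType).
Implicit Types (nu f g : nat -> R) (M : R).

Definition pmf_mean nu f : R := fine (\esum_(k in [set: nat]) (nu k * f k)%:E)%E.

Lemma pmf_meanP nu f M : is_pmf nu -> (forall k, 0 <= f k <= M) ->
  (\esum_(k in [set: nat]) (nu k * f k)%:E = (pmf_mean nu f)%:E)%E /\ 0 <= pmf_mean nu f <= M.
Proof.
move=> [nu0 nu1] fM; have M0 : 0 <= M by case/andP: (fM 0%N); exact: le_trans.
set S := esum _ _; have SM : (S <= M%:E)%E.
  rewrite -[leRHS]mule1 -nu1 -esumZl//.
  apply: le_esum => k _; rewrite -EFinM lee_fin mulrC ler_wpM2r//.
  by case/andP: (fM k).
have S0 : (0 <= S)%E.
  by apply: esum_ge0 => k _; rewrite lee_fin mulr_ge0//; case/andP: (fM k).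
have SE : S = (pmf_mean nu f)%:E.
  by rewrite /pmf_mean fineK// ge0_fin_numE// (le_lt_trans SM)// ltry.
by move: SM S0; rewrite SE !lee_fin => -> ->.
Qed.

Lemma le_pmf_mean nu f g M : is_pmf nu -> (forall k, 0 <= f k <= M) -> (forall k, 0 <= g k <= M) ->
  (forall k, f k <= g k) -> pmf_mean nu f <= pmf_mean nu g.
Proof.
move=> nup fM gM fg; rewrite -lee_fin -(pmf_meanP nup fM).1 -(pmf_meanP nup gM).1.
by apply: le_esum => k _; rewrite lee_fin ler_wpM2l// nup.1.
Qed.

Lemma eq_pmf_mean nu f g : f =1 g -> pmf_mean nu f = pmf_mean nu g.
Proof. by move=> fg; congr fine; apply: eq_esum => k _; rewrite fg. Qed.

Lemma pmf_meanZ nu f c M : is_pmf nu -> (forall k, 0 <= f k <= M) -> 0 <= c ->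
  pmf_mean nu (fun k => c * f k) = c * pmf_mean nu f.
Proof.
move=> nup fM c0; apply: EFin_inj; rewrite EFinM -(pmf_meanP nup fM).1.
have cfM k : 0 <= c * f k <= c * M.
  by case/andP: (fM k) => ? ?; rewrite mulr_ge0//= ler_wpM2l.
rewrite -(pmf_meanP nup cfM).1 -esumZl//.
  by apply: eq_esum => k _; rewrite -EFinM mulrCA.
by move=> k; rewrite lee_fin mulr_ge0 ?nup.1//; case/andP: (fM k).
Qed.

Lemma pmf_meanD nu f g M : is_pmf nu -> (forall k, 0 <= f k <= M) -> (forall k, 0 <= g k <= M) ->
  pmf_mean nu (fun k => f k + g k) = pmf_mean nu f + pmf_mean nu g.
Proof.
move=> nup fM gM; apply: EFin_inj; rewrite EFinD -(pmf_meanP nup fM).1 -(pmf_meanP nup gM).1.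
have fgM k : 0 <= f k + g k <= M + M.
  by case/andP: (fM k) => ? ?; case/andP: (gM k) => ? ?; rewrite addr_ge0//= lerD.
rewrite -(pmf_meanP nup fgM).1 -esumD.
- by apply: eq_esum => k _; rewrite mulrDr.
- by move=> k _; rewrite lee_fin mulr_ge0 ?nup.1//; case/andP: (fM k).
- by move=> k _; rewrite lee_fin mulr_ge0 ?nup.1//; case/andP: (gM k).
Qed.

Lemma pmf_mean_cst nu : is_pmf nu -> pmf_mean nu (fun=> 1) = 1.
Proof. by move=> [nu0 nu1]; rewrite /pmf_mean; under eq_esum do rewrite mulr1; rewrite nu1. Qed.

Lemma pmf_mean_onem nu f : is_pmf nu -> (forall k, 0 <= f k <= 1) ->
  pmf_mean nu (fun k => 1 - f k) = 1 - pmf_mean nu f.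
Proof.
move=> nup f1; apply/eqP; rewrite eq_sym subr_eq -(pmf_meanD (M := 1) nup)//.
  rewrite -[X in X == _](pmf_mean_cst nup); apply/eqP/eq_pmf_mean => k.
  by rewrite subrK.
by move=> k; case/andP: (f1 k) => ? ?; rewrite subr_ge0 lerBlDr lerDl; apply/andP.
Qed.

(** These are the terms that matter to first order for increments over a short
    time. *)
Lemma pmf_mean_ge2 nu f M : is_pmf nu -> (forall k, 0 <= f k <= M) ->
  nu 0%N * f 0%N + nu 1%N * f 1%N <= pmf_mean nu f.
Proof.
move=> nup fM; rewrite -lee_fin -(pmf_meanP nup fM).1.
have nf k : (0 <= (nu k * f k)%:E)%E.
  by rewrite lee_fin mulr_ge0 ?nup.1//; case/andP: (fM k).
rewrite -nneseries_esumT//.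
apply: le_trans (@nneseries_lim_ge _ _ xpredT 0 2 _); last by move=> k _ _.
by rewrite !big_nat_recl//= big_nil adde0 -EFinD.
Qed.

Lemma pmf_mean_cvg nu (f_ : nat -> nat -> R) f : is_pmf nu -> (forall n k, 0 <= f_ n k <= 1) ->
  (forall k, f_ n k @[n --> \oo] --> f k) -> pmf_mean nu (f_ n) @[n --> \oo] --> pmf_mean nu f.
Proof.
move=> nup f1 cf.
have f01 k : 0 <= f k <= 1.
  have c := cf k; rewrite -(cvg_lim _ c)//; apply/andP; split.
    by apply: limr_ge; [apply/cvg_ex; exists (f k)|apply: nearW => n; case/andP: (f1 n k)].
  by apply: limr_le; [apply/cvg_ex; exists (f k)|apply: nearW => n; case/andP: (f1 n k)].
have E g : (forall k, 0 <= g k <= 1) ->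
    (\int[@counting nat R]_k (nu k * g k)%:E = (pmf_mean nu g)%:E)%E.
  move=> g1; rewrite -(pmf_meanP nup g1).1.
  have ng k : (0 <= (nu k * g k)%:E)%E.
    by rewrite lee_fin mulr_ge0 ?nup.1//; case/andP: (g1 k).
  by rewrite ge0_integral_count// nneseries_esumT.
have [] := @dominated_cvg_real _ nat R (@counting nat R) setT (fun n k => nu k * f_ n k)
  (fun k => nu k * f k) nu measurableT.
- by move=> n; [].
- by [].
- by move=> k _; apply: cvgMr; exact: cf.
- apply/integrableP; split => //.
  under eq_integral do rewrite gee0_abs ?lee_fin ?nup.1//.
  have -> : (\int[@counting nat R]_k (nu k)%:E = \int[@counting nat R]_k (nu k * 1)%:E)%E.
    by apply: eq_integral => k _; rewrite mulr1.
  by rewrite (E (fun=> 1)) ?ltry// => k; rewrite lexx ler01.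
- move=> k n _; case/andP: (f1 n k) => ? ?.
  by rewrite ger0_norm ?mulr_ge0 ?nup.1// ler_piMr ?nup.1.
move=> _; rewrite E//; under eq_fun do rewrite E//.
by move=> /fine_cvgP[].
Qed.

End pmf_mean.

Section walk.
Context (R : realType).

Lemma partial_sum_frcons M (r : {ffun 'I_M -> nat}) k i : (i <= M)%N ->
  partial_sum (frcons r k) i = partial_sum r i.
Proof.
move=> iM; rewrite /partial_sum big_mkcond [RHS]big_mkcond/= big_ord_recr/=.
rewrite ltnNge iM addn0; apply: eq_bigr => j _; by rewrite frcons_widen.
Qed.

Lemma partial_sum_frconsS M (r : {ffun 'I_M -> nat}) k :
  partial_sum (frcons r k) M.+1 = (partial_sum r M + k)%N.
Proof.
rewrite (partial_sumS (frcons r k) ord_max)/= frcons_max.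
by rewrite partial_sum_frcons.
Qed.

(** One step of a random walk with increments of law nu that survives at its
    new position s with probability c s. *)
Definition walk_step (c nu : nat -> R) (g : nat -> R) (s : nat) : R :=
  pmf_mean nu (fun k => c (s + k)%N * g (s + k)%N).

Lemma walk_step_bound c nu g s : is_pmf nu -> (forall s, 0 <= c s <= 1) -> (forall s, 0 <= g s <= 1) ->
  0 <= walk_step c nu g s <= 1.
Proof.
move=> nup c1 g1; apply: (pmf_meanP nup _).2 => k.
case/andP: (c1 (s + k)%N) => ? ?; case/andP: (g1 (s + k)%N) => ? ?.
by rewrite mulr_ge0// mulr_ile1.
Qed.

Lemma iter_walk_bound c nu g M s : is_pmf nu -> (forall s, 0 <= c s <= 1) -> (forall s, 0 <= g s <= 1) ->
  0 <= iter M (walk_step c nu) g s <= 1.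
Proof.
move=> nup c1 g1; elim: M s => [//|M IH] s /=.
exact: walk_step_bound.
Qed.

(** Summing over the last increment first turns the sum over trajectories of
    length M into M steps of the operator. *)
Lemma esum_walk c nu g M l : is_pmf nu -> (forall s, 0 <= c s <= 1) -> (forall s, 0 <= g s <= 1) ->
  (\esum_(r in [set: {ffun 'I_M -> nat}])
     (multi_pmf nu r * ((\prod_(i < M) c (l + partial_sum r i.+1)%N) * g (l + partial_sum r M)%N))%:E =
   (iter M (walk_step c nu) g l)%:E)%E.
Proof.
move=> nup c1 + ; elim: M g => [|M IH] g g1.
  rewrite esum_ffun0; last first.
    move=> z; rewrite /multi_pmf !big_ord0 !mul1r lee_fin.
    by case/andP: (g1 (l + partial_sum z 0)%N).
  by rewrite /multi_pmf !big_ord0 !mul1r partial_sum0 addn0.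
have ge0 (r : {ffun 'I_M.+1 -> nat}) : 0 <= multi_pmf nu r *
    ((\prod_(i < M.+1) c (l + partial_sum r i.+1)%N) * g (l + partial_sum r M.+1)%N).
  rewrite mulr_ge0//; first by apply: multi_pmf_ge0; exact: nup.1.
  rewrite mulr_ge0//; last by case/andP: (g1 (l + partial_sum r M.+1)%N).
  by apply: prodr_ge0 => i _; case/andP: (c1 (l + partial_sum r i.+1)%N).
rewrite esum_multi_pmfS//; last exact: nup.1.
rewrite iterSr -IH; last by move=> s; exact: walk_step_bound.
apply: eq_esum => r _; rewrite EFinM; congr (_ * _)%E.
have cgb k : 0 <= c (l + partial_sum r M + k)%N * g (l + partial_sum r M + k)%N <= 1.
  case/andP: (c1 (l + partial_sum r M + k)%N) => ? ?.
  case/andP: (g1 (l + partial_sum r M + k)%N) => ? ?.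
  by rewrite mulr_ge0// mulr_ile1.
rewrite EFinM -(pmf_meanP nup cgb).1 -esumZl.
- apply: eq_esum => k _; rewrite -EFinM; congr (_%:E).
  rewrite big_ord_recr/= partial_sum_frconsS addnA.
  have -> : \prod_(i < M) c (l + partial_sum (frcons r k) i.+1)%N =
            \prod_(i < M) c (l + partial_sum r i.+1)%N.
    by apply: eq_bigr => i _; rewrite partial_sum_frcons.
  by ring.
- by apply: prodr_ge0 => i _; case/andP: (c1 (l + partial_sum r i.+1)%N).
- by move=> k; rewrite lee_fin mulr_ge0 ?nup.1//; case/andP: (cgb k).
Qed.

End walk.

(** * Increments over a short time *)

Section small_time.
Context (R : realType) (lambda : R).
Hypothesis lambda0 : 0 < lambda.
Implicit Types (nu f : nat -> R).

Definition point_mass (j k : nat) : R := (k == j)%:R.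

Lemma point_mass_pmf j : is_pmf (point_mass j).
Proof.
split=> [k|]; first exact: ler0n.
have := @esum_pointmass R j (fun=> 1) (fun=> ler01).
by under eq_esum do rewrite mulr1.
Qed.

Lemma pmf_mean_point_mass j f : (forall k, 0 <= f k) -> pmf_mean (point_mass j) f = f j.
Proof. by move=> f0; rewrite /pmf_mean esum_pointmass. Qed.

Lemma pmf_mean_indic nu j : is_pmf nu -> pmf_mean nu (point_mass j) = nu j.
Proof.
move=> [nu0 _]; rewrite /pmf_mean /point_mass.
by under eq_esum do rewrite mulrC; rewrite esum_pointmass.
Qed.

(** The law of the increment of the m-fold iterated process when the innermost
    Poisson process jumps j times.  For j = 1 this is the law of the jumps. *)
Definition layers m j : nat -> R := iter m.-1 (poisson_step lambda) (point_mass j).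

Lemma layers_pmf m j : is_pmf (layers m j).
Proof.
rewrite /layers; elim: m.-1 => [|k IH] /=; first exact: point_mass_pmf.
exact: poisson_step_pmf.
Qed.

Lemma poisson_step_point_mass j : poisson_step lambda (point_mass j) =1 poisson_weight (lambda * j%:R).
Proof.
move=> k; rewrite /poisson_step /point_mass.
by rewrite (esum_pointmass j (f := fun j => poisson_weight (lambda * j%:R) k))// => i; exact: poisson_weight_ge0.
Qed.

Lemma eq_poisson_step nu nu' : nu =1 nu' -> poisson_step lambda nu =1 poisson_step lambda nu'.
Proof. by move=> E k; congr fine; apply: eq_esum => j _; rewrite E. Qed.

Lemma layers0 m : layers m 0 =1 point_mass 0.
Proof.
rewrite /layers; elim: m.-1 => [//|i IH] k /=.
rewrite (eq_poisson_step IH) poisson_step_point_mass.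
by rewrite /poisson_weight mulr0 ltxx.
Qed.

Lemma layers1 m : layers m.+2 1 =1 mipp_pmf lambda m.+1 1.
Proof.
rewrite /layers /mipp_pmf /= => k; rewrite -[poisson_step _ _]/(iter m.+1 (poisson_step lambda) (point_mass 1)) iterSr.
elim: m k => [|m IH] k /=; first by rewrite poisson_step_point_mass.
exact: eq_poisson_step.
Qed.

(** The number of jumps of the innermost process is Poisson of parameter
    lambda * h. *)
Lemma mipp_pmf_mixture m h k :
  ((mipp_pmf lambda m h k)%:E =
   \esum_(j in [set: nat]) (poisson_weight (lambda * h) j * layers m j k)%:E)%E.
Proof.
have w0 j : 0 <= poisson_weight (lambda * h) j := poisson_weight_ge0 _ _.
rewrite /mipp_pmf /layers; elim: m.-1 k => [|i IH] k /=.
  have := @esum_pointmass R k (poisson_weight (lambda * h)) w0.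
  by move=> <-; apply: eq_esum => j _; rewrite mulrC /point_mass eq_sym.
have pm l : is_pmf (iter i (poisson_step lambda) (point_mass l)) := layers_pmf i.+1 l.
have pm' : is_pmf (iter i (poisson_step lambda) (poisson_weight (lambda * h))) := mipp_pmfP lambda i.+1 h.
rewrite -poisson_stepE//.
transitivity (\esum_(j in [set: nat]) \esum_(l in [set: nat])
   (poisson_weight (lambda * h) l * (iter i (poisson_step lambda) (point_mass l) j * poisson_weight (lambda * j%:R) k))%:E)%E.
  apply: eq_esum => j _; rewrite EFinM IH muleC -esumZl ?poisson_weight_ge0//.
    by apply: eq_esum => l _; rewrite -EFinM mulrC mulrA.
  by move=> l; rewrite lee_fin mulr_ge0//; exact: (pm l).1.
rewrite esum_exchange; last first.
  by move=> j l; rewrite lee_fin !mulr_ge0 ?poisson_weight_ge0//; exact: (pm l).1.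
apply: eq_esum => l _; rewrite EFinM -poisson_stepE// -esumZl//.
by move=> j; rewrite lee_fin mulr_ge0 ?poisson_weight_ge0//; exact: (pm l).1.
Qed.

Lemma pmf_mean_mixture m h f : (forall k, 0 <= f k <= 1) ->
  pmf_mean (mipp_pmf lambda m h) f =
  pmf_mean (poisson_weight (lambda * h)) (fun j => pmf_mean (layers m j) f).
Proof.
move=> f1; have f0 k : 0 <= f k by case/andP: (f1 k).
rewrite [LHS]/pmf_mean [RHS]/pmf_mean; congr fine.
transitivity (\esum_(k in [set: nat]) \esum_(j in [set: nat])
  (poisson_weight (lambda * h) j * (layers m j k * f k))%:E)%E.
  apply: eq_esum => k _; rewrite EFinM mipp_pmf_mixture muleC -esumZl//.
    by apply: eq_esum => l _; rewrite -EFinM mulrC mulrA.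
  by move=> l; rewrite lee_fin mulr_ge0 ?poisson_weight_ge0//; exact: (layers_pmf m l).1.
rewrite esum_exchange; last first.
  by move=> j l; rewrite lee_fin !mulr_ge0 ?poisson_weight_ge0//; exact: (layers_pmf m l).1.
apply: eq_esum => l _; rewrite EFinM -(pmf_meanP (layers_pmf m l) f1).1 -esumZl ?poisson_weight_ge0//.
by move=> j; rewrite lee_fin mulr_ge0//; exact: (layers_pmf m l).1.
Qed.

(** Only zero or one jump of the innermost process is kept. *)
Lemma small_time_ge m h f : 0 < h -> (forall k, 0 <= f k <= 1) ->
  expR (- (lambda * h)) * f 0%N + lambda * h * expR (- (lambda * h)) * pmf_mean (layers m 1) f
  <= pmf_mean (mipp_pmf lambda m h) f.
Proof.
move=> h0 f1; have f0 k : 0 <= f k by case/andP: (f1 k).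
have lh : 0 < lambda * h by rewrite mulr_gt0.
have wp : is_pmf (poisson_weight (lambda * h)) := mipp_pmfP lambda 1 h.
rewrite pmf_mean_mixture//; apply: le_trans (pmf_mean_ge2 (M := 1) wp _); last first.
  by move=> j; exact: (pmf_meanP (layers_pmf m j) f1).2.
have -> : pmf_mean (layers m 0) f = f 0%N.
  rewrite -(pmf_mean_point_mass 0 f0); congr fine; apply: eq_esum => k _.
  by rewrite layers0.
rewrite /poisson_weight lh /poisson_pmf lh expr0 expr1 (_ : 1`! = 1%N)// fact0.
by rewrite invr1 !mulr1 mul1r.
Qed.

(** This is the lower bound for 1 - f; the remaining probabilities are of
    order (lambda * h) ^ 2. *)
Lemma small_time_le m h f : 0 < h -> (forall k, 0 <= f k <= 1) ->
  pmf_mean (mipp_pmf lambda m h) f <=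
  expR (- (lambda * h)) * f 0%N + lambda * h * pmf_mean (layers m 1) f + (lambda * h) ^+ 2.
Proof.
move=> h0 f1; set y := lambda * h.
have y0 : 0 < y by rewrite mulr_gt0.
have g1 k : 0 <= 1 - f k <= 1.
  by case/andP: (f1 k) => ? ?; rewrite subr_ge0 lerBlDr lerDl; apply/andP.
have := small_time_ge m h0 g1.
rewrite !pmf_mean_onem//; [|exact: mipp_pmfP|exact: layers_pmf].
rewrite -/y; set e := expR (- y); set A := pmf_mean (layers m 1) f.
set B := pmf_mean _ f; set F := f 0%N => H.
have A1 : 0 <= A <= 1 := (pmf_meanP (layers_pmf m 1) f1).2.
have e1 : 1 - y <= e by exact: expR_ge1Dx.
have e2 : e <= 1 by rewrite expR_le1 oppr_le0 ltW.
case/andP: A1 => A0 A1.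
have h1 : y * e * A <= y * A by rewrite ler_wpM2r// ler_piMr// ltW.
have h2 : (1 - y) * (1 + y) <= e * (1 + y) by rewrite ler_wpM2r// addr_ge0 ?ltW.
by nra.
Qed.

End small_time.

Section balance.
Context (R : realType).

Lemma cvg_expR_inv (c : R) : expR (c * n.+1%:R^-1) @[n --> \oo] --> (1 : R).
Proof.
have C1 : c * n.+1%:R^-1 @[n --> \oo] --> (0 : R).
  by rewrite -[X in _ --> X](mulr0 c); apply: cvgMr; exact: cvg_harmonic.
have C2 : expR x @[x --> (0 : R)] --> (1 : R).
  have E0 : expR 0 = 1 :> R by exact: expR0.
  rewrite -[X in _ --> X]E0; exact: continuous_expR.
exact: (cvg_comp _ _ C1 C2).
Qed.

(** Lets the mesh 1 / (n + 1) tend to 0 in an inequality with errors of the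
    order of the mesh. *)
Lemma limit_le (x y c : R) : (forall n, x <= y * expR (c * n.+1%:R^-1) + c * n.+1%:R^-1) -> x <= y.
Proof.
move=> H; have C : y * expR (c * n.+1%:R^-1) + c * n.+1%:R^-1 @[n --> \oo] --> y.
  rewrite -[X in _ --> X]addr0 -[X in _ --> X + _](mulr1 y) -[X in _ --> _ + X](mulr0 c).
  apply: cvgD; apply: cvgMr; [exact: cvg_expR_inv|exact: cvg_harmonic].
rewrite -(cvg_lim _ C)//; apply: limr_ge; first by apply/cvg_ex; exists y.
exact: nearW.
Qed.

End balance.

(** * Survival of the walk *)

Section walk_lower_bound.
Context (R : realType) (p : R).
Hypothesis p1 : 1 < p.

Lemma zeta_tail_nonincreasing l k : (0 < l)%N -> (l <= k)%N -> zeta_tail p k <= zeta_tail p l.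
Proof.
move=> l0; elim: k => [|k IH].
  by rewrite leqn0 => /eqP l00; rewrite l00 in l0.
rewrite leq_eqVlt => /orP[/eqP<-//|]; rewrite ltnS => lk.
apply: le_trans (IH lk); rewrite -subr_ge0.
by apply: le_trans (zeta_tail_step p1 (leq_trans l0 lk)); exact: powR_ge0.
Qed.

(** The contribution to exp (- u J) of an interval of length h spent at level
    s. *)
Definition killing (u h : R) (s : nat) : R := expR (- (u * (h * s%:R `^ (- p)))).

Lemma killing01 u h s : 0 <= u -> 0 <= h -> 0 <= killing u h s <= 1.
Proof. by move=> u0 h0; rewrite expR_ge0 expR_le1 oppr_le0 !mulr_ge0 ?powR_ge0. Qed.

(** The potential u / alpha * zeta_tail p dominates the killing.  At level l
    one step leaves l with probability at least alpha * h, which lowers the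
    potential by at least u / alpha * l ^ (- p) each time: on average this
    makes up for the killing cost u * h * l ^ (- p) of the step. *)
Lemma iter_walk_lower nu alpha u h M l : is_pmf nu -> 0 < alpha -> 0 < h -> 0 <= u ->
  alpha * h <= 1 - nu 0%N -> (0 < l)%N ->
  1 - u / alpha * zeta_tail p l <= iter M (walk_step (killing u h) nu) (fun=> 1) l.
Proof.
move=> nup al0 h0 u0 nuh; elim: M l => [|M IH] l l0 /=.
  by rewrite lerBlDr lerDl mulr_ge0 ?zeta_tail_ge0 ?divr_ge0 ?(ltW al0).
set g := iter M _ _; have c1 s := killing01 s u0 (ltW h0).
have g1 s : 0 <= g s <= 1 by apply: iter_walk_bound => // ?; rewrite ler01 lexx.
set D := u / alpha; have D0 : 0 <= D by rewrite divr_ge0// ltW.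
have uD : D * alpha = u by rewrite /D divfK// gt_eqF.
pose F k := killing u h (l + k)%N * g (l + k)%N.
have F1 k : 0 <= F k <= 1.
  case/andP: (c1 (l + k)%N) => ? ?; case/andP: (g1 (l + k)%N) => ? ?.
  by rewrite mulr_ge0// mulr_ile1.
have z0 k : 0 <= zeta_tail p k := zeta_tail_ge0 k p1.
have zs := zeta_tail_step p1 l0.
have Ls : 0 <= l%:R `^ (- p) :> R := powR_ge0 _ _.
set zl := zeta_tail p l in zs *; set zl1 := zeta_tail p l.+1 in zs *.
set y := l%:R `^ (- p) in zs Ls *.
have dz0 : 0 <= zl - zl1 by exact: le_trans zs.
pose A := u * h * y + D * zl1; pose B := D * (zl - zl1).
have A0 : 0 <= A by have h0' := ltW h0; exact: addr_ge0 (mulr_ge0 (mulr_ge0 u0 h0') Ls) (mulr_ge0 D0 (z0 _)).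
have B0 : 0 <= B by rewrite /B mulr_ge0.
rewrite -[leRHS]/(pmf_mean nu F).
have Fd k : 1 - F k <= A * 1 + B * point_mass R 0 k.
  have lk0 : (0 < l + k)%N by rewrite addn_gt0 l0.
  have cb : 1 - u * h * y <= killing u h (l + k)%N.
    apply: (le_trans _ (expR_ge1Dx _)); rewrite lerD2l lerN2 mulrA ler_wpM2l ?mulr_ge0 ?(ltW h0)//.
    by apply: powRN_le; rewrite ?ltr0n ?ler_nat ?leq_addr// ltW// (lt_trans ltr01).
  have gb : 1 - D * (zl1 + (zl - zl1) * point_mass R 0 k) <= g (l + k)%N.
    apply: le_trans (IH _ lk0); rewrite lerD2l lerN2 ler_wpM2l// /point_mass.
    case: k {F1 lk0 cb} => [|k]; first by rewrite addn0 mulr1 addrCA subrr addr0.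
    by rewrite mulr0 addr0 zeta_tail_nonincreasing// addnS ltnS leq_addr.
  case/andP: (c1 (l + k)%N) => ? ?; case/andP: (g1 (l + k)%N) => ? ?.
  rewrite /F /A /B; set c := killing _ _ _ in cb *; set gk := g _ in gb *.
  have : (1 - c) * (1 - gk) >= 0 by rewrite mulr_ge0// subr_ge0.
  by nra.
have pm1 k : 0 <= point_mass R 0 k <= 1 by rewrite /point_mass; case: eqP; rewrite ?lexx ?ler01.
have fin1 (k : nat) : 0 <= A * 1 <= A + B by rewrite mulr1 A0 lerDl.
have fin2 k : 0 <= B * point_mass R 0 k <= A + B.
  case/andP: (pm1 k) => ? ?; rewrite mulr_ge0//=; apply: (le_trans (y := B)); last by rewrite lerDr.
  by rewrite ler_piMr.
have : 1 - pmf_mean nu F <= A + B * nu 0%N.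
  rewrite -pmf_mean_onem//.
  apply: (le_trans (y := pmf_mean nu (fun k => A * 1 + B * point_mass R 0 k))).
    apply: (le_pmf_mean (M := 1 + (A + B + (A + B)))) => // k.
      case/andP: (F1 k) => ? ?; rewrite subr_ge0; apply/andP; split => //.
      by apply: (le_trans (y := 1)); [rewrite lerBlDr lerDl|rewrite lerDl; exact: addr_ge0 (addr_ge0 A0 B0) (addr_ge0 A0 B0)].
    case/andP: (fin1 k) => ? ?; case/andP: (fin2 k) => ? ?.
    rewrite addr_ge0//=; apply: (le_trans (lerD _ _)); [eassumption|eassumption|by rewrite lerDr].
  rewrite (pmf_meanD (M := A + B))// [X in _ + X](pmf_meanZ (M := 1))// (pmf_meanZ (M := 1))//.
    by rewrite pmf_mean_cst// pmf_mean_indic// mulr1.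
  by move=> _; rewrite ler01 lexx.
rewrite /A /B => H.
have H2 : D * ((zl - zl1) * (alpha * h)) <= D * ((zl - zl1) * (1 - nu 0%N)).
  by rewrite ler_wpM2l// ler_wpM2l.
have H3 : D * alpha * h * y <= D * alpha * h * (zl - zl1).
  by rewrite ler_wpM2l// uD mulr_ge0// ltW.
rewrite uD in H3.
have H4 : u * h * (zl - zl1) = D * ((zl - zl1) * (alpha * h)) by rewrite -uD; ring.
rewrite H4 in H3.
by move: H H2 H3; clear; lra.
Qed.

End walk_lower_bound.

Section jump_law.
Context (R : realType) (lambda : R).
Hypothesis lambda0 : 0 < lambda.

(** Each layer may contribute exactly one jump. *)
Lemma layers1_gt0 m : 0 < layers lambda m 1 1.
Proof.
rewrite /layers; elim: m.-1 => [|i IH] /=; first by rewrite /point_mass ltr01.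
have lp : is_pmf (iter i (poisson_step lambda) (point_mass R 1)) := layers_pmf lambda i.+1 1.
apply: (@lt_le_trans _ _ (iter i (poisson_step lambda) (point_mass R 1) 1 * poisson_weight (lambda * 1%:R) 1)).
  rewrite mulr_gt0// /poisson_weight mulr1 lambda0 /poisson_pmf lambda0.
  by rewrite !mulr_gt0 ?expR_gt0 ?exprn_gt0// invr_gt0 ltr0n fact_gt0.
rewrite -lee_fin -poisson_stepE//; apply: esum_ge.
exists [set 1%N]; last by rewrite fsbig_set1.
by split.
Qed.

Lemma layers10_lt1 m : layers lambda m 1 0 < 1.
Proof.
have lp := layers_pmf lambda m 1.
rewrite -subr_gt0 -(pmf_mean_indic 0 lp) -pmf_mean_onem//; last first.
  by move=> k; rewrite /point_mass; case: eqP; rewrite ?lexx ?ler01.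
apply: lt_le_trans (layers1_gt0 m) _.
have -> : layers lambda m 1 1 = layers lambda m 1 0 * (1 - point_mass R 0 0) + layers lambda m 1 1 * (1 - point_mass R 0 1).
  by rewrite /point_mass eqxx subrr mulr0 add0r subr0 mulr1.
apply: (pmf_mean_ge2 (f := fun k => 1 - point_mass R 0 k) (M := 1) lp) => k.
by rewrite /point_mass; case: eqP; rewrite ?subrr ?subr0 ?lexx ?ler01.
Qed.

(** To first order the process moves at rate lambda * (1 - q 0), where q is
    the law of the jumps; the factor exp (- lambda) makes the bound valid for
    all meshes h <= 1. *)
Lemma jump_prob_lower m h : 0 < h -> h <= 1 ->
  lambda * expR (- lambda) * (1 - layers lambda m 1 0) * h <= 1 - mipp_pmf lambda m h 0.
Proof.
move=> h0 h1; have f1 k : 0 <= 1 - point_mass R 0 k <= 1.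
  by rewrite /point_mass; case: eqP; rewrite ?subrr ?subr0 ?lexx ?ler01.
have pm k : 0 <= point_mass R 0 k <= 1.
  by rewrite /point_mass; case: eqP; rewrite ?lexx ?ler01.
have := small_time_ge lambda0 m h0 f1.
rewrite !pmf_mean_onem//; [|exact: mipp_pmfP|exact: layers_pmf].
rewrite !pmf_mean_indic; [|exact: mipp_pmfP|exact: layers_pmf].
rewrite /point_mass eqxx subrr mulr0 add0r; apply: le_trans.
have q0 : 0 <= 1 - layers lambda m 1 0 by rewrite subr_ge0 ltW// layers10_lt1.
have E : expR (- lambda) <= expR (- (lambda * h)).
  by rewrite ler_expR lerN2 ler_piMr// ltW.
have -> : lambda * expR (- lambda) * (1 - layers lambda m 1 0) * h =
    lambda * h * (1 - layers lambda m 1 0) * expR (- lambda) by ring.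
have -> : lambda * h * expR (- (lambda * h)) * (1 - layers lambda m 1 0) =
    lambda * h * (1 - layers lambda m 1 0) * expR (- (lambda * h)) by ring.
by rewrite ler_wpM2l// !mulr_ge0// ltW.
Qed.

End jump_law.

(** * Iterating the equation for the transforms *)

Section renewal_iteration.
Context (R : realType).
Variables (a p : R) (r : nat -> R).
Hypothesis a0 : 0 < a.
Hypothesis p1 : 1 < p.
Hypothesis r0 : forall k, 0 <= r k.
Hypothesis r00 : r 0%N = 0.
Hypothesis r1 : (\esum_(k in [set: nat]) (r k)%:E = 1)%E.
Variables (u D : R) (phi : nat -> R).
Hypothesis u0 : 0 <= u.
Hypothesis phi01 : forall l, (0 < l)%N -> 0 <= phi l <= 1.
Hypothesis phi_eq : forall l, (0 < l)%N ->
  (a * l%:R `^ p + u) * phi l = a * l%:R `^ p * pmf_mean r (fun k => phi (l + k)%N).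
Hypothesis phi_lower : forall l, (0 < l)%N -> 1 - D * zeta_tail p l <= phi l.
Hypothesis D0 : 0 <= D.

Definition rate_factor K (z : {ffun 'I_K -> nat}) : R := \prod_(b <- rates a p z) (b / (b + u)).

Lemma rate_factor01 K (z : {ffun 'I_K -> nat}) : 0 <= rate_factor z <= 1.
Proof.
have p0 : 0 < p by rewrite (lt_trans ltr01).
have := rates_gt a0 p0 z a0; rewrite /rate_factor.
elim: (rates a p z) => [|b s IH] /=; first by rewrite big_nil ler01 lexx.
case/andP => b0 /IH /andP[s0 s1]; rewrite big_cons.
have bu : 0 < b + u by rewrite ltr_wpDr.
have f0 : 0 <= b / (b + u) by rewrite divr_ge0 ?ltW.
have f1 : b / (b + u) <= 1 by rewrite ler_pdivrMr// mul1r lerDl.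
by rewrite mulr_ge0//= mulr_ile1.
Qed.

Lemma rate_factor_frcons K (z : {ffun 'I_K -> nat}) k : rate_factor (frcons z k) =
  rate_factor z * (a * (end_level z)%:R `^ p / (a * (end_level z)%:R `^ p + u)).
Proof. by rewrite /rate_factor rates_frcons big_rcons. Qed.

Lemma total_gt0 K (z : {ffun 'I_K -> nat}) : (0 < end_level z)%N.
Proof. by rewrite /end_level addn1. Qed.

(** By induction on K: the equation at the level reached after K jumps splits
    off the factor of that level and averages over the next jump. *)
Lemma renewal_iterate K :
  (\esum_(z in [set: {ffun 'I_K -> nat}]) (multi_pmf r z * (rate_factor z * phi (end_level z)))%:E
   = (phi 1%N)%:E)%E.
Proof.
have ge0 m (z : {ffun 'I_m -> nat}) : 0 <= multi_pmf r z * (rate_factor z * phi (end_level z)).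
  rewrite mulr_ge0 ?multi_pmf_ge0//; case/andP: (rate_factor01 z) => ? _.
  by rewrite mulr_ge0//; case/andP: (phi01 (total_gt0 z)).
elim: K => [|K IH].
  rewrite esum_ffun0; last by move=> z; rewrite lee_fin.
  have -> : rate_factor ([ffun=> 0%N] : {ffun 'I_0 -> nat}) = 1 :> R.
    rewrite /rate_factor (_ : rates _ _ _ = [::]) ?big_nil//.
    by apply: size0nil; rewrite size_map size_enum_ord.
  by rewrite /multi_pmf /end_level !big_ord0 !mul1r.
rewrite esum_multi_pmfS// -IH; apply: eq_esum => z _; rewrite EFinM; congr mule.
set l := end_level z; have l0 : (0 < l)%N := total_gt0 z.
have b0 : 0 < a * l%:R `^ p by rewrite mulr_gt0// powR_gt0// ltr0n.
set b := a * l%:R `^ p in b0 *; have bu : 0 < b + u by rewrite ltr_wpDr.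
have phl k : 0 <= phi (l + k)%N <= 1 by apply: phi01; rewrite addn_gt0 l0.
have -> : phi l = b / (b + u) * pmf_mean r (fun k => phi (l + k)%N).
  apply: (mulfI (lt0r_neq0 bu)); rewrite phi_eq// -/b.
  by rewrite mulrA mulrCA divff ?mulr1// gt_eqF.
rewrite mulrA EFinM -(pmf_meanP (conj r0 r1) phl).1 -esumZl.
- by apply: eq_esum => k _; rewrite rate_factor_frcons total_frcons -EFinM -/l -/b; congr EFin; ring.
- case/andP: (rate_factor01 z) => ? _; rewrite mulr_ge0// divr_ge0// ltW//.
- by move=> k; rewrite lee_fin mulr_ge0//; case/andP: (phl k).
Qed.

(** After K jumps the level exceeds K, where phi differs from 1 by at most [D
    * zeta_tail p K.+1]. *)
Lemma mean_rate_factor_cvg : mean r (@rate_factor K) @[K --> \oo] --> phi 1%N.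
Proof.
have B K : phi 1%N <= mean r (@rate_factor K) <= phi 1%N + D * zeta_tail p K.+1.
  have q1 (z : {ffun 'I_K -> nat}) : positive_multiindices K z -> 0 <= rate_factor z <= 1.
    by move=> _; exact: rate_factor01.
  have [E _] := meanP r0 r00 r1 q1.
  apply/andP; split.
    rewrite -lee_fin -E -(renewal_iterate K); apply: le_esum_mean => // z _.
    case/andP: (rate_factor01 z) => ? _; rewrite ler_piMr//.
    by case/andP: (phi01 (total_gt0 z)).
  have c0 : 0 <= D * zeta_tail p K.+1 by rewrite mulr_ge0 ?zeta_tail_ge0.
  have h1 (z : {ffun 'I_K -> nat}) : positive_multiindices K z -> 0 <= rate_factor z * phi (end_level z) <= 1.
    move=> _; case/andP: (rate_factor01 z) => ? ?; case/andP: (phi01 (total_gt0 z)) => ? ?.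
    by rewrite mulr_ge0//= mulr_ile1.
  have h2 (z : {ffun 'I_K -> nat}) : positive_multiindices K z -> 0 <= D * zeta_tail p K.+1 <= D * zeta_tail p K.+1.
    by move=> _; rewrite c0 lexx.
  have E1 : mean r (fun z : {ffun 'I_K -> nat} => rate_factor z * phi (end_level z)) = phi 1%N.
    by rewrite /mean renewal_iterate.
  pose c := D * zeta_tail p K.+1; rewrite -/c in c0 h2 *.
  pose G (z : {ffun 'I_K -> nat}) := rate_factor z * phi (end_level z) + c.
  have hG (z : {ffun 'I_K -> nat}) : positive_multiindices K z -> 0 <= G z <= 1 + c.
    by move=> /h1 /andP[? ?]; rewrite addr_ge0//= lerD2r.
  have [EG _] := meanP r0 r00 r1 hG.
  have GE : mean r G = phi 1%N + mean r (fun _ : {ffun 'I_K -> nat} => c).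
    rewrite -E1; apply: (meanD (M := 1 + c) r0 r00 r1) => z zp.
      by case/andP: (h1 z zp) => ? ?; rewrite ler_wpDr//; apply/andP.
    by rewrite c0 lerDr ler01.
  have [_ /andP[_ cb]] := meanP r0 r00 r1 h2.
  apply: (@le_trans _ _ (mean r G)); last by rewrite GE lerD2l.
  rewrite -lee_fin -E -EG; apply: le_esum_mean => // z zp; rewrite /G.
  have l0 := total_gt0 z.
  have zc : D * zeta_tail p (end_level z) <= c.
    by rewrite ler_wpM2l// zeta_tail_nonincreasing// total_gt.
  have := phi_lower l0; case/andP: (rate_factor01 z) => Q0 Q1.
  case/andP: (phi01 l0) => f0 f1.
  move: zc Q0 Q1 f0 f1; move: (rate_factor z) (phi _) (D * _) (c) => Q f t c' zc Q0 Q1 f0 f1 H.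
  have : Q * (1 - f) <= 1 * (1 - f) by rewrite ler_wpM2r// subr_ge0.
  by rewrite mulrBr mulr1 mul1r; lra.
apply: (@squeeze_cvgr _ _ _ _ (fun=> phi 1%N) (fun K : nat => phi 1%N + D * zeta_tail p K.+1)).
- by apply: nearW => K; exact: B.
- exact: cvg_cst.
- rewrite -[X in _ --> X]addr0 -[X in _ --> _ + X](mulr0 D).
  apply: cvgD; first exact: cvg_cst.
  apply: cvgMr; rewrite (cvg_shiftS (zeta_tail p)); exact: zeta_tail_cvg.
Qed.

End renewal_iteration.

Section conditioned.
Context (R : realType) (q : nat -> R).
Hypothesis qp : is_pmf q.
Hypothesis q0 : q 0%N < 1.

Definition cond_pmf (k : nat) : R := if k == 0%N then 0 else q k / (1 - q 0%N).

Lemma cond_pmf_ge0 k : 0 <= cond_pmf k.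
Proof.
by rewrite /cond_pmf; case: eqP => // _; rewrite divr_ge0 ?qp.1// subr_ge0 ltW.
Qed.

(** The term k = 0 is separated from the others, which carry the mass 1 - q 0. *)
Lemma esum_cond_pmf (f : nat -> R) : (forall k, 0 <= f k) ->
  (\esum_(k in [set: nat]) (q k * f k)%:E =
   (q 0%N * f 0%N)%:E + (1 - q 0%N)%:E * \esum_(k in [set: nat]) (cond_pmf k * f k)%:E)%E.
Proof.
move=> f0; have c0 := cond_pmf_ge0.
have P0 : 0 < 1 - q 0%N by rewrite subr_gt0.
rewrite -(esum_pointmass 0 (f := fun k => q k * f k)); last by move=> k; rewrite mulr_ge0 ?qp.1.
rewrite -esumZl ?(ltW P0)//; last by move=> k; rewrite lee_fin mulr_ge0.
rewrite -esumD; first last.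
- by move=> k _; rewrite -EFinM lee_fin !mulr_ge0// ltW.
- by move=> k _; rewrite lee_fin !mulr_ge0 ?qp.1.
apply: eq_esum => k _; rewrite -EFinM -EFinD; congr EFin.
rewrite /cond_pmf; case: eqP => [->|_]; first by rewrite mul1r mul0r mulr0 addr0.
by rewrite mul0r add0r mulrA mulrCA divff ?mulr1// gt_eqF.
Qed.

Lemma cond_pmfP : is_pmf cond_pmf.
Proof.
split; first exact: cond_pmf_ge0.
have P0 : 0 < 1 - q 0%N by rewrite subr_gt0.
have := esum_cond_pmf (fun=> ler01).
under eq_esum do rewrite mulr1; under [in RHS]eq_esum do rewrite mulr1.
rewrite qp.2 mulr1; set e := esum _ _.
have e0 : (0 <= e)%E by apply: esum_ge0 => k _; rewrite lee_fin cond_pmf_ge0.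
case: e e0 => [s| |]//=.
- move=> _ [] H; congr EFin; apply: (mulfI (lt0r_neq0 P0)).
  by rewrite mulr1; lra.
- by move=> _; rewrite gt0_muley ?lte_fin.
Qed.

Lemma pmf_mean_cond (f : nat -> R) M : (forall k, 0 <= f k <= M) ->
  pmf_mean q f = q 0%N * f 0%N + (1 - q 0%N) * pmf_mean cond_pmf f.
Proof.
move=> fM; apply: EFin_inj; rewrite EFinD [X in (_ + X)%E]EFinM -(pmf_meanP cond_pmfP fM).1 -(pmf_meanP qp fM).1.
by rewrite esum_cond_pmf// => k; case/andP: (fM k).
Qed.

End conditioned.

Section limit_laplace.
Context (R : realType) (a p : R) (r : nat -> R).
Hypotheses (a0 : 0 < a) (p1 : 1 < p).
Hypotheses (r0 : forall k, 0 <= r k) (r00 : r 0%N = 0)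
  (r1 : (\esum_(k in [set: nat]) (r k)%:E = 1)%E).
Notation mu := (@lebesgue_measure R).

(** The transforms of the averaged densities are the means of the products of
    b / (b + u), and converge to that of the limit. *)
Lemma limit_pdf_laplace u phi : 0 <= u ->
  mean r (@rate_factor R a p u K) @[K --> \oo] --> phi ->
  (\int[mu]_(x in `[0%R, +oo[) (expR (- (u * x)) * limit_pdf a p r x)%:E = phi%:E)%E.
Proof.
move=> u0 C; have cd : `|0 : R| + `|0 : R| <= 1 by rewrite normr0 addr0 ler01.
have o1 w x : osc 0 0 w x = 1 :> R by rewrite /osc !mul0r !addr0.
have ua : - a < u by rewrite (lt_le_trans _ u0)// oppr_lt0.
have [_ D] := osc_integral_cvg a0 p1 r0 r00 r1 0 cd ua.
transitivity (\int[mu]_(x in `[0%R, +oo[) (expR (- (u * x)) * osc 0 0 0 x * limit_pdf a p r x)%:E)%E.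
  by apply: eq_integral => x _; rewrite o1 mulr1.
apply: (cvg_unique _ D) => //.
have E K : (0 < K)%N -> (\int[mu]_(x in `[0%R, +oo[) (expR (- (u * x)) * osc 0 0 0 x * mean_pdf a p r K x)%:E =
    (mean r (@rate_factor R a p u K))%:E)%E.
  move=> K0; have uRe : - a < complex.Re (u%:C) by [].
  have := osc_integral_mean_pdf a0 p1 r0 r00 r1 K0 cd uRe; rewrite /= oppr0 => ->.
  have q1 (z : {ffun 'I_K -> nat}) : positive_multiindices K z -> 0 <= rate_factor a p u z <= 1.
    by move=> _; exact: rate_factor01.
  rewrite -(meanP r0 r00 r1 q1).1; apply: eq_esum => z _.
  by rewrite !mul0r !addr0.
have C' : (mean r (@rate_factor R a p u K))%:E @[K --> \oo] --> phi%:E.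
  by apply: cvg_EFin; [exact: nearW|exact: C].
apply: cvg_trans C'; apply: near_eq_cvg; near=> K; rewrite E//; near: K; exact: nbhs_infty_gt.
Unshelve. all: by end_near.
Qed.

End limit_laplace.

(** * The functional of the iterated process *)

Section functional.
Context d (T : measurableType d) (R : realType) (P : probability T R).
Variables (n : nat) (lambda p : R) (N : nat -> R -> {RV P >-> nat}).
Hypothesis hn : (0 < n)%N.
Hypothesis lambda0 : 0 < lambda.
Hypothesis hN : forall i, (1 <= i <= n)%N -> poisson_process lambda (N i).
Hypothesis hNindep : mutually_independent P (fun i : 'I_n => process_sigma (N i.+1)).
Hypothesis p1 : 1 < p.
Notation mu := (@lebesgue_measure R).

(** The functional started at height l instead of 1: it is the whole family
    over l that satisfies a closed equation. *)
Definition shifted_functional (l : nat) (w : T) : \bar R :=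
  (\int[mu]_(t in `[0%R, +oo[) ((mipp N n t w + l%:R) `^ (- p))%:E)%E.

Definition shifted_sum (l : nat) (h : R) (w : T) : \bar R :=
  riemann_sum (fun t => (mipp N n t w + l%:R) `^ (- p)) h.

Lemma shifted_sumE l h w : 0 < h -> shifted_sum l h w =
  (\sum_(j <oo) (h * (l + mipp_nat N n (j.+1%:R * h) w)%N%:R `^ (- p))%:E)%E.
Proof. by move=> h0; apply: eq_eseriesr => j _; rewrite mippE// -natrD addnC. Qed.

Lemma shifted_sandwich l h w : (0 < l)%N -> 0 < h ->
  (shifted_sum l h w <= shifted_functional l w <= h%:E + shifted_sum l h w)%E.
Proof.
move=> l0 h0; have p0 : 0 <= p by rewrite ltW// (lt_trans ltr01).
have fni x y : 0 <= x -> x <= y ->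
    (mipp N n y w + l%:R) `^ (- p) <= (mipp N n x w + l%:R) `^ (- p).
  move=> x0 xy; apply: powRN_le => //; last by rewrite lerD2r; exact: (mipp_homo hN).
  by apply: ltr_wpDl; [exact: mipp_ge0|rewrite ltr0n].
have /andP[lo hi] := riemann_sandwich h0 fni (fun x => powR_ge0 _ _).
rewrite lo; apply: le_trans hi _; rewrite leeD2r// lee_fin ler_piMr ?(ltW h0)//.
rewrite (mipp_start hN)// add0r.
by apply: (le_trans (powRN_le (x := 1) p0 ltr01 _)); rewrite ?ler1n// (congr1 (@^~ (- p)) (@powR1 R)).
Qed.

Lemma shifted_sum_ge0 l h w : 0 < h -> (0 <= shifted_sum l h w)%E.
Proof.
by move=> h0; apply: nneseries_ge0 => j _ _; rewrite lee_fin mulr_ge0 ?powR_ge0// ltW.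
Qed.

Lemma shifted_functional_ge0 l w : (0 <= shifted_functional l w)%E.
Proof. by apply: integral_ge0 => t _; rewrite lee_fin powR_ge0. Qed.

Lemma measurable_mipp_power l t : measurable_fun setT (fun w => (l + mipp_nat N n t w)%N%:R `^ (- p)).
Proof.
have := measurable_mipp_nat N t hn; move: (mipp_nat N n t) => Y mY.
exact: (@measurableT_comp _ _ _ _ _ _ (fun k : nat => (l + k)%N%:R `^ (- p))).
Qed.

Lemma measurable_shifted_sum l h : 0 < h -> measurable_fun setT (shifted_sum l h).
Proof.
move=> h0; rewrite (_ : shifted_sum l h = fun w =>
   (\sum_(j <oo) (h * (l + mipp_nat N n (j.+1%:R * h) w)%N%:R `^ (- p))%:E)%E); last first.
  by apply/funext => w; rewrite shifted_sumE.
apply: ge0_emeasurable_sum => [k x _ _|k _].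
  by rewrite lee_fin mulr_ge0 ?powR_ge0// ltW.
by apply/measurable_EFinP; apply: measurable_funM => //; exact: measurable_mipp_power.
Qed.

(** The integral is the supremum of its lower Riemann sums, which depend on
    countably many values of the process. *)
Lemma measurable_shifted_functional l : (0 < l)%N -> measurable_fun setT (shifted_functional l).
Proof.
move=> l0; have h0 k : 0 < k.+1%:R^-1 :> R by rewrite invr_gt0.
rewrite (_ : shifted_functional l = fun w => esups (fun k => shifted_sum l k.+1%:R^-1 w) 0).
  by apply: measurable_fun_esups => k; exact: measurable_shifted_sum.
apply/funext => w; apply/eqP; rewrite eq_le; apply/andP; split; last first.
  apply: ge_ereal_sup => _ [k _ <-].
  by case/andP: (shifted_sandwich w l0 (h0 k)).
apply/lee_addgt0Pr => e e0.
have [k _ ke] := near_infty_natSinv_lt (PosNum e0).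
have {}ke := ke k (leqnn k).
case/andP: (shifted_sandwich w l0 (h0 k)) => _ hi; apply: (le_trans hi).
rewrite addeC; apply: leeD; last by rewrite lee_fin ltW.
by apply: ereal_sup_ubound; exists k.
Qed.

Notation step_pmf h := (mipp_pmf lambda n h).

(** The events that fix the trajectory on the grid form a countable partition,
    with probabilities given by the product of the laws of the increments; the
    expectation is therefore a sum over trajectories of the killed walk. *)
Lemma grid_mean u h M l : 0 <= u -> 0 < h ->
  (\int[P]_w (\prod_(i < M) killing p u h (l + mipp_nat N n (i.+1%:R * h) w))%:E =
   (iter M (walk_step (killing p u h) (step_pmf h)) (fun=> 1) l)%:E)%E.
Proof.
move=> u0 h0; set c := killing p u h; have c1 s : 0 <= c s <= 1 := killing01 p s u0 (ltW h0).
pose t (i : nat) : R := i%:R * h.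
have t0 : t 0%N = 0 by rewrite /t mul0r.
have tm i : (i < M)%N -> t i <= t i.+1 by rewrite /t ler_pM2r// ler_nat.
have nn : (0 < n <= n)%N by rewrite hn leqnn.
have nup : is_pmf (step_pmf h) := mipp_pmfP lambda n h.
pose G (r : {ffun 'I_M -> nat}) : R := \prod_(i < M) c (l + partial_sum r i.+1)%N.
have G0 r : 0 <= G r by apply: prodr_ge0 => i _; case/andP: (c1 (l + partial_sum r i.+1)%N).
have mG (r : {ffun 'I_M -> nat}) : measurable (grid_event (mipp_nat N n) t r) by exact: grid_event_measurable.
have E w : (\prod_(i < M) c (l + mipp_nat N n (i.+1%:R * h) w)%N)%:E =
    (\esum_(r in [set: {ffun 'I_M -> nat}]) (\1_(grid_event (mipp_nat N n) t r) w * G r)%:E)%E.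
  have [r Hr] := grid_event_cover hN w nn t0 tm.
  rewrite (esum_indic_partition (@grid_event_trivIset _ _ _ (mipp_nat N n) t M) Hr G0).
  by congr (_%:E); apply: eq_bigr => i _; rewrite -(Hr i).
rewrite (eq_integral (fun w => (\esum_(r in [set: {ffun 'I_M -> nat}]) (\1_(grid_event (mipp_nat N n) t r) w * G r)%:E)%E)); last by move=> w _; exact: E.
rewrite integral_esum//; last first.
- by move=> r w; rewrite lee_fin mulr_ge0.
- by move=> r; apply/measurable_EFinP; apply: measurable_funM => //; exact: measurable_indic.
have b1 (s : nat) : 0 <= (1 : R) <= 1 by rewrite ler01 lexx.
rewrite -(esum_walk (g := fun=> 1) M l nup c1 b1).
apply: eq_esum => r _; rewrite mulr1.
transitivity (\int[P]_w ((G r)%:E * (\1_(grid_event (mipp_nat N n) t r) w)%:E))%E.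
  by apply: eq_integral => w _; rewrite -EFinM mulrC.
rewrite ge0_integralZl ?lee_fin//; last by apply/measurable_EFinP; exact: measurable_indic.
rewrite integral_indic// setIT mulrC EFinM; congr mule.
apply: (eq_trans (grid_prob lambda0 hN hNindep r nn t0 tm)).
by congr (_%:E); apply: eq_bigr => i _; rewrite /t -mulrBl -natrB// subSnn mul1r.
Qed.

Definition shifted_laplace (u : R) (l : nat) : R :=
  fine (\int[P]_w (eexp u (shifted_functional l w))%:E)%E.

Definition step_laplace (u h : R) (l : nat) : R :=
  fine (\int[P]_w (eexp u (shifted_sum l h w))%:E)%E.

Lemma prod_killingE u h M l w : \prod_(i < M) killing p u h (l + mipp_nat N n (i.+1%:R * h) w)%N =
  expR (- (u * \sum_(i < M) h * (l + mipp_nat N n (i.+1%:R * h) w)%N%:R `^ (- p))).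
Proof. by rewrite -expR_sum sumrN -mulr_sumr. Qed.

Lemma integrable_one : P.-integrable setT (fun w => (1%:E : \bar R)).
Proof. exact: finite_measure_integrable_cst. Qed.

Lemma unit_integral (f : T -> R) : measurable_fun setT f -> (forall w, 0 <= f w <= 1) ->
  (\int[P]_w (f w)%:E = (fine (\int[P]_w (f w)%:E))%:E)%E.
Proof.
move=> mf f1; rewrite fineK// ge0_fin_numE; last by apply: integral_ge0 => w _; rewrite lee_fin; case/andP: (f1 w).
apply: (@le_lt_trans _ _ (\int[P]_w (1%:E : \bar R))%E).
  apply: ge0_le_integral => //.
  - by move=> w _; rewrite lee_fin; case/andP: (f1 w).
  - exact/measurable_EFinP.
  - by move=> w _; rewrite lee_fin; case/andP: (f1 w).
rewrite integral_cst//= mul1e; apply: (@le_lt_trans _ _ 1%E); last exact: ltry.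
exact: probability_le1.
Qed.

Lemma step_laplaceP u h l : 0 < u -> 0 < h ->
  [/\ measurable_fun setT (fun w => eexp u (shifted_sum l h w)),
      (\int[P]_w (eexp u (shifted_sum l h w))%:E = (step_laplace u h l)%:E)%E &
      iter M (walk_step (killing p u h) (step_pmf h)) (fun=> 1) l @[M --> \oo] --> step_laplace u h l].
Proof.
move=> u0 h0; pose f M w := \prod_(i < M) killing p u h (l + mipp_nat N n (i.+1%:R * h) w)%N.
have cf w : setT w -> f M w @[M --> \oo] --> eexp u (shifted_sum l h w).
  move=> _; rewrite shifted_sumE//.
  under eq_fun do rewrite /f prod_killingE.
  by apply: (@cvg_eexp R u (fun j => h * (l + mipp_nat N n (j.+1%:R * h) w)%N%:R `^ (- p)) u0) => j; rewrite mulr_ge0 ?powR_ge0// ltW.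
have mf M : measurable_fun setT (f M).
  apply: measurable_prod => i _.
  have := measurable_mipp_nat N (i.+1%:R * h) hn; move: (mipp_nat N n _) => Y mY.
  exact: (@measurableT_comp _ _ _ _ _ _ (fun k : nat => killing p u h (l + k)%N)).
have mg : measurable_fun setT (fun w => eexp u (shifted_sum l h w)).
  exact: measurable_fun_cvg mf cf.
have g1 w : 0 <= eexp u (shifted_sum l h w) <= 1.
  by rewrite eexp_ge0 eexp_le1 ?shifted_sum_ge0// ltW.
split => //; first exact: unit_integral.
have f1 w M : setT w -> `|f M w| <= 1.
  by move=> _; rewrite /f prod_killingE ger0_norm ?expR_ge0// expR_le1 oppr_le0 mulr_ge0 ?(ltW u0)// sumr_ge0// => i _; rewrite mulr_ge0 ?powR_ge0// ltW.
have [_] := @dominated_cvg_real _ T R P setT f _ (fun=> 1) measurableT mf mg cf integrable_one f1.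
rewrite unit_integral// => /fine_cvgP[_ /=].
rewrite -[fine _]/(step_laplace u h l); apply: cvg_trans.
apply: near_eq_cvg; apply: nearW => M /=; by rewrite grid_mean// ltW.
Qed.

(** For n = 1 the jumps have size 1.  Otherwise this is the law at time 1 of
    the process with n - 1 layers, read on a grid of one step. *)
Lemma jump_law k : P [set w | mipp N n.-1 1 w = k%:R] = (layers lambda n 1 k)%:E.
Proof.
case: n hn hN hNindep => // -[_ _ _|m _ hN' hNindep'].
  rewrite /layers /point_mass /=; case: eqP => [->|k1].
    by rewrite (_ : [set _ | _] = setT) ?probability_setT//; apply/seteqP; split.
  rewrite (_ : [set _ | _] = set0) ?measure0//; apply/seteqP; split => w //=.
  by move=> /esym /eqP; rewrite pnatr_eq1 => /eqP.
pose t (i : nat) : R := i%:R; pose z : {ffun 'I_1 -> nat} := [ffun=> k].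
have t0 : t 0%N = 0 by [].
have tm i : (i < 1)%N -> t i <= t i.+1 by rewrite /t ler_nat.
have mn : (0 < m.+1 <= m.+2)%N by rewrite /= leqnSn.
have := grid_prob lambda0 hN' hNindep' z mn t0 tm.
rewrite big_ord1 ffunE subr0 -layers1 => <-; congr (P _).
have S1 : partial_sum z 1 = k by rewrite (partial_sumS z ord0) partial_sum0 ffunE.
apply/seteqP; split => w.
  move=> H i; rewrite (ord1 i) S1; apply/eqP; rewrite -(eqr_nat R).
  by rewrite -mippE//; apply/eqP.
by move=> /(_ ord0); rewrite S1 => <-; exact: (mippE N 1 w (ltn0Sn m)).
Qed.

Local Notation J := shifted_functional.
Local Notation S := shifted_sum.
Local Notation phi := shifted_laplace.
Local Notation phi_step := step_laplace.

Lemma eexp_sandwich u l h w : 0 < u -> (0 < l)%N -> 0 < h ->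
  eexp u (J l w) <= eexp u (S l h w) <= expR (u * h) * eexp u (J l w).
Proof.
move=> u0 l0 h0; have /andP[lo hi] := shifted_sandwich w l0 h0.
have S0 := shifted_sum_ge0 l w h0.
rewrite eexp_ge ?(ltW u0)//=.
have J0 := shifted_functional_ge0 l w.
have := eexp_ge (ltW u0) hi J0; rewrite eexpD expRN mulrC ler_pdivrMr ?expR_gt0//.
by rewrite mulrC.
Qed.

Lemma measurable_eexp_functional u l : 0 < u -> (0 < l)%N ->
  measurable_fun setT (fun w => eexp u (J l w)).
Proof.
move=> u0 l0; have h0 k : 0 < k.+1%:R^-1 :> R by rewrite invr_gt0.
apply: (@measurable_fun_cvg _ _ _ _ (fun k w => eexp u (S l k.+1%:R^-1 w))) => [k|w _].
  by have [] := step_laplaceP l u0 (h0 k).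
apply: (@squeeze_cvgr _ _ _ _ (fun=> eexp u (J l w)) (fun k : nat => expR (u * k.+1%:R^-1) * eexp u (J l w))).
- by apply: nearW => k; exact: eexp_sandwich.
- exact: cvg_cst.
- rewrite -[X in _ --> X](mul1r (eexp u (J l w))); apply: cvgMl; exact: cvg_expR_inv.
Qed.

Lemma shifted_laplaceP u l : 0 < u -> (0 < l)%N ->
  (\int[P]_w (eexp u (J l w))%:E = (phi u l)%:E)%E /\ 0 <= phi u l <= 1.
Proof.
move=> u0 l0; have b w : 0 <= eexp u (J l w) <= 1.
  by rewrite eexp_ge0 eexp_le1 ?shifted_functional_ge0// ltW.
have m := measurable_eexp_functional u0 l0.
have E := unit_integral m b; split => //.
rewrite -!lee_fin -E; apply/andP; split.
  by apply: integral_ge0 => w _; rewrite lee_fin eexp_ge0.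
apply: (@le_trans _ _ (\int[P]_w (1%:E : \bar R))%E).
  apply: ge0_le_integral => //.
  - by move=> w _; rewrite lee_fin eexp_ge0.
  - exact/measurable_EFinP.
  - by move=> w _; rewrite lee_fin; case/andP: (b w).
by rewrite integral_cst//= mul1e; exact: probability_le1.
Qed.

Lemma step_laplace_sandwich u h l : 0 < u -> 0 < h -> (0 < l)%N ->
  phi u l <= phi_step u h l <= expR (u * h) * phi u l.
Proof.
move=> u0 h0 l0; have [mS ES _] := step_laplaceP l u0 h0.
have [EJ _] := shifted_laplaceP u0 l0; have mJ := measurable_eexp_functional u0 l0.
rewrite -!lee_fin EFinM -ES -EJ -ge0_integralZl ?lee_fin ?expR_ge0//; last first.
- by move=> w _; rewrite lee_fin eexp_ge0.
- exact/measurable_EFinP.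
apply/andP; split; apply: ge0_le_integral => //.
- by move=> w _; rewrite lee_fin eexp_ge0.
- exact/measurable_EFinP.
- exact/measurable_EFinP.
- by move=> w _; rewrite lee_fin; case/andP: (eexp_sandwich w u0 l0 h0).
- by move=> w _; rewrite lee_fin eexp_ge0.
- exact/measurable_EFinP.
- by apply/measurable_EFinP; apply: measurable_funM.
- by move=> w _; rewrite -EFinM lee_fin; case/andP: (eexp_sandwich w u0 l0 h0).
Qed.

Let one01 (s : nat) : 0 <= (1 : R) <= 1. Proof. by rewrite ler01 lexx. Qed.

Lemma step_laplace01 u h l : 0 < u -> 0 < h -> 0 <= phi_step u h l <= 1.
Proof.
move=> u0 h0; have [_ _ C] := step_laplaceP l u0 h0.
have b M := iter_walk_bound M l (mipp_pmfP lambda n h) (fun s => killing01 p s (ltW u0) (ltW h0)) one01.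
rewrite -(cvg_lim _ C)//; apply/andP; split.
  by apply: limr_ge; [apply/cvg_ex; eexists; exact: C|apply: nearW => M; case/andP: (b M)].
by apply: limr_le; [apply/cvg_ex; eexists; exact: C|apply: nearW => M; case/andP: (b M)].
Qed.

(** A walk of M + 1 steps is one step followed by a walk of M steps; then M
    tends to infinity. *)
Lemma step_laplace_rec u h l : 0 < u -> 0 < h ->
  phi_step u h l = walk_step (killing p u h) (mipp_pmf lambda n h) (phi_step u h) l.
Proof.
move=> u0 h0; have C k := (step_laplaceP k u0 h0).
have [_ _ Cl] := C l.
have np := mipp_pmfP lambda n h.
have c1 s := killing01 p s (ltW u0) (ltW h0).
have C2 : iter M.+1 (walk_step (killing p u h) (mipp_pmf lambda n h)) (fun=> 1) l @[M --> \oo]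
    --> walk_step (killing p u h) (mipp_pmf lambda n h) (phi_step u h) l.
  apply: pmf_mean_cvg => // [M k|k].
    have b := iter_walk_bound M (l + k)%N np c1 one01.
    case/andP: (c1 (l + k)%N) => ? ?; case/andP: b => ? ?.
    by rewrite mulr_ge0// mulr_ile1.
  by apply: cvgMr; have [] := C (l + k)%N.
rewrite (cvg_shiftS (fun M => iter M _ _ l)) in C2.
exact: (cvg_unique _ Cl C2).
Qed.

Let le_eq2 (x y z t : R) : x = y -> z = t -> x <= z -> y <= t.
Proof. by move=> -> ->. Qed.

Let q := layers lambda n 1.
Let alpha := lambda * expR (- lambda) * (1 - q 0).

Lemma alpha_gt0 : 0 < alpha.
Proof. by rewrite /alpha !mulr_gt0 ?expR_gt0// subr_gt0 /q layers10_lt1. Qed.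

Let hk k : 0 < k.+1%:R^-1 :> R. Proof. by rewrite invr_gt0. Qed.
Let hk1 k : k.+1%:R^-1 <= 1 :> R. Proof. by rewrite invf_le1// ler1n. Qed.

(** The bound for the walk does not depend on the mesh. *)
Lemma shifted_laplace_lower u l : 0 < u -> (0 < l)%N ->
  1 - u / alpha * zeta_tail p l <= phi u l.
Proof.
move=> u0 l0; apply: (@limit_le _ _ _ u) => k.
have [_ _ C] := step_laplaceP l u0 (hk k).
apply: (@le_trans _ _ (phi_step u k.+1%:R^-1 l)).
  rewrite -(cvg_lim _ C)//; apply: limr_ge; first by apply/cvg_ex; eexists; exact: C.
  apply: nearW => M; apply: iter_walk_lower => //.
  - exact: mipp_pmfP.
  - exact: alpha_gt0.
  - exact: ltW.
  - exact: jump_prob_lower.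
case/andP: (step_laplace_sandwich u0 (hk k) l0) => _; rewrite mulrC => /le_trans; apply.
by rewrite lerDl mulr_ge0// ltW.
Qed.

(** The transform phi_step for the mesh h satisfies an exact one-step
    equation, whose law is expanded to first order in h.  Both sides of the
    expansion are of order h, while phi and phi_step differ by a factor
    between 1 and exp (u * h): it is essential to replace phi_step by phi only
    after the terms of order 1 have cancelled. *)
Lemma laplace_equation u l : 0 < u -> (0 < l)%N ->
  (lambda + u * l%:R `^ (- p)) * phi u l = lambda * pmf_mean q (fun k => phi u (l + k)%N).
Proof.
move=> u0 l0; set b := lambda + _; set E := pmf_mean q _.
have y0 : 0 <= l%:R `^ (- p) :> R := powR_ge0 _ _.
have p0 : 0 <= p by rewrite ltW// (lt_trans ltr01).
have b0 : 0 < b by rewrite ltr_pwDl// mulr_ge0// ltW.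
have lk0 k : (0 < l + k)%N by rewrite addn_gt0 l0.
have f1 k : 0 <= phi u (l + k)%N <= 1 by exact: (shifted_laplaceP u0 (lk0 k)).2.
have qp : is_pmf q := layers_pmf lambda n 1.
have [_ E01] := pmf_meanP qp f1; rewrite -/E in E01.
have /andP[E0 E1] := E01.
have /andP[ph0 ph1] := (shifted_laplaceP u0 l0).2.
have c1 h s : 0 < h -> 0 <= killing p u h s <= 1 by move=> h0; exact: killing01 (ltW u0) (ltW h0).
pose F h k := killing p u h (l + k)%N * phi_step u h (l + k)%N.
have F0 h : F h 0%N = killing p u h l * phi_step u h l by rewrite /F addn0.
have F1 h k : 0 < h -> 0 <= F h k <= 1.
  move=> h0; case/andP: (c1 h (l + k)%N h0) => ? ?; case/andP: (step_laplace01 (l + k)%N u0 h0) => ? ?.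
  by rewrite mulr_ge0// mulr_ile1.
(* With no jump, the walk stays at l and survives with probability exp (- b h). *)
have up h (h0 : 0 < h) : phi_step u h l * (1 - expR (- (b * h))) <=
    lambda * h * (expR (u * h) * E) + (lambda * h) ^+ 2.
  have := small_time_le lambda0 n h0 (fun k => F1 h k h0).
  have -> : pmf_mean (mipp_pmf lambda n h) (F h) = phi_step u h l by rewrite step_laplace_rec.
  rewrite F0 => H.
  have E2 : pmf_mean q (F h) <= expR (u * h) * E.
    rewrite -(pmf_meanZ qp f1 (expR_ge0 _)).
    apply: (@le_pmf_mean _ _ _ _ (expR (u * h) * 1)) => // k.
    - case/andP: (F1 h k h0) => ? le1; rewrite mulr1; apply/andP; split => //.
      by apply: (le_trans le1); rewrite -[leLHS]expR0 ler_expR mulr_ge0// ltW.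
    - by case/andP: (f1 k) => ? ?; rewrite mulr_ge0 ?expR_ge0//= ler_wpM2l// expR_ge0.
    - case/andP: (step_laplace_sandwich u0 h0 (lk0 k)) => _; apply: le_trans.
      by case/andP: (c1 h (l + k)%N h0) => ? ?; rewrite ler_piMl//; case/andP: (step_laplace01 (l + k)%N u0 h0).
  have bE : expR (- (b * h)) = expR (- (lambda * h)) * killing p u h l.
    by rewrite /killing -expRD /b; congr expR; ring.
  have : lambda * h * pmf_mean q (F h) <= lambda * h * (expR (u * h) * E).
    by rewrite ler_wpM2l// mulr_ge0// ltW.
  by move: H; rewrite bE -/q; nra.
have lo h (h0 : 0 < h) : lambda * h * expR (- (lambda * h)) * (expR (- (u * h)) * E) <=
    phi_step u h l * (1 - expR (- (b * h))).
  have := small_time_ge lambda0 n h0 (fun k => F1 h k h0).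
  have -> : pmf_mean (mipp_pmf lambda n h) (F h) = phi_step u h l by rewrite step_laplace_rec.
  rewrite F0 => H.
  have E2 : expR (- (u * h)) * E <= pmf_mean q (F h).
    rewrite -(pmf_meanZ qp f1 (expR_ge0 _)).
    have e1 : expR (- (u * h)) <= 1 by rewrite expR_le1 oppr_le0 mulr_ge0// ltW.
    apply: (@le_pmf_mean _ _ _ _ 1) => // k.
    - by case/andP: (f1 k) => ? ?; rewrite mulr_ge0 ?expR_ge0//= mulr_ile1 ?expR_ge0.
    - exact: F1.
    - case/andP: (step_laplace_sandwich u0 h0 (lk0 k)) => H1 _; case/andP: (f1 k) => ? ?.
      apply: ler_pM => //; rewrite ?expR_ge0// ler_expR lerN2 ler_wpM2l ?(ltW u0)//.
      rewrite ler_piMr ?(ltW h0)//.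
      apply: (le_trans (powRN_le (x := 1) p0 ltr01 _)); first by rewrite ler1n.
      by rewrite (congr1 (@^~ (- p)) (@powR1 R)).
  have bE : expR (- (b * h)) = expR (- (lambda * h)) * killing p u h l.
    by rewrite /killing -expRD /b; congr expR; ring.
  have : lambda * h * expR (- (lambda * h)) * (expR (- (u * h)) * E) <= lambda * h * expR (- (lambda * h)) * pmf_mean q (F h).
    by rewrite ler_wpM2l// !mulr_ge0 ?expR_ge0// ltW.
  by move: H; rewrite bE -/q; nra.
apply/eqP; rewrite eq_le; apply/andP; split.
  apply: (@limit_le _ _ _ (u + b + lambda ^+ 2 * expR b)) => k.
  set h := k.+1%:R^-1; have h0 : 0 < h := hk k; have h1 : h <= 1 := hk1 k.
  set c := u + b + _.
  have H := up h h0; have /andP[G1 _] := step_laplace_sandwich u0 h0 l0.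
  set G := phi_step u h l in H G1.
  have eb : 1 + b * h <= expR (b * h) := expR_ge1Dx _.
  have eN : expR (- (b * h)) * expR (b * h) = 1 by rewrite -expRD addNr expR0.
  have H1 : phi u l * (b * h) <= (lambda * h * (expR (u * h) * E) + (lambda * h) ^+ 2) * expR (b * h).
    apply: le_trans (ler_wpM2r (expR_ge0 (b * h)) H).
    rewrite -mulrA mulrBl mul1r eN; apply: ler_pM => //; first by rewrite mulr_ge0// ltW.
    by rewrite lerBrDl.
  have H2 : b * phi u l <= lambda * E * expR ((u + b) * h) + lambda ^+ 2 * h * expR (b * h).
    have -> : expR ((u + b) * h) = expR (u * h) * expR (b * h) by rewrite mulrDl expRD.
    by rewrite -(ler_pM2r h0); apply: (le_eq2 _ _ H1); ring.
  apply: (le_trans H2); apply: lerD.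
    rewrite ler_wpM2l ?mulr_ge0 ?(ltW lambda0)// ler_expR ler_wpM2r ?(ltW h0)//.
    by rewrite /c lerDl mulr_ge0 ?expR_ge0// sqr_ge0.
  rewrite mulrAC ler_wpM2r ?(ltW h0)// /c.
  rewrite (le_trans (y := lambda ^+ 2 * expR b))//.
    by rewrite ler_wpM2l ?sqr_ge0// ler_expR ler_piMr// ltW.
  by rewrite lerDr addr_ge0// ltW.
apply: (@limit_le _ _ _ (lambda + 2 * u)) => k.
set h := k.+1%:R^-1; have h0 : 0 < h := hk k; have h1 : h <= 1 := hk1 k.
have H := lo h h0; have /andP[_ G1] := step_laplace_sandwich u0 h0 l0.
set G := phi_step u h l in H G1.
have H1 : lambda * h * expR (- (lambda * h)) * (expR (- (u * h)) * E) <= expR (u * h) * phi u l * (b * h).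
  apply: (le_trans H); apply: ler_pM => //.
  - by case/andP: (step_laplace01 l u0 h0).
  - by rewrite subr_ge0 expR_le1 oppr_le0 mulr_ge0// ltW.
  - by rewrite lerBlDr -lerBlDl -[X in _ <= X]/(expR _); have := expR_ge1Dx (- (b * h)); lra.
have eN : expR (- (lambda * h)) * expR (- (u * h)) * expR ((lambda + u) * h) = 1.
  by rewrite -!expRD -[RHS]expR0; congr expR; ring.
have eE : expR (u * h) * expR ((lambda + u) * h) = expR ((lambda + 2 * u) * h).
  by rewrite -expRD; congr expR; ring.
have H2 := ler_wpM2r (expR_ge0 ((lambda + u) * h)) H1.
have H3 : lambda * E <= b * phi u l * expR ((lambda + 2 * u) * h).
  rewrite -(ler_pM2r h0) -eE -[X in X <= _]mulr1 -eN.
  by apply: (le_eq2 _ _ H2); ring.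
apply: (le_trans H3); by rewrite lerDl mulr_ge0 ?(ltW h0)// addr_ge0 ?mulr_ge0// ltW.
Qed.

Let a := lambda * (1 - q 0%N).
Let r := cond_pmf q.

Let qp : is_pmf q. Proof. exact: layers_pmf. Qed.
Let q01 : q 0%N < 1. Proof. exact: layers10_lt1. Qed.
Let a0 : 0 < a. Proof. by rewrite mulr_gt0// subr_gt0. Qed.
Let r0 k : 0 <= r k. Proof. exact: cond_pmf_ge0. Qed.
Let r00 : r 0%N = 0. Proof. by []. Qed.
Let r1 : (\esum_(k in [set: nat]) (r k)%:E = 1)%E. Proof. exact: (cond_pmfP qp q01).2. Qed.

(** Jumps of size 0 leave the level unchanged, so they move to the left-hand
    side and change the rate from lambda to a. *)
Lemma conditioned_laplace_equation u l : 0 < u -> (0 < l)%N ->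
  (a * l%:R `^ p + u) * phi u l = a * l%:R `^ p * pmf_mean r (fun k => phi u (l + k)%N).
Proof.
move=> u0 l0.
have f1 k : 0 <= phi u (l + k)%N <= 1.
  by apply: (shifted_laplaceP u0 _).2; rewrite addn_gt0 l0.
have := laplace_equation u0 l0.
rewrite (pmf_mean_cond qp q01 f1) addn0 -/r powRN.
have L0 : 0 < l%:R `^ p :> R by rewrite powR_gt0// ltr0n.
move: (l%:R `^ p) (pmf_mean _ _) L0 => L E L0 H.
have H2 : (lambda - lambda * q 0%N) * L * phi u l + u * phi u l = (lambda - lambda * q 0%N) * L * E.
  have LV : L^-1 * L = 1 by rewrite mulVf// gt_eqF.
  have := congr1 ( *%R^~ L) H; rewrite !mulrDl.
  rewrite (_ : u * L^-1 * phi u l * L = u * phi u l * (L^-1 * L)); last by ring.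
  by rewrite LV mulr1 => H3; move: H3; rewrite /=; lra.
by rewrite /a mulrBr mulr1 mulrDl H2.
Qed.

Lemma functional_laplace_cvg u : 0 < u -> mean r (@rate_factor R a p u K) @[K --> \oo] --> phi u 1%N.
Proof.
move=> u0; apply: (mean_rate_factor_cvg (D := u / alpha) a0 p1 r0 r00 r1) => [|l l0|l l0|l l0|].
- exact: ltW.
- exact: (shifted_laplaceP u0 l0).2.
- exact: conditioned_laplace_equation.
- exact: (shifted_laplace_lower u0 l0).
- by rewrite divr_ge0 ?(ltW u0)// ltW// alpha_gt0.
Qed.

(** As u tends to 0, the lower bound for phi u 1 tends to 1, and phi u 1 is at
    most the probability that the functional is finite. *)
Lemma functional_finite : P [set w | J 1 w = +oo%E] = 0%E.
Proof.
have mJ := measurable_shifted_functional (ltn0Sn 0).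
set A := [set w | _]; have mA : measurable A.
  by have := mJ measurableT _ (emeasurable_set1 +oo%E); rewrite setTI.
apply/eqP; rewrite eq_le measure_ge0 andbT.
have PA u : 0 < u -> (P A <= (u * (alpha^-1 * zeta_tail p 1))%:E)%E.
  move=> u0; have [E _] := shifted_laplaceP u0 (ltn0Sn 0).
  have L := shifted_laplace_lower u0 (ltn0Sn 0).
  have mE := measurable_eexp_functional u0 (ltn0Sn 0).
  have H : ((phi u 1)%:E + P A <= 1)%E.
    have <- : (\int[P]_w (\1_A w)%:E = P A)%E by rewrite integral_indic// setIT.
    rewrite -E -ge0_integralD//; first last.
    - by apply/measurable_EFinP; exact: measurable_indic.
    - exact/measurable_EFinP.
    - by move=> w _; rewrite lee_fin eexp_ge0.
    apply: (@le_trans _ _ (\int[P]_w (1%:E : \bar R))%E); last first.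
      by rewrite integral_cst//= mul1e; exact: probability_le1.
    apply: ge0_le_integral => //.
    - by move=> w _; rewrite -EFinD lee_fin addr_ge0// eexp_ge0.
    - apply/measurable_EFinP; apply: measurable_funD => //; exact: measurable_indic.
    - move=> w _; rewrite -EFinD lee_fin indicE; case: (boolP (w \in A)) => wA.
        by move: wA; rewrite inE /A/= => ->; rewrite /= add0r.
      by rewrite addr0 eexp_le1 ?(ltW u0)// shifted_functional_ge0.
  have PAf : P A \is a fin_num by exact: fin_num_measure.
  rewrite -(fineK PAf) -EFinD !lee_fin in H *; rewrite -/alpha in L.
  by rewrite mulrA; move: (zeta_tail p 1) (u / alpha) L H => y z L H; lra.
have c0 : 0 <= alpha^-1 * zeta_tail p 1.
  by rewrite mulr_ge0 ?zeta_tail_ge0// invr_ge0 ltW// alpha_gt0.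
set c := alpha^-1 * zeta_tail p 1 in PA c0.
apply/lee_addgt0Pr => e e0; rewrite add0e.
(* The choice u = e / (c + 1) makes u * c at most e, also when c = 0. *)
have c1 : 0 < c + 1 by rewrite ltr_wpDl.
apply: (le_trans (PA (e / (c + 1)) _)); first by rewrite divr_gt0.
by rewrite lee_fin mulrAC ler_pdivrMr// ler_wpM2l ?(ltW e0)// lerDl.
Qed.

Lemma functional_ae_finite : {ae P, forall w, (J 1 w < +oo)%E}.
Proof.
have mJ := measurable_shifted_functional (ltn0Sn 0).
exists [set w | J 1 w = +oo%E]; split => //.
- by have := mJ measurableT _ (emeasurable_set1 +oo%E); rewrite setTI.
- exact: functional_finite.
- by move=> w /= /negP; rewrite -leNgt leye_eq => /eqP.
Qed.

Lemma measurable_fine_functional : measurable_fun setT (fun w => fine (J 1 w)).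
Proof. exact: measurableT_comp (measurable_shifted_functional (ltn0Sn 0)). Qed.

Lemma functional_laplace u : 0 < u ->
  (\int[P]_w (expR (- (u * fine (J 1 w))))%:E = (phi u 1)%:E)%E.
Proof.
move=> u0; have [<- _] := shifted_laplaceP u0 (ltn0Sn 0).
have mE := measurable_eexp_functional u0 (ltn0Sn 0).
apply: ae_eq_integral => //.
- apply/measurable_EFinP; apply: measurableT_comp => //; apply: measurableT_comp => //.
  by apply: measurable_funM => //; exact: measurable_fine_functional.
- exact/measurable_EFinP.
- apply: filterS functional_ae_finite => w + _.
  have := shifted_functional_ge0 1 w.
  by case: (J 1 w).
Qed.

(** The Laplace transforms agree for u > 0; at u = 0 the averages are
    constantly 1, so that no mass escapes to infinity in the limit. *)
Lemma functional_density : is_density P (fun w => fine (J 1 w)) (limit_pdf a p r).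
Proof.
apply: density_of_laplace.
- exact: measurable_fine_functional.
- by move=> w; apply: fine_ge0; exact: shifted_functional_ge0.
- exact: measurable_limit_pdf.
- exact: limit_pdf_ge0.
- by move=> x; exact: limit_pdf_lt0.
move=> u; rewrite le_eqVlt => /orP[/eqP <-|u0]; last first.
  rewrite functional_laplace//; apply/esym.
  by apply: limit_pdf_laplace; [|exact: p1| | | |exact: ltW|exact: functional_laplace_cvg].
rewrite (@limit_pdf_laplace R a p r a0 p1 r0 r00 r1 0 1)//; last first.
  apply: (mean_rate_factor_cvg (D := 0) (phi := fun=> 1) a0 p1 r0 r00 r1) => //.
  - by move=> l _; rewrite ler01 lexx.
  - by move=> l _; rewrite addr0 pmf_mean_cst.
  - by move=> l _; rewrite mul0r subr0.
under eq_integral do rewrite mul0r oppr0 expR0.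
by rewrite integral_cst//= mul1e probability_setT.
Qed.

End functional.

(** * The terms of the two series *)

Section sums_over_multiindices.
Context (R : realType) (r : nat -> R).
Hypotheses (r0 : forall k, 0 <= r k) (r00 : r 0%N = 0)
  (r1 : (\esum_(k in [set: nat]) (r k)%:E = 1)%E).
Variables (K : nat).
Local Notation pos := (positive_multiindices K).
Implicit Types (f B h G : {ffun 'I_K -> nat} -> R) (z : {ffun 'I_K -> nat}).

Lemma esum_positive c G M : 0 <= c -> (forall z, pos z -> 0 <= G z <= M) ->
  (\esum_(z in pos) (c * (multi_pmf r z * G z))%:E = (c * mean r G)%:E)%E.
Proof.
move=> c0 GM; rewrite EFinM -(meanP r0 r00 r1 GM).1 -esumZl//.
  rewrite esum_mkcond; apply: eq_esum => z _; case: ifPn => // /negP zp.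
  by rewrite multi_pmf_eq0// ?mul0r ?mule0// => /mem_set.
move=> z; rewrite lee_fin; apply: (multi_pmf_mul_ge0 r0 r00) => z' /GM.
by case/andP.
Qed.

Lemma eq_rsum f h : (forall z, pos z -> f z = h z) -> rsum pos f = rsum pos h.
Proof.
move=> fh; rewrite /rsum; congr (fine (_ - _)); apply: eq_esum => z zp.
  by rewrite !funeposE fh.
by rewrite !funenegE fh.
Qed.

(** The sum of a signed function h dominated by B is the difference of the
    sums of the nonnegative functions B + h and B. *)
Lemma rsum_multi_pmf c M f B h : 0 <= c -> (forall z, pos z -> 0 <= B z <= M) ->
  (forall z, pos z -> `|h z| <= B z) ->
  (forall z, pos z -> f z = c * (multi_pmf r z * h z)) ->
  rsummable pos f /\ rsum pos f = c * (mean r (fun z => B z + h z) - mean r B).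
Proof.
move=> c0 BM hB fE.
have W0 z : 0 <= multi_pmf r z by exact: multi_pmf_ge0.
have GM z : pos z -> 0 <= B z + h z <= M + M.
  move=> zp; case/andP: (BM z zp) => b0 bM.
  by have := hB z zp; rewrite ler_norml => /andP[h1 h2]; lra.
pose F z := (c * (multi_pmf r z * (B z + h z)))%:E.
pose G z := (c * (multi_pmf r z * B z))%:E.
have F0 z : pos z -> (0 <= F z)%E.
  by move=> zp; rewrite lee_fin !mulr_ge0//; case/andP: (GM z zp).
have G0 z : pos z -> (0 <= G z)%E.
  by move=> zp; rewrite lee_fin !mulr_ge0//; case/andP: (BM z zp).
have EF : (\esum_(z in pos) F z = (c * mean r (fun z => B z + h z))%:E)%E by exact: esum_positive GM.
have EG : (\esum_(z in pos) G z = (c * mean r B)%:E)%E by exact: esum_positive BM.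
have sF : summable pos F.
  by rewrite /summable; under eq_esum => z zp do rewrite gee0_abs ?F0//; rewrite EF ltry.
have sG : summable pos G.
  by rewrite /summable; under eq_esum => z zp do rewrite gee0_abs ?G0//; rewrite EG ltry.
have fFG z : pos z -> (f z)%:E = (F \- G)%E z.
  by move=> zp; rewrite fE// /F /G -EFinB; congr EFin; ring.
split.
  rewrite /rsummable /summable (eq_esum (b := fun z => `|(F \- G) z|%E)); last by move=> z zp; rewrite fFG.
  exact: summableB.
rewrite (@eq_rsum f (fun z => fine ((F \- G)%E z))); last by move=> z zp; rewrite -fFG.
have := esumB sF sG F0 G0; rewrite EF EG => E.
by rewrite /rsum -[RHS]/(fine (_)%:E) mulrBr EFinB -E; congr (fine (_ - _)).
Qed.

Lemma rsum_multi_pmf_ge0 c M f h : 0 <= c -> (forall z, pos z -> 0 <= h z <= M) ->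
  (forall z, pos z -> f z = c * (multi_pmf r z * h z)) ->
  rsummable pos f /\ rsum pos f = c * mean r h.
Proof.
move=> c0 hM fE; have hB z : pos z -> `|h z| <= h z.
  by move=> zp; rewrite ger0_norm//; case/andP: (hM z zp).
have [? ->] := rsum_multi_pmf c0 hM hB fE; split => //; congr (_ * _).
by rewrite (meanD r0 r00 r1 hM hM) addrK.
Qed.

End sums_over_multiindices.

Section modulus.
Context (R : realType).
Implicit Types (x u : R[i]).
Import Normc.

Lemma normr_Re_le x : `|complex.Re x| <= normc x.
Proof. by case: x => a b /=; rewrite -sqrtr_sqr ler_wsqrtr// lerDl sqr_ge0. Qed.

Lemma normr_Im_le x : `|complex.Im x| <= normc x.
Proof. by case: x => a b /=; rewrite -sqrtr_sqr ler_wsqrtr// lerDr sqr_ge0. Qed.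

Lemma normc_real (b : R) : normc b%:C = `|b|.
Proof. by rewrite /= expr0n /= addr0 sqrtr_sqr. Qed.

Lemma normc_resolvent_le (b : R) u : 0 <= b -> 0 < b + complex.Re u ->
  normc (b%:C / (b%:C + u)) <= b / (b + complex.Re u).
Proof.
move=> b0 bu; rewrite normcM normcV normc_real ger0_norm// ler_wpM2l//.
have le : b + complex.Re u <= normc (b%:C + u).
  apply: le_trans (normr_Re_le _); apply: le_trans (ler_norm _).
  by case: u {bu}.
by rewrite lef_pV2 ?posrE// (lt_le_trans bu).
Qed.

Lemma normc_ge0 x : 0 <= normc x.
Proof. by case: x => a b /=; exact: sqrtr_ge0. Qed.

Lemma normc_prod_resolvent_le (s : seq R) u :
  all (fun b => (0 <= b) && (0 < b + complex.Re u)) s ->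
  normc (\prod_(b <- s) (b%:C / (b%:C + u))) <= \prod_(b <- s) (b / (b + complex.Re u)).
Proof.
elim: s => [|b s IH] /=; first by rewrite !big_nil normc1.
case/andP => /andP[b0 bu] /IH {}IH; rewrite !big_cons normcM.
by apply: ler_pM; rewrite ?normc_ge0//; exact: normc_resolvent_le.
Qed.

End modulus.

Section series_terms.
Context (R : realType) (a p : R) (q : nat -> R).
Hypotheses (a0 : 0 < a) (p1 : 1 < p).
Hypotheses (qp : is_pmf q) (q1 : q 0%N < 1).
Let r := cond_pmf q.
Let p0 : 0 < p. Proof. exact: lt_trans p1. Qed.
Let P0 : 0 < 1 - q 0%N. Proof. by rewrite subr_gt0. Qed.
Variable K : nat.
Local Notation pos := (positive_multiindices K).

(** Conditioning each of the K jumps to be positive costs the factor 1 - q 0. *)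
Lemma multi_pmf_cond z : pos z -> multi_pmf q z = (1 - q 0%N) ^+ K * multi_pmf r z.
Proof.
move=> zp; rewrite /multi_pmf -[X in _ ^+ X]card_ord -prodr_const -big_split/=.
apply: eq_bigr => k _; rewrite /r /cond_pmf gtn_eqF ?zp//.
by rewrite mulrCA divff ?mulr1// gt_eqF.
Qed.

(** With b = a * level ^ p, the factor of each level is b / (b + u). *)
Lemma laplace_termE u z : pos z -> - a < complex.Re u ->
  laplace_term a p q u z = ((1 - q 0%N) ^+ K * multi_pmf r z)%:C *
     \prod_(b <- rates a p z) (b%:C / (b%:C + u)).
Proof.
move=> zp ua; rewrite -multi_pmf_cond// /laplace_term; congr (_ * _).
rewrite /rates big_map big_enum/=; apply: eq_bigr => k _.
rewrite -/(rate a p z k); set b := rate a p z k.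
have b0 : 0 < b by rewrite (lt_le_trans a0)// rate_ge.
have bC : b%:C != 0 by rewrite eq_complex /= eqxx andbT gt_eqF.
have bu : b%:C + u != 0.
  apply/negP => /eqP /(congr1 (@complex.Re R)) H.
  have : 0 < complex.Re (b%:C + u).
    case: u ua {H} => v w /= va; have := rate_ge a0 p0 z k; rewrite -/b; lra.
  by rewrite H ltxx.
have -> : 1 + u / b%:C = (b%:C + u) / b%:C by rewrite mulrDl divff.
by rewrite invf_div.
Qed.

(** With b = a * level ^ p and c the rate of another level, the factor 1 / (1
    - b / c) is c / (c - b), a factor of the weight of b in the decomposition
    into partial fractions. *)
Lemma density_termE x z : pos z ->
  density_term a p q x z = (1 - q 0%N) ^+ K / a * (multi_pmf r z * hypoexp_pdf (rates a p z) x).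
Proof.
move=> zp; rewrite /density_term -/(multi_pmf q z) multi_pmf_cond//.
rewrite -!mulrA; congr (_ * _); rewrite mulrCA; congr (_ * _).
rewrite /hypoexp_pdf {1}/rates big_map big_enum/= mulr_sumr; apply: eq_bigr => k1 _.
rewrite -/(rate a p z k1); set e := expR _; set w := pf_weight _ _.
have -> : a^-1 * (rate a p z k1 * e * w) = level R z k1 `^ p * e * w.
  by rewrite {1}/rate -!mulrA mulKf ?gt_eqF.
congr (_ * _); rewrite /w.
rewrite /pf_weight /rates big_map big_enum_cond/=.
apply: eq_big => [k2|k2 k12]; first by rewrite (inj_eq (rate_inj a0 p0 zp)).
have L0 k : 0 < level R z k by rewrite (lt_le_trans ltr01)// level_ge1.
have b0 k : 0 < rate a p z k by rewrite (lt_le_trans a0)// rate_ge.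
have nz : rate a p z k2 - rate a p z k1 != 0.
  by rewrite subr_eq0 (inj_eq (rate_inj a0 p0 zp)).
have -> : (level R z k1 / level R z k2) `^ p = rate a p z k1 / rate a p z k2.
  rewrite powRM ?invr_ge0 ?ltW// -powR_inv1 ?ltW// -powRrM mulN1r powRN /rate.
  by rewrite -mulf_div divff ?mul1r// gt_eqF.
have -> : 1 - rate a p z k1 / rate a p z k2 = (rate a p z k2 - rate a p z k1) / rate a p z k2.
  by rewrite mulrBl divff ?gt_eqF.
by rewrite invf_div.
Qed.

End series_terms.

(** * The limit of the complex Laplace transforms *)

Section complex_convergence.
Context (R : realType).

Lemma cvg_complex (x_ y_ : nat -> R) (x y : R) :
  x_ K @[K --> \oo] --> x -> y_ K @[K --> \oo] --> y ->
  (x_ K +i* y_ K : R[i]^o) @[K --> \oo] --> (x +i* y : R[i]^o).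
Proof.
move=> cx cy; apply/cvgrPdist_lt => e; rewrite ltcE /= => /andP[/eqP e2 e1].
have eE : e = (complex.Re e)%:C by case: e e2 {e1} => ? ? /= ->.
have h0 : 0 < complex.Re e / 2 by rewrite divr_gt0.
near=> K; rewrite eE normc_def ltcR /=.
have hx : `|x - x_ K| < complex.Re e / 2 by near: K; move/cvgrPdist_lt : cx; exact.
have hy : `|y - y_ K| < complex.Re e / 2 by near: K; move/cvgrPdist_lt : cy; exact.
apply: (@le_lt_trans _ _ (`|x - x_ K| + `|y - y_ K|)); last first.
  by rewrite [ltRHS]splitr ltrD.
rewrite -[leRHS]ger0_norm ?addr_ge0// -sqrtr_sqr ler_wsqrtr// [leRHS]sqrrD !real_normK ?num_real//.
by rewrite addrAC lerDl mulrn_wge0// mulr_ge0.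
Unshelve. all: by end_near.
Qed.

End complex_convergence.

Section laplace_limit.
Context (R : realType) (a p : R) (q : nat -> R).
Hypotheses (a0 : 0 < a) (p1 : 1 < p).
Hypotheses (qp : is_pmf q) (q1 : q 0%N < 1).
Let r := cond_pmf q.
Let p0 : 0 < p. Proof. exact: lt_trans p1. Qed.
Let P0 : 0 < 1 - q 0%N. Proof. by rewrite subr_gt0. Qed.
Let r0 k : 0 <= r k. Proof. exact: cond_pmf_ge0. Qed.
Let r00 : r 0%N = 0. Proof. by []. Qed.
Let r1 : (\esum_(k in [set: nat]) (r k)%:E = 1)%E. Proof. exact: (cond_pmfP qp q1).2. Qed.
Variable u : R[i].
Hypothesis ua : - a < complex.Re u.
Notation mu := (@lebesgue_measure R).
Local Notation v := (complex.Re u).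
Local Notation w := (- complex.Im u).

Definition transform K (z : {ffun 'I_K -> nat}) : R[i] := \prod_(b <- rates a p z) (b%:C / (b%:C + u)).
(** The transform at the real part of u, which dominates the modulus of the
    transform at u. *)
Definition majorant K (z : {ffun 'I_K -> nat}) : R := \prod_(b <- rates a p z) (b / (b + v)).
(** The averages of real nonnegative quantities from which the real and
    imaginary parts of the average transform are recovered. *)
Definition osc_mean K c d : R := mean r (fun z : {ffun 'I_K -> nat} =>
  majorant z + (c * complex.Re (transform z) + d * complex.Im (transform z))).

Let rates_ok K (z : {ffun 'I_K -> nat}) : all (fun b => (0 <= b) && (0 < b + v)) (rates a p z).
Proof.
apply/allP => _ /mapP[k _ ->]; have := rate_ge a0 p0 z k => h.
by rewrite (le_trans (ltW a0) h)/= -ltrBlDr sub0r (lt_le_trans _ h)// ltrNl.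
Qed.

Lemma majorant_ge0 K (z : {ffun 'I_K -> nat}) : 0 <= majorant z.
Proof. exact: le_trans (normc_ge0 _) (normc_prod_resolvent_le (rates_ok z)). Qed.

Lemma majorant_bounded : exists M, forall K (z : {ffun 'I_K -> nat}),
  positive_multiindices K z -> 0 <= majorant z <= M.
Proof.
(* This c is a tilt allowed by the rates, and b / (b + v) is at most b / (b - c). *)
pose c := Num.max (- v) 0; have c0 : 0 <= c by rewrite le_max lexx orbT.
have ca : c < a by rewrite gt_max a0 andbT ltrNl.
exists (expR (c / (a - c) * zeta_tail p 1)) => K z zp; rewrite majorant_ge0/=.
apply: le_trans (prod_rates_bound a0 p0 p1 c0 ca zp).
rewrite /majorant /rates big_map [leRHS]big_map big_enum [leRHS]big_enum/=; apply: ler_prod => k _.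
have h := rate_ge a0 p0 z k.
have b0 : 0 <= rate a p z k by rewrite (le_trans (ltW a0)).
have bc : 0 < rate a p z k - c by rewrite subr_gt0 (lt_le_trans ca).
have cv : - v <= c by rewrite le_max lexx.
have bv : rate a p z k - c <= rate a p z k + v by lra.
have bv0 := lt_le_trans bc bv.
by rewrite divr_ge0 ?(ltW bv0)//= ler_wpM2l// lef_pV2 ?posrE.
Qed.

Lemma transform_Re_le K (z : {ffun 'I_K -> nat}) : `|complex.Re (transform z)| <= majorant z.
Proof. exact: le_trans (normr_Re_le _) (normc_prod_resolvent_le (rates_ok z)). Qed.

Lemma transform_Im_le K (z : {ffun 'I_K -> nat}) : `|complex.Im (transform z)| <= majorant z.
Proof. exact: le_trans (normr_Im_le _) (normc_prod_resolvent_le (rates_ok z)). Qed.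

Lemma csum_laplace_term K :
  csummable (positive_multiindices K) (laplace_term a p q u) /\
  ((1 - q 0%N) ^- K)%:C * csum (positive_multiindices K) (laplace_term a p q u) =
  (osc_mean K 1 0 - osc_mean K 0 0) +i* (osc_mean K 0 1 - osc_mean K 0 0).
Proof.
have [M HM] := majorant_bounded.
have PK : 0 <= (1 - q 0%N) ^+ K by rewrite exprn_ge0// ltW.
have ReE z : positive_multiindices K z -> complex.Re (laplace_term a p q u z) =
    (1 - q 0%N) ^+ K * (multi_pmf r z * complex.Re (transform z)).
  by move=> zp; rewrite laplace_termE// Re_realM mulrA.
have ImE z : positive_multiindices K z -> complex.Im (laplace_term a p q u z) =
    (1 - q 0%N) ^+ K * (multi_pmf r z * complex.Im (transform z)).
  by move=> zp; rewrite laplace_termE// Im_realM mulrA.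
have [sR eR] := rsum_multi_pmf r0 r00 r1 PK (HM K) (fun z _ => transform_Re_le z) ReE.
have [sI eI] := rsum_multi_pmf r0 r00 r1 PK (HM K) (fun z _ => transform_Im_le z) ImE.
split; first by split.
have nz : (1 - q 0%N) ^+ K != 0 by rewrite expf_neq0// gt_eqF.
have m00 : mean r (@majorant K) = osc_mean K 0 0.
  by apply: (eq_mean r00) => z _; rewrite !mul0r !addr0.
have m10 : mean r (fun z : {ffun 'I_K -> nat} => majorant z + complex.Re (transform z)) = osc_mean K 1 0.
  by apply: (eq_mean r00) => z _; rewrite mul0r mul1r addr0.
have m01 : mean r (fun z : {ffun 'I_K -> nat} => majorant z + complex.Im (transform z)) = osc_mean K 0 1.
  by apply: (eq_mean r00) => z _; rewrite mul0r mul1r add0r.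
rewrite /csum eR eI m00 m10 m01; apply/eqP; rewrite eq_complex/=.
by rewrite !mul0r subr0 addr0 !mulKf ?eqxx.
Qed.

Variables (d : measure_display) (T : measurableType d) (P : probability T R) (X : T -> R).
Hypothesis mX : measurable_fun setT X.
Hypothesis densX : is_density P X (limit_pdf a p r).

(** Both sides are integrals of one kernel, against the averaged densities and
    against the limit density, which is the density of X. *)
Lemma osc_mean_cvg c e : `|c| + `|e| <= 1 ->
  P.-integrable setT (fun t => (expR (- (v * X t)) * osc c e w (X t))%:E) /\
  osc_mean K c e @[K --> \oo] --> fine (\int[P]_t (expR (- (v * X t)) * osc c e w (X t))%:E)%E.
Proof.
move=> ce; have [I C] := osc_integral_cvg a0 p1 r0 r00 r1 w ce ua.
pose k x := expR (- (v * x)) * osc c e w x.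
have k0 x : 0 <= k x by rewrite mulr_ge0 ?expR_ge0//; case/andP: (osc_bound w x ce).
have mk D : measurable_fun D k.
  by apply: measurable_funM; [exact: measurable_expRM|exact: measurable_osc].
have E : (\int[P]_t (k (X t))%:E = \int[mu]_(x in `[0%R, +oo[) (k x * limit_pdf a p r x)%:E)%E.
  rewrite (ge0_integral_is_density (f := fun x => (k x)%:E) mX densX)//; last first.
    by apply/measurable_EFinP.
  rewrite [RHS]integral_mkcond; apply: eq_integral => x _; rewrite patchE.
  case: ifPn => [_|]; first by rewrite EFinM.
  rewrite notin_setE/= in_itv/= andbT => /negP; rewrite -ltNge => x0.
  by rewrite limit_pdf_lt0// mule0.
have fin : (\int[mu]_(x in `[0%R, +oo[) (k x * limit_pdf a p r x)%:E)%E \is a fin_num.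
  exact: integrable_fin_num I.
split.
  apply/integrableP; split.
    by apply/measurable_EFinP; exact: (measurableT_comp (mk setT) mX).
  under eq_integral do rewrite gee0_abs ?lee_fin ?k0//.
  by rewrite -/k E -ge0_fin_numE// ; apply: integral_ge0 => x _; rewrite lee_fin mulr_ge0// limit_pdf_ge0.
rewrite -/k E; apply: (fine_cvg (f := fun K => (osc_mean K c e)%:E)).
rewrite fineK//; apply: cvg_trans C; apply: near_eq_cvg; near=> K.
have [M HM] := majorant_bounded.
have GM (z : {ffun 'I_K -> nat}) : positive_multiindices K z -> 0 <= majorant z + (c * complex.Re (transform z) + e * complex.Im (transform z)) <= M + M.
  move=> zp; case/andP: (HM K z zp) => b0 bM.
  have h : `|c * complex.Re (transform z) + e * complex.Im (transform z)| <= majorant z.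
    apply: (le_trans (ler_normD _ _)); rewrite !normrM.
    apply: (@le_trans _ _ (`|c| * majorant z + `|e| * majorant z)).
      by apply: lerD; rewrite ler_wpM2l ?normr_ge0// ?transform_Re_le ?transform_Im_le.
    by rewrite -mulrDl ler_piMl.
  by move: h; rewrite ler_norml => /andP[h1 h2]; apply/andP; split; lra.
rewrite -(meanP r0 r00 r1 GM).1.
apply: (osc_integral_mean_pdf a0 p1 r0 r00 r1) => //.
near: K; exact: nbhs_infty_gt.
Unshelve. all: by end_near.
Qed.

Let one10 : `|1 : R| + `|0 : R| <= 1. Proof. by rewrite normr0 addr0 normr1. Qed.
Let one01 : `|0 : R| + `|1 : R| <= 1. Proof. by rewrite normr0 add0r normr1. Qed.
Let one00 : `|0 : R| + `|0 : R| <= 1. Proof. by rewrite normr0 addr0 ler01. Qed.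

Let wave c e t := expR (- (v * X t)) * osc c e w (X t).

Lemma Re_cexp t : complex.Re (cexp (- u * (X t)%:C)) = wave 1 0 t - wave 0 0 t.
Proof.
rewrite /wave /osc -mulrBr; case: u => x y; rewrite /cexp /=.
rewrite !mulr0 subr0 add0r mul0r subr0; congr (expR _ * _); last by ring.
by rewrite mulNr.
Qed.

Lemma Im_cexp t : complex.Im (cexp (- u * (X t)%:C)) = wave 0 1 t - wave 0 0 t.
Proof.
rewrite /wave /osc -mulrBr; case: u => x y; rewrite /cexp /=.
rewrite !mulr0 subr0 add0r mul0r addr0; congr (expR _ * _); last by ring.
by rewrite mulNr.
Qed.

Let expectation_wave (c e : R) (f : T -> R) : `|c| + `|e| <= 1 -> (forall t, f t = wave c e t - wave 0 0 t) ->
  P.-integrable setT (fun t => (f t)%:E) /\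
  osc_mean K c e - osc_mean K 0 0 @[K --> \oo] --> fine ('E_P[f])%E.
Proof.
move=> ce fE; have [I1 C1] := osc_mean_cvg ce; have [I0 C0] := osc_mean_cvg one00.
have E : (fun t => (f t)%:E) = ((fun t => (wave c e t)%:E) \- (fun t => (wave 0 0 t)%:E))%E.
  by apply/funext => t; rewrite fE EFinB.
split; first by rewrite E; exact: integrableB.
have -> : fine ('E_P[f])%E = fine (\int[P]_t (wave c e t)%:E)%E - fine (\int[P]_t (wave 0 0 t)%:E)%E.
  rewrite unlock E integralB// fineB//; exact: integrable_fin_num.
exact: cvgB.
Qed.

Lemma cintegrable_cexp : cintegrable P (fun t => cexp (- u * (X t)%:C)).
Proof.
by split; [exact: (expectation_wave one10 Re_cexp).1|exact: (expectation_wave one01 Im_cexp).1].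
Qed.

Lemma laplace_limit_cvg :
  (((1 - q 0%N) ^- K)%:C * csum (positive_multiindices K) (laplace_term a p q u) : R[i]^o)
    @[K --> \oo] --> (cexpectation P (fun t => cexp (- u * (X t)%:C)) : R[i]^o).
Proof.
have C1 := (expectation_wave one10 Re_cexp).2; have C2 := (expectation_wave one01 Im_cexp).2.
under eq_fun do rewrite (csum_laplace_term _).2.
exact: cvg_complex.
Qed.

End laplace_limit.

Theorem theorem3p20 (R : realType)
    (d : measure_display) (T : measurableType d) (P : probability T R)
    (n : nat) (hn : (1 <= n)%N) (lambda : R) (hlambda : 0 < lambda)
    (N : nat -> R -> {RV P >-> nat})
    (hN : forall i, (1 <= i <= n)%N -> poisson_process lambda (N i))
    (hNindep : mutually_independent P
       (fun i : 'I_n => process_sigma (N i.+1)))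
    (d' : measure_display) (T' : measurableType d') (P' : probability T' R)
    (Z : {RV P' >-> nat})
    (hZ : forall k : nat,
       P' [set w | Z w = k] = P [set w | mipp N n.-1 1 w = k%:R])
    (p : R) (hp : 1 < p) :
  let J : T -> R := fun w => fine (mipp_functional N n p w) in
  let q : nat -> R := fun k => fine (P' [set w | Z w = k]) in
  let Pn1 : R := fine (P' [set w | (1 <= Z w)%N]) in
  [/\ measurable_fun [set: T] (mipp_functional N n p),
      {ae P, forall w, (mipp_functional N n p w < +oo)%E},
      forall u : R[i], - (lambda * Pn1) < complex.Re u ->
        [/\ cintegrable P (fun w => cexp (- u * (J w)%:C)),
            forall K : nat, csummable (positive_multiindices K)
              (laplace_term (lambda * Pn1) p q u)
          & ((Pn1 ^- K)%:C * csum (positive_multiindices K)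
               (laplace_term (lambda * Pn1) p q u) : R[i]^o)
             @[K --> \oo] -->
            (cexpectation P (fun w => cexp (- u * (J w)%:C)) : R[i]^o)]
    & exists psi : R -> R,
        is_density P J psi /\
        forall x : R, 0 < x ->
          (forall K : nat, rsummable (positive_multiindices K)
             (density_term (lambda * Pn1) p q x)) /\
          lambda * (Pn1 ^ (1 - K%:Z) * rsum (positive_multiindices K)
             (density_term (lambda * Pn1) p q x))
            @[K --> \oo] --> psi x].
Proof.
move=> J q Pn1.
have qE : q = layers lambda n 1.
  apply/funext => k; rewrite /q; apply: (congr1 fine (y := (_)%:E)).
  by rewrite hZ (jump_law hn hlambda hN hNindep).
have qp : is_pmf q by rewrite qE; exact: layers_pmf.
have q1 : q 0%N < 1 by rewrite qE; exact: layers10_lt1.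
have PE : Pn1 = 1 - q 0%N.
  have mZ : measurable [set w | Z w = 0%N].
    rewrite -[[set w | _]]/(Z @^-1` [set 0%N]) -[X in measurable X]setTI.
    exact: measurable_funPT.
  rewrite /Pn1 (_ : [set w | (1 <= Z w)%N] = ~` [set w | Z w = 0%N]).
    rewrite probability_setC//= fineB//; exact: fin_num_measure.
  by apply/seteqP; split => w /=; rewrite lt0n => /eqP.
have JE : mipp_functional N n p = shifted_functional n p N 1 by [].
have a0 : 0 < lambda * Pn1 by rewrite PE mulr_gt0// subr_gt0.
have mJ : measurable_fun setT J by exact: (measurable_fine_functional hn hN hp).
have dJ : is_density P J (limit_pdf (lambda * Pn1) p (cond_pmf q)).
  by rewrite PE qE; exact: functional_density.
split.
- by rewrite JE; exact: (measurable_shifted_functional hn hN hp (ltn0Sn 0)).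
- exact: (functional_ae_finite hn hlambda hN hNindep hp).
- move=> u ua; split.
  + exact: (cintegrable_cexp a0 hp qp q1 ua mJ dJ).
  + by move=> K; exact: (csum_laplace_term a0 hp qp q1 ua K).1.
  + by have := laplace_limit_cvg a0 hp qp q1 ua mJ dJ; rewrite -PE.
exists (limit_pdf (lambda * Pn1) p (cond_pmf q)); split => // x x0.
have [r0 r00 r1] : [/\ forall k, 0 <= cond_pmf q k, cond_pmf q 0%N = 0 &
    (\esum_(k in [set: nat]) (cond_pmf q k)%:E = 1)%E].
  by have [? ?] := cond_pmfP qp q1; split.
have S K : rsummable (positive_multiindices K) (density_term (lambda * Pn1) p q x) /\
    lambda * (Pn1 ^ (1 - K%:Z) * rsum (positive_multiindices K) (density_term (lambda * Pn1) p q x)) =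
    mean_pdf (lambda * Pn1) p (cond_pmf q) K x.
  have hM (z : {ffun 'I_K -> nat}) := hypoexp_pdf_rates_bound a0 hp (z := z) (lexx 0) a0 (ltW x0).
  have P0 : 0 < Pn1 by rewrite PE subr_gt0.
  have c0 : 0 <= Pn1 ^+ K / (lambda * Pn1) by rewrite divr_ge0 ?exprn_ge0// ltW.
  have fE (z : {ffun 'I_K -> nat}) : positive_multiindices K z -> _ :=
    density_termE a0 hp q1 x (z := z).
  rewrite -PE in fE.
  have [? ->] := rsum_multi_pmf_ge0 r0 r00 r1 c0 hM fE; split => //.
  rewrite -/(mean_pdf _ _ _ _ _) expfzDr ?gt_eqF// expr1z -exprnN.
  have PK : Pn1 ^- K * Pn1 ^+ K = 1 by rewrite mulVf// expf_neq0// gt_eqF.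
  have aV : lambda * Pn1 / (lambda * Pn1) = 1 by rewrite divff// gt_eqF.
  rewrite [RHS](_ : _ = (lambda * Pn1 / (lambda * Pn1)) * (Pn1 ^- K * Pn1 ^+ K) * mean_pdf (lambda * Pn1) p (cond_pmf q) K x); first by ring.
  by rewrite aV PK !mul1r.
split; first by move=> K; exact: (S K).1.
under eq_fun do rewrite (S _).2.
exact: (cvg_mean_pdf a0 hp r0 r00 r1 (ltW x0)).
Qed.
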